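(* Let $\mathbb{F}$ be a field and let $n \geq p > r>0$ be integers. Assume that $|\mathbb{F}|>r+1$. Let $\mathcal{S}$ be an affine subspace of $\mathrm{M}_{n,p}(\mathbb{F})$ in which all the matrices have rank $r$, and whose dimension equals $d^{=}_r(n,p)$, the greatest possible dimension of an affine subspace of $\mathrm{M}_{n,p}(\mathbb{F})$ in which every matrix has rank $r$. (a) If $n>p$, then $\mathcal{S} \sim \widetilde{\mathcal{W}}^{(n,p)}$ for some optimal affine subspace $\mathcal{W}$ of $\mathrm{M}_r(\mathbb{F})$, and the equivalence class of $\mathcal{W}$ is uniquely determined by the equivalence class of $\mathcal{S}$. (b) If $n=p$, then there exist a partition $r=s+t$, with integers $s \geq 0$ and $t \geq 0$, and optimal affine subspaces $\mathcal{M} \subseteq \mathrm{M}_t(\mathbb{F})$ and $\mathcal{N} \subseteq \mathrm{M}_s(\mathbb{F})$ such that $\mathcal{S} \sim \mathcal{M} \wedge_{n,n} \mathcal{N}$; moreover, the pair $(s,t)$ and the equivalence classes of $\mathcal{M}$ and $\mathcal{N}$ are uniquely determined by the equivalence class of $\mathcal{S}$.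
   Context: $\mathrm{M}_{n,p}(\mathbb{F})$ is the $\mathbb{F}$-vector space of all $n\times p$ matrices with entries in $\mathbb{F}$, $\mathrm{M}_n(\mathbb{F})=\mathrm{M}_{n,n}(\mathbb{F})$, and $\mathrm{GL}_n(\mathbb{F})$ is the group of invertible elements of $\mathrm{M}_n(\mathbb{F})$. An affine subspace is a nonempty translate $A+V$ of a linear subspace $V$; its dimension is $\dim_{\mathbb{F}} V$. Equivalence: two subsets $\mathcal{X},\mathcal{Y}$ of $\mathrm{M}_{n,p}(\mathbb{F})$ are equivalent, written $\mathcal{X}\sim\mathcal{Y}$, if there exist $P\in \mathrm{GL}_n(\mathbb{F})$ and $Q\in\mathrm{GL}_p(\mathbb{F})$ such that $\mathcal{Y}=P\mathcal{X}Q$. Optimal subspace: for $s>0$, an affine subspace of $\mathrm{M}_s(\mathbb{F})$ is optimal if it is included in $\mathrm{GL}_s(\mathbb{F})$ and its dimension equals $\binom{s}{2}$. For $s=0$, by convention, $\mathrm{M}_0(\mathbb{F})$ consists of the single empty matrix (regarded as invertible), and its only affine subspace, itself, is considered optimal. Extended space: for an optimal affine subspace $\mathcal{W}$ of $\mathrm{M}_r(\mathbb{F})$, $$\widetilde{\mathcal{W}}^{(n,p)}:=\left\{\begin{bmatrix} W & [0]_{r \times (p-r)} \\ B & [0]_{(n-r) \times (p-r)} \end{bmatrix} \;\middle|\; W \in \mathcal{W}, \; B \in \mathrm{M}_{n-r,r}(\mathbb{F})\right\}\subseteq \mathrm{M}_{n,p}(\mathbb{F}).$$ Wedge: for a partition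 $r=s+t$ with $s,t\geq 0$ and optimal affine subspaces $\mathcal{M}\subseteq\mathrm{M}_t(\mathbb{F})$ and $\mathcal{N}\subseteq\mathrm{M}_s(\mathbb{F})$, $\mathcal{M}\wedge_{n,p}\mathcal{N}$ is the set of all matrices of $\mathrm{M}_{n,p}(\mathbb{F})$ of the form $$\begin{bmatrix} [?]_{s \times t} & N & [?]_{s \times (p-r)} \\ M & [0]_{t \times s} & [0]_{t \times (p-r)} \\ [?]_{(n-r) \times t} & [0]_{(n-r) \times s} & [0]_{(n-r) \times (p-r)} \end{bmatrix} \quad\text{with } M\in\mathcal{M},\ N\in\mathcal{N},$$ where the blocks marked $[?]$ are arbitrary matrices of the indicated sizes with entries in $\mathbb{F}$. Blocks with zero rows or zero columns are omitted. *)

(* Defs.v *)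
From HB Require Import structures.
From mathcomp Require Import all_boot all_order all_algebra.
From mathcomp Require Import boolp classical_sets functions cardinality.

Set Implicit Arguments.
Unset Strict Implicit.
Unset Printing Implicit Defensive.

Import GRing.Theory.
Local Open Scope classical_set_scope.
Local Open Scope ring_scope.

Definition affine_subspace_dim (F : fieldType) (n p : nat)
    (X : set 'M[F]_(n, p)) (d : nat) : Prop :=
  exists (A : 'M[F]_(n, p)) (V : {vspace 'M[F]_(n, p)}),
    \dim V = d /\ X = [set A + B | B in [set` V]].

Definition constant_rank (F : fieldType) (n p : nat)
    (X : set 'M[F]_(n, p)) (r : nat) : Prop :=
  forall M, X M -> \rank M = r.

(* [greatest_constant_rank_dim F n p r d] says that [d] is d^=_r(n,p). *)
Definition greatest_constant_rank_dim (F : fieldType) (n p r d : nat) : Prop :=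
  (exists X : set 'M[F]_(n, p), affine_subspace_dim X d /\ constant_rank X r) /\
  (forall (X : set 'M[F]_(n, p)) (k : nat),
     affine_subspace_dim X k -> constant_rank X r -> (k <= d)%N).

Definition mx_equivalent (F : fieldType) (n p : nat)
    (X Y : set 'M[F]_(n, p)) : Prop :=
  exists (P : 'M[F]_n) (Q : 'M[F]_p),
    [/\ P \in unitmx, Q \in unitmx & Y = [set P *m M *m Q | M in X]].

(* For [s = 0] the empty matrix is in [unitmx] (its determinant is 1) and
   ['C(0, 2) = 0], so that the unique affine subspace of ['M_0] is optimal. *)
Definition optimal (F : fieldType) (s : nat) (W : set 'M[F]_s) : Prop :=
  affine_subspace_dim W 'C(s, 2) /\ W `<=` [set M | M \in unitmx].

(* The equalities [en] and [ep] hold exactly when [r <= n] and [r <= p]; they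
   only serve to type the block matrix, and the set is empty otherwise. *)
Definition extended_space (F : fieldType) (n p r : nat)
    (W : set 'M[F]_r) : set 'M[F]_(n, p) :=
  [set X | exists (en : (r + (n - r))%N = n) (ep : (r + (p - r))%N = p)
             (A : 'M[F]_r) (B : 'M[F]_(n - r, r)),
      W A /\ X = castmx (en, ep) (block_mx A 0 B 0)].

Arguments extended_space {F} n p {r} W _.

(* The 3 x 3 block matrix with rows (A N C), (M 0 0), (D 0 0): row sizes
   s, t, n - (s + t) and column sizes t, s, p - (s + t). *)
Definition wedge (F : fieldType) (n p s t : nat)
    (MM : set 'M[F]_t) (NN : set 'M[F]_s) : set 'M[F]_(n, p) :=
  [set X | exists (en : (s + (t + (n - (s + t))))%N = n)
             (ep : (t + (s + (p - (s + t))))%N = p)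
             (M : 'M[F]_t) (N : 'M[F]_s) (A : 'M[F]_(s, t))
             (C : 'M[F]_(s, p - (s + t))) (D : 'M[F]_(n - (s + t), t)),
      [/\ MM M, NN N &
          X = castmx (en, ep) (block_mx A (row_mx N C) (col_mx M D) 0)]].

Arguments wedge {F} n p {s t} MM NN _.

(* Main.v *)
Require Import Defs.
From HB Require Import structures.
From mathcomp Require Import all_boot all_order all_algebra.
From mathcomp Require Import zify.
From mathcomp Require Import boolp classical_sets functions cardinality.

Set Implicit Arguments.
Unset Strict Implicit.
Unset Printing Implicit Defensive.

Import GRing.Theory.
Local Open Scope classical_set_scope.
Local Open Scope ring_scope.

(** Bring a matrix of [S] to the form [[1, 0], [0, 0]] and let [V] be the
    translation space, with blocks [A], [C] (upper right), [B] (lower left),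
    [D]; write [n = r + a] and [p = r + b], so that [b <= a].  The bordered
    minors of order [r + 1] of [1 + t M] are polynomials in [t] of degree at
    most [r + 1] with more than [r + 1] roots, hence zero; their coefficients
    give [D = 0], [B C = 0], [B A C = 0] and [B A A C = 0] on [V]
    ([corner_shift_coefs]).

    Two bounds now compete.  The matrices of [V] with [B = C = 0] form a space
    [W] such that [1 + W] is nonsingular, so that [dim W <= 'C(r, 2)]
    ([dim_unit_shift]).  The pairs [(B, C)] form a space on which [B C]
    vanishes, and matching each column of [C] with a row of [B] shows that its
    dimension is at most [r a], since [b c] is a hyperbolic quadratic form in a row [b]
    and a column [c] ([dim_isotropic_pairs]).  The sum of the two bounds is attained
    ([constant_rank_example]), so for [S] of greatest dimension both are
    equalities.

    The key to the equality cases is that the left factors [u] of the rank one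
    matrices [u l] of [W] do not span ([rank1_left_proper]).  For [c] outside
    the hyperplane that contains them, [W c] is a hyperplane when [W] is
    maximal, and a row [b] with [b c = 0] and [b W c = 0] vanishes
    ([orth_col_eq0]).  Applied to the pairs supported on one row and one column, which
    form a Lagrangian subspace, this yields a [W]-invariant subspace [E] of
    [F^r], the same for all rows and columns, such that the pairs are exactly
    those with [B E = 0] and [Im C] inside [E] ([lagrangian_split],
    [isotropic_pairs_split]).  Put [s = dim E] and [t = r - s].  When [b < a],
    counting dimensions gives [s = 0].

    In a basis adapted to [E], [W] is block triangular with maximal diagonal
    blocks [W1], [W2] and an arbitrary upper right block.  The conditions on
    [B A C] and [B A A C], with [W1] and [W2] varied, force the lower left
    block of every [A] to vanish ([split_shift_dl0]).  What remains are two
    independent problems of full rank: [1 + A22] on top of [B2], and [1 + A11]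
    next to [C1].  Each is solved by a row or column operation that makes the
    square block independent, modulo [W2] or [W1], of the rectangular one
    ([column_shift_linear]); after these operations [S] is a wedge.

    For uniqueness, the subspace [K] of the last [p - t] coordinates of the
    source and the subspace [G] of the first [s] coordinates of the target are
    recovered from the wedge alone ([wedge_frame_unique]).  The matrices of an
    equivalence between two wedges therefore respect them, and act on the
    blocks holding [M] and [N] separately ([wedge_classes_unique]).  The
    extended space of [W] is the wedge with [s = 0] ([extended_spaceE]). *)

(** * Linear algebra over a field with enough elements *)

Lemma dim_le_ker_img (F : fieldType) (aT rT : vectType F) (f : 'Hom(aT, rT))
    (U K : {vspace aT}) (I : {vspace rT}) :
  (forall u, u \in U -> f u = 0 -> u \in K) ->
  (forall u, u \in U -> f u \in I) -> (\dim U <= \dim K + \dim I)%N.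
Proof.
move=> kerK imgI; rewrite -(limg_ker_dim f U); apply: leq_add; apply: dimvS.
  by apply/subvP=> u /memv_capP[uU]; rewrite memv_ker => /eqP; apply: kerK.
by apply/subvP=> _ /memv_imgP[u uU ->]; apply: imgI.
Qed.

Lemma dim_le_inj (F : fieldType) (aT rT : vectType F) (f : 'Hom(aT, rT))
    (U : {vspace aT}) (I : {vspace rT}) :
  (forall u, u \in U -> f u = 0 -> u = 0) ->
  (forall u, u \in U -> f u \in I) -> (\dim U <= \dim I)%N.
Proof.
move=> injf imgI; have := @dim_le_ker_img F aT rT f U 0%VS I; rewrite dimv0.
by apply=> // u uU /(injf u uU) ->; rewrite mem0v.
Qed.

Lemma dim_fullmx (F : fieldType) m n : \dim {: 'M[F]_(m, n)} = (m * n)%N.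
Proof. by rewrite dimvf dim_matrix. Qed.

Lemma mx11_eq0 (F : fieldType) (A : 'M[F]_1) : (A == 0) = (A 0 0 == 0).
Proof.
apply/eqP/eqP=> [->|A0]; first by rewrite mxE.
by apply/matrixP=> i j; rewrite !ord1 mxE.
Qed.

(** Duality for subspaces: a column of the cokernel matrix of a basis of [U]
    detects [v]. *)
Lemma separation (F : fieldType) n (U : {vspace 'cV[F]_n}) (v : 'cV_n) :
  v \notin U ->
  exists y : 'rV_n, y *m v = 1%:M /\ forall u, u \in U -> y *m u = 0.
Proof.
move=> vU; pose B := \matrix_(i < \dim U) ((vbasis U)`_i)^T.
have subB u : (u^T <= B)%MS -> u \in U.
  case/submxP=> D uD; rewrite -[u]trmxK uD mulmx_sum_row linear_sum /=.
  apply: memv_suml => i _; rewrite linearZ /= memvZ // rowK trmxK vbasis_mem //.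
  by rewrite mem_nth // size_tuple.
have /rV0Pn[j wj] : v^T *m cokermx B != 0.
  by apply: contra vU => /eqP v0; apply: subB; rewrite submxE v0.
set c := (v^T *m cokermx B) 0 j in wj.
exists (c^-1 *: (col j (cokermx B))^T); split.
  apply/matrixP=> a b; rewrite !ord1 -scalemxAl mxE [X in _ * X]mxE.
  rewrite [RHS]mxE eqxx; apply: (mulfI wj); rewrite mulr1 mulrA divff // mul1r.
  by rewrite /c mxE; apply: eq_bigr => i _; rewrite !mxE mulrC.
move=> u uU; rewrite -scalemxAl; apply/eqP; rewrite scaler_eq0; apply/orP; right.
apply/eqP; apply: trmx_inj; rewrite trmx_mul trmxK trmx0.
have : (u^T <= B)%MS.
  rewrite (coord_vbasis uU) linear_sum /=; apply: summx_sub => i _.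
  by rewrite linearZ /= scalemx_sub // -[X in (X <= _)%MS](rowK (fun i => ((vbasis U)`_i)^T)) row_sub.
by rewrite submxE => /eqP uB; rewrite colE mulmxA uB mul0mx.
Qed.

(** A lower bound on the cardinality of [F], as an explicit list of scalars to be
    counted against the roots of polynomials. *)
Definition has_elements (F : fieldType) (k : nat) :=
  exists ts : seq F, uniq ts /\ (k <= size ts)%N.

Lemma has_elementsW (F : fieldType) k k' :
  (k' <= k)%N -> has_elements F k -> has_elements F k'.
Proof. by move=> le [ts [uts kts]]; exists ts; split=> //; apply: leq_trans kts. Qed.

(** A nonzero affine function [a + t b] has at most one root [t]. *)
Lemma avoid_roots (F : fieldType) (ps : seq (F * F)) :
  has_elements F (size ps).+1 -> (forall p, p \in ps -> p != (0, 0)) ->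
  exists t, forall p, p \in ps -> p.1 + t * p.2 != 0.
Proof.
case=> ts [uts sts] ps0; pose bad := [seq - p.1 / p.2 | p <- ps].
have : ~~ all [in bad] ts.
  apply/negP=> /allP sub; have := uniq_leq_size uts sub; rewrite size_map.
  by rewrite leqNgt sts.
case/allPn=> t _ /= tbad; exists t => p pps.
apply: contra tbad => /eqP e; apply/mapP; exists p => //.
have p2 : p.2 != 0.
  apply/eqP=> p2; have := ps0 p pps; move: e; rewrite p2 mulr0 addr0.
  by case: p {pps} p2 => a b /= -> ->; rewrite eqxx.
by rewrite -[LHS](mulfK p2); congr (_ / _); apply/eqP; rewrite -addr_eq0 addrC e.
Qed.

(** One form at a time: on the line through the point found so far and a point
    where the new form does not vanish, every form has at most one root. *)
Lemma avoid_hyperplanes (F : fieldType) r (ls : seq 'rV[F]_r) :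
  has_elements F (size ls) -> (forall l, l \in ls -> l != 0) ->
  exists x : 'cV_r, forall l, l \in ls -> l *m x != 0.
Proof.
elim: ls => [|l ls IH] hF ls0; first by exists 0.
have [||x xls] := IH.
- exact: has_elementsW hF.
- by move=> l' l'ls; apply: ls0; rewrite inE l'ls orbT.
have /rV0Pn[j lj] := ls0 l (mem_head _ _).
pose y : 'cV[F]_r := delta_mx j 0.
have ly : (l *m y) 0 0 != 0.
  by rewrite -[l *m _]colE mxE.
case: (eqVneq ((l *m x) 0 0) 0) => [lx0|lx0]; last first.
  exists x => l'; rewrite inE => /predU1P[->|/xls //].
  by rewrite mx11_eq0.
pose ps := [seq ((l' *m x) 0 0, (l' *m y) 0 0) | l' <- ls].
pose qs := [seq (q.2, q.1) | q <- ps].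
have [|q|t tq] := @avoid_roots F qs.
- by rewrite /qs /ps !size_map.
- case/mapP=> p /mapP[l' l'ls ->] -> /=; rewrite xpair_eqE negb_and.
  by have := xls _ l'ls; rewrite mx11_eq0 => ->; rewrite orbT.
exists (t *: x + y) => l'; rewrite mx11_eq0 inE => /predU1P[->|l'ls].
  by rewrite mulmxDr -scalemxAr mxE [X in X + _]mxE lx0 mulr0 add0r.
rewrite mulmxDr -scalemxAr mxE [X in X + _]mxE addrC.
apply: (tq ((l' *m y) 0 0, (l' *m x) 0 0)).
by apply/mapP; exists ((l' *m x) 0 0, (l' *m y) 0 0) => //; apply/mapP; exists l'.
Qed.

(** Starting from the kernel of the prescribed form, of dimension [r - 1], each
    further form can be chosen so as to lower the dimension of the common
    kernel. *)
Lemma select_forms (F : fieldType) r (T : eqType) (Z : T -> 'rV[F]_r)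
    (P : T -> Prop) (x0 : T) :
  (forall u : 'cV_r, u != 0 -> exists2 x, P x & Z x *m u != 0) ->
  P x0 -> Z x0 != 0 ->
  exists xs : seq T, [/\ (size xs <= r)%N, x0 \in xs,
    forall x, x \in xs -> P x &
    forall u : 'cV_r, (forall x, x \in xs -> Z x *m u = 0) -> u = 0].
Proof.
move=> sepZ Px0 Zx0.
pose ev x : 'Hom('cV[F]_r, 'M[F]_1) := linfun (mulmx (Z x)).
pose K (xs : seq T) : {vspace 'cV[F]_r} := (\bigcap_(x <- xs) lker (ev x))%VS.
have KP xs u : (u \in K xs) = all (fun x => Z x *m u == 0) xs.
  rewrite /K; elim: xs => [|x xs IH]; first by rewrite big_nil memvf.
  by rewrite big_cons memv_cap IH memv_ker lfunE.
suff main d xs : (\dim (K xs) <= d)%N -> x0 \in xs -> (forall x, x \in xs -> P x) ->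
    exists ys, [/\ (size ys <= size xs + d)%N, x0 \in ys,
      forall x, x \in ys -> P x & \dim (K ys) = 0%N].
  have [|||ys [sz x0ys Pys K0]] := main r.-1 [:: x0].
  - have /rV0Pn[j Zj] := Zx0.
    have r0 : (0 < r)%N by case: (r) j {Zj} => // -[].
    have ne : K [:: x0] != fullv.
      apply/eqP=> e; have : delta_mx j 0 \in K [:: x0] by rewrite e memvf.
      by rewrite KP /= -[Z x0 *m _]colE andbT mx11_eq0 mxE; apply/negP.
    have [] := dimv_leqif_eq (subvf (K [:: x0])).
    rewrite dim_fullmx muln1 => le eq.
    by rewrite -ltnS prednK // ltn_neqAle eq ne.
  - by rewrite inE.
  - by move=> x; rewrite inE => /eqP ->.
  exists ys; split=> //.
    have /rV0Pn[j Zj] := Zx0.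
    by move: sz; rewrite /= add1n prednK //; case: (r) j {Zj} => // -[].
  move=> u uys; apply/eqP; rewrite -memv0; suff /eqP <- : K ys == 0%VS.
    by rewrite KP; apply/allP=> x /uys ->.
  by rewrite -dimv_eq0 K0.
elim: d xs => [|d IH] xs dK x0xs Pxs.
  by exists xs; split=> //; [rewrite addn0 | move: dK; rewrite leqn0 => /eqP].
have [K0|K0] := eqVneq (\dim (K xs)) 0%N.
  by exists xs; split=> //; rewrite leq_addr.
have u0 : vpick (K xs) != 0 by rewrite vpick0 -dimv_eq0.
have [x Px Zx] := sepZ _ u0.
have [|||ys [sz x0ys Pys Ky]] := IH (x :: xs).
- rewrite -ltnS; apply: leq_trans dK; rewrite ltnNge; apply/negP=> le.
  have sub : (K (x :: xs) <= K xs)%VS.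
    by apply/subvP=> v; rewrite !KP /= => /andP[].
  have [_] := dimv_leqif_eq sub; rewrite eqn_leq le dimvS //= => /esym/eqP e.
  have : vpick (K xs) \in K (x :: xs) by rewrite e memv_pick.
  by rewrite KP /= (negPf Zx).
- by rewrite inE x0xs orbT.
- by move=> y; rewrite inE => /predU1P[->|/Pxs].
by exists ys; split=> //; rewrite (leq_trans sz) //= addSnnS.
Qed.

(** * Spaces of matrices [W] such that [1 + W] is nonsingular *)

(** Nonsingularity of all the matrices of [1 + W], phrased on vectors because it
    is used on invariant subspaces and on quotients. *)
Definition unit_shift (F : fieldType) r (W : {vspace 'M[F]_r}) :=
  forall M (x : 'cV_r), M \in W -> x + M *m x = 0 -> x = 0.

Definition trv (F : fieldType) m n (W : {vspace 'M[F]_(m, n)}) :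
  {vspace 'M[F]_(n, m)} := (linfun trmx @: W)%VS.

Lemma unitmx_injP (F : fieldType) r (A : 'M[F]_r) :
  A \in unitmx <-> forall x : 'cV_r, A *m x = 0 -> x = 0.
Proof.
split=> [uA x Ax|inj]; first by rewrite -[x](mulKmx uA) Ax mulmx0.
rewrite -unitmx_tr -row_free_unit; apply: inj_row_free => v vA; apply: trmx_inj.
by rewrite trmx0; apply: inj; apply: trmx_inj; rewrite trmx_mul trmxK vA trmx0.
Qed.

Lemma unit_shiftP (F : fieldType) r (W : {vspace 'M[F]_r}) :
  unit_shift W <-> forall M, M \in W -> 1%:M + M \in unitmx.
Proof.
split=> uW M; first by move=> MW; apply/unitmx_injP=> x; rewrite mulmxDl mul1mx; apply: uW.
by move=> x /uW/unitmx_injP inj; rewrite -{1}[x]mul1mx -mulmxDl; apply: inj.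
Qed.

Lemma mem_trv (F : fieldType) m n (W : {vspace 'M[F]_(m, n)}) M :
  (M \in trv W) = (M^T \in W).
Proof.
apply/memv_imgP/idP=> [[N NW ->]|MW]; first by rewrite lfunE trmxK.
by exists M^T; rewrite // lfunE /= trmxK.
Qed.

Lemma dim_trv (F : fieldType) m n (W : {vspace 'M[F]_(m, n)}) :
  \dim (trv W) = \dim W.
Proof.
apply: limg_dim_eq; apply/eqP; rewrite -subv0; apply/subvP=> M /memv_capP[_].
rewrite memv_ker lfunE /= memv0 => /eqP M0.
by rewrite -[M]trmxK M0 trmx0.
Qed.

Lemma unit_shift_trv (F : fieldType) r (W : {vspace 'M[F]_r}) :
  unit_shift W -> unit_shift (trv W).
Proof.
move=> /unit_shiftP uW; apply/unit_shiftP=> M; rewrite mem_trv => /uW.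
by rewrite -unitmx_tr linearD /= trmxK trmx1.
Qed.

(** If the left factors of the rank one matrices of [W] spanned, then some basis
    [u_j] would come with forms [l_j <> 0] such that [u_j l_j] is in [W].  A
    vector [x = sum c_j u_j] on which no [l_j] vanishes is then mapped to [- x]
    by [- sum (c_j / l_j x) u_j l_j], against the nonsingularity of [1 + W]. *)
Lemma rank1_left_proper (F : fieldType) r (W : {vspace 'M[F]_r}) :
  has_elements F r -> unit_shift W -> (0 < r)%N ->
  exists2 f : 'rV_r, f != 0 &
    forall (u : 'cV_r) (l : 'rV_r), l != 0 -> u *m l \in W -> f *m u = 0.
Proof.
move=> hF uW r0; apply: contrapT => none.
pose Z (p : 'cV[F]_r * 'rV[F]_r) := p.1^T.
pose P (p : 'cV[F]_r * 'rV[F]_r) := p.2 != 0 /\ p.1 *m p.2 \in W.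
have sepZ (w : 'cV_r) : w != 0 -> exists2 p, P p & Z p *m w != 0.
  move=> w0; apply: contrapT => no; apply: none; exists w^T.
    by rewrite -trmx0 (inj_eq trmx_inj).
  move=> u l l0 ulW; apply/eqP; apply: contrapT => /negP wu; apply: no.
  exists (u, l) => //; rewrite /Z /= -(inj_eq trmx_inj) trmx0 trmx_mul trmxK.
  by rewrite mx11_eq0 -mx11_eq0.
have [p0 Pp0 Zp0] : exists2 p, P p & Z p != 0.
  have [|p Pp Zp] := sepZ (const_mx 1).
    apply/eqP=> /matrixP/(_ (Ordinal r0) 0); rewrite !mxE => /eqP.
    by rewrite oner_eq0.
  by exists p => //; apply: contraNneq Zp => ->; rewrite mul0mx.
have [ps [sz p0ps Pps inj]] := select_forms sepZ Pp0 Zp0.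
have [||x lx] := @avoid_hyperplanes F r [seq p.2 | p <- ps].
- by rewrite size_map; apply: has_elementsW hF.
- by move=> _ /mapP[p /Pps[p2 _] ->].
have xspan : x \in <<[seq p.1 | p <- ps]>>%VS.
  apply: contrapT => /negP/separation[y [yx y0]].
  have y_eq0 : y = 0.
    apply: trmx_inj; rewrite trmx0; apply: inj => p pps.
    rewrite /Z -trmx_mul y0 ?trmx0 //.
    by apply: memv_span; apply/mapP; exists p.
  move: yx; rewrite y_eq0 mul0mx => /matrixP/(_ 0 0); rewrite !mxE eqxx => /eqP.
  by rewrite eq_sym oner_eq0.
pose X := in_tuple [seq p.1 | p <- ps].
have nthX (i : 'I_(size [seq p.1 | p <- ps])) :
    exists p, p \in ps /\ X`_i = p.1.
  have iX : X`_i \in [seq p.1 | p <- ps] by rewrite mem_nth.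
  by have /mapP[p pps ->] := iX; exists p.
have [q qP] := choice nthX.
pose c i := coord X i x.
have xE : x = \sum_i c i *: (q i).1.
  rewrite {1}(coord_span (X := X) xspan); apply: eq_bigr => i _.
  by rewrite (qP i).2.
pose M := - \sum_i (c i / ((q i).2 *m x) 0 0) *: ((q i).1 *m (q i).2).
have : x = 0.
  apply: (uW M).
    rewrite /M memvN; apply: memv_suml => i _; apply: memvZ.
    by have /Pps[] := (qP i).1.
  rewrite /M mulNmx mulmx_suml {1}xE -sumrB big1 // => i _.
  have kE : c i / ((q i).2 *m x) 0 0 * ((q i).2 *m x) 0 0 = c i.
    by rewrite divfK // -mx11_eq0; apply: lx; apply/mapP; exists (q i); case: (qP i).
  rewrite -scalemxAl -mulmxA; move: kE; set k := c i / _ => <-.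
  by rewrite -scalerA -[X in k *: X - _]mul_mx_scalar -mx11_scalar subrr.
by move=> x0; have := lx _ (map_f (fun p => p.2) p0ps); rewrite x0 mulmx0 eqxx.
Qed.

Lemma rank1_right_proper (F : fieldType) r (W : {vspace 'M[F]_r}) :
  has_elements F r -> unit_shift W -> (0 < r)%N ->
  exists2 e : 'cV_r, e != 0 &
    forall (u : 'cV_r) (l : 'rV_r), u != 0 -> u *m l \in W -> l *m e = 0.
Proof.
move=> hF /unit_shift_trv uW r0.
have [f f0 fP] := rank1_left_proper hF uW r0; exists f^T.
  by rewrite -trmx0 (inj_eq trmx_inj).
move=> u l u0 ulW; apply: trmx_inj; rewrite trmx_mul trmxK trmx0.
apply: (fP _ u^T); first by rewrite -trmx0 (inj_eq trmx_inj).
by rewrite mem_trv trmx_mul !trmxK.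
Qed.

Definition eqv (F : fieldType) m n (P : 'M[F]_m) (Q : 'M[F]_n)
    (V : {vspace 'M[F]_(m, n)}) : {vspace 'M[F]_(m, n)} :=
  (linfun (mulmxr Q \o mulmx P) @: V)%VS.

Lemma mem_eqv (F : fieldType) m n (P : 'M[F]_m) (Q : 'M[F]_n)
    (V : {vspace 'M[F]_(m, n)}) N : P \in unitmx -> Q \in unitmx ->
  (N \in eqv P Q V) = (invmx P *m N *m invmx Q \in V).
Proof.
move=> uP uQ; apply/memv_imgP/idP=> [[M MV ->]|NV].
  by rewrite lfunE /= !mulmxA mulVmx // mul1mx mulmxK.
by exists (invmx P *m N *m invmx Q); rewrite // lfunE /= !mulmxA mulmxV // mul1mx mulmxKV.
Qed.

Lemma dim_eqv (F : fieldType) m n (P : 'M[F]_m) (Q : 'M[F]_n)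
    (V : {vspace 'M[F]_(m, n)}) : P \in unitmx -> Q \in unitmx ->
  \dim (eqv P Q V) = \dim V.
Proof.
move=> uP uQ; apply: limg_dim_eq; apply/eqP; rewrite -subv0.
apply/subvP=> M /memv_capP[_]; rewrite memv_ker lfunE /= memv0 => /eqP PMQ.
by rewrite -[M](mulKmx uP) -[P *m M](mulmxK uQ) PMQ mul0mx mulmx0.
Qed.

Lemma unit_shift_eqv (F : fieldType) r (g : 'M[F]_r) (W : {vspace 'M[F]_r}) :
  g \in unitmx -> unit_shift W -> unit_shift (eqv (invmx g) g W).
Proof.
move=> ug uW N x; rewrite mem_eqv ?unitmx_inv // invmxK => NW xN.
have gx0 : g *m x = 0.
  by apply: (uW _ _ NW); rewrite !mulmxA mulmxKV // -mulmxA -mulmxDr xN mulmx0.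
by rewrite -[x](mulKmx ug) gx0 mulmx0.
Qed.

Lemma lsubmx_mul (F : fieldType) m n k1 k2 (A : 'M[F]_(m, n))
    (B : 'M[F]_(n, k1 + k2)) : lsubmx (A *m B) = A *m lsubmx B.
Proof. by rewrite -{1}[B]hsubmxK mul_mx_row row_mxKl. Qed.

Lemma unitmx_first_col (F : fieldType) k (c : 'cV[F]_(1 + k)) : c != 0 ->
  exists2 g : 'M_(1 + k), g \in unitmx & lsubmx g = c.
Proof.
move=> c0; pose e : 'rV[F]_(1 + k) := row_mx 1%:M 0.
have eT : e *m e^T = 1%:M by rewrite tr_row_mx mul_row_col trmx1 mulmx1 mul0mx addr0.
have /complete_unitmx[] : \rank (e *m (e^T *m c^T)) = \rank e.
  rewrite mulmxA eT mul1mx !rank_rV -(inj_eq trmx_inj) trmxK trmx0 c0.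
  suff -> : e != 0 by [].
  apply: contra_eq_neq eT => ->; rewrite mul0mx; apply/eqP=> /matrixP/(_ 0 0)/eqP.
  by rewrite !mxE eqxx eq_sym oner_eq0.
move=> g ug; rewrite mulmxA eT mul1mx => gE.
exists g^T; first by rewrite unitmx_tr.
rewrite -[g^T]mulmx1 lsubmx_mul; apply: trmx_inj; rewrite trmx_mul trmxK gE.
congr (_ *m _); rewrite (scalar_mx_block 1 k) block_mxEh row_mxKl tr_col_mx.
by rewrite trmx1 trmx0.
Qed.

(** The matrices of [X] that kill [c] act on the quotient by the line of [c],
    faithfully since no nonzero matrix of [X] has its image inside that line. *)
Lemma dim_le_quotient (F : fieldType) k (X : {vspace 'M[F]_(1 + k)})
    (c : 'cV_(1 + k)) (b : nat) :
  unit_shift X -> c != 0 -> (forall l : 'rV_(1 + k), c *m l \in X -> l = 0) ->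
  (forall Y : {vspace 'M[F]_k}, unit_shift Y -> \dim Y <= b)%N ->
  (\dim X <= b + \dim (linfun (mulmxr c) @: X))%N.
Proof.
move=> uX c0 good bound; have [g ug gc] := unitmx_first_col c0.
rewrite -(limg_ker_dim (linfun (mulmxr c)) X) leq_add2r.
pose f : 'Hom('M[F]_(1 + k), 'M[F]_k) :=
  linfun ((rsubmx \o dsubmx) \o (mulmxr g \o mulmx (invmx g))).
set X0 := (X :&: _)%VS.
have X0P M : M \in X0 -> M \in X /\ exists l K,
    invmx g *m M *m g = block_mx 0 l 0 K.
  case/memv_capP=> MX; rewrite memv_ker lfunE /= => /eqP Mc; split=> //.
  set N := invmx g *m M *m g.
  exists (usubmx (rsubmx N)), (dsubmx (rsubmx N)).
  have N0 : lsubmx N = 0 by rewrite lsubmx_mul gc -mulmxA Mc mulmx0.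
  by rewrite -[LHS]hsubmxK N0 block_mxEh vsubmxK col_mx0.
apply: (@leq_trans (\dim (f @: X0))).
  apply: (dim_le_inj (f := f)); last by move=> M MX; apply: memv_img.
  move=> M /X0P[MX [l [K e]]]; rewrite /f lfunE /= e -[rsubmx _]/(drsubmx _) block_mxKdr => K0.
  have MEc : M = c *m (row_mx 0 l *m invmx g).
    have <- : g *m col_mx 1%:M 0 = c.
      by rewrite -{1}[g]hsubmxK mul_row_col mulmx1 mulmx0 addr0.
    rewrite -!mulmxA (mulmxA _ (row_mx 0 l)).
    have -> : col_mx 1%:M 0 *m row_mx 0 l = invmx g *m M *m g.
      by rewrite e K0 mul_col_row !mul1mx !mul0mx.
    by rewrite !mulmxA mulmxV // mul1mx mulmxK.
  by rewrite MEc (good (row_mx 0 l *m invmx g)) ?mulmx0 // -MEc.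
apply: bound => K v /memv_imgP[M /X0P[MX [l [K' e]]] ->].
rewrite /f lfunE /= e -[rsubmx _]/(drsubmx _) block_mxKdr; suff: 1%:M + K' \in unitmx.
  by move/unitmx_injP=> inj vK; apply: inj; rewrite mulmxDl mul1mx.
have/unit_shiftP/(_ _ MX) : unit_shift X by [].
have -> : 1%:M + M = g *m (1%:M + block_mx 0 l 0 K') *m invmx g.
  by rewrite -e mulmxDr mulmx1 mulmxDl mulmxV // !mulmxA mulmxV // mul1mx mulmxK.
rewrite !unitmx_mul unitmx_inv ug andbT /=.
rewrite (scalar_mx_block 1 k) add_block_mx !add0r addr0 unitmxE det_ublock.
by rewrite det1 mul1r -unitmxE.
Qed.

Lemma dim_img_col (F : fieldType) r (X : {vspace 'M[F]_r}) (c : 'cV_r)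
    (b : 'rV_r) :
  b != 0 -> (forall M, M \in X -> b *m (M *m c) = 0) ->
  (\dim (linfun (mulmxr c) @: X) <= r.-1)%N.
Proof.
move=> b0 bX; set I := (_ @: _)%VS.
have ne : I != fullv.
  apply/eqP=> e; have /rV0Pn[j bj] := b0.
  have : delta_mx j 0 \in I by rewrite e memvf.
  case/memv_imgP=> M MX; rewrite lfunE /= => jE.
  by have := bX M MX; rewrite -jE -colE => /matrixP/(_ 0 0); rewrite !mxE => /eqP; apply/negP.
have [] := dimv_leqif_eq (subvf I); rewrite dim_fullmx muln1 => le eq.
by rewrite -ltnS (leq_trans _ (leqSpred r)) // ltn_neqAle eq ne.
Qed.

(** Induction along [dim_le_quotient], for a vector [c] outside the hyperplane of
    [rank1_left_proper]; there [X c] does not contain [c], since [c = M c] would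
    make [1 - M] singular. *)
Theorem dim_unit_shift (F : fieldType) r (X : {vspace 'M[F]_r}) :
  has_elements F r -> unit_shift X -> (\dim X <= 'C(r, 2))%N.
Proof.
elim: r X => [|r IH] X hF uX.
  by rewrite (leq_trans (dimvS (subvf X))) // dim_fullmx.
have [f f0 fP] := rank1_left_proper hF uX isT.
have /rV0Pn[j fj] := f0; pose c : 'cV[F]_r.+1 := delta_mx j 0.
have fc : f *m c != 0 by rewrite mx11_eq0 -colE mxE.
have c0 : c != 0 by apply: contraNneq fc => ->; rewrite mulmx0.
have good (l : 'rV_r.+1) : c *m l \in X -> l = 0.
  by move=> clX; apply/eqP; apply: contraNT fc => l0; apply/eqP; apply: fP clX.
have := dim_le_quotient uX c0 good (fun Y => IH Y (has_elementsW (leqnSn r) hF)).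
move=> /leq_trans; apply; rewrite binS bin1 leq_add2l.
have /separation[y [yc yX]] : c \notin (linfun (mulmxr c) @: X)%VS.
  apply: contraNN c0 => /memv_imgP[M MX]; rewrite lfunE /= => cE.
  by apply/eqP; apply: (uX (- M)); rewrite ?memvN // mulNmx -cE subrr.
apply: (@dim_img_col _ r.+1 _ _ y) => [|M MX].
  by apply: contra_eq_neq yc => ->; rewrite mul0mx; apply/eqP=> /matrixP/(_ 0 0)/eqP;
    rewrite !mxE eqxx eq_sym oner_eq0.
by apply: yX; apply/memv_imgP; exists M; rewrite // lfunE.
Qed.

(** When [F] has at least [r] elements, [dim_unit_shift] makes the dimension
    exactly ['C(r, 2)]: [1 + X] is an optimal affine space. *)
Definition max_unit_shift (F : fieldType) r (X : {vspace 'M[F]_r}) :=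
  unit_shift X /\ ('C(r, 2) <= \dim X)%N.

(** The space [X c] does not contain [c].  If a nonzero [b] killed both, [X c]
    would have codimension at least [2], too much for a maximal [X] in
    [dim_le_quotient]. *)
Lemma orth_col_eq0 (F : fieldType) r (X : {vspace 'M[F]_r}) (c : 'cV_r) (b : 'rV_r) :
  has_elements F r -> max_unit_shift X -> c != 0 ->
  (forall l : 'rV_r, c *m l \in X -> l = 0) ->
  b *m c = 0 -> (forall M, M \in X -> b *m (M *m c) = 0) -> b = 0.
Proof.
case: r X c b => [|r] X c b hF [uX dX] c0 good bc bX; first by rewrite thinmx0.
apply/eqP; apply: contraT => b0.
have hF' := has_elementsW (leqnSn r) hF.
have := dim_le_quotient uX c0 good (fun Y => dim_unit_shift hF').
move=> /(leq_trans dX); rewrite binS bin1 leq_add2l.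
set I := (_ @: _)%VS => le.
have cI : c \notin I.
  apply: contraNN c0 => /memv_imgP[M MX]; rewrite lfunE /= => cE.
  by apply/eqP; apply: (uX (- M)); rewrite ?memvN // mulNmx -cE subrr.
pose f := linfun (mulmx b : 'cV_r.+1 -> 'M_1).
have ker_lt : (r < \dim (lker f))%N.
  apply: leq_trans (dimvS (_ : (<[c]> + I <= _)%VS)).
    rewrite dimv_disjoint_sum; first by rewrite dim_vline c0 add1n ltnS.
    apply/eqP; rewrite -subv0; apply/subvP=> u /memv_capP[/vlineP[k ->] kcI].
    rewrite memv0 scaler_eq0 (negPf c0) orbF; apply: contraNT cI => k0.
    by rewrite -[c]scale1r -(mulVf k0) -scalerA memvZ.
  rewrite subv_add; apply/andP; split; apply/subvP=> u.
    by case/vlineP=> k ->; rewrite memv_ker lfunE /= -scalemxAr bc scaler0.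
  case/memv_imgP=> M MX ->; rewrite memv_ker !lfunE /= bX //.
have [] := dimv_leqif_eq (subvf (lker f)); rewrite dim_fullmx muln1 => le' eq.
have /eqP ker : lker f == fullv by rewrite -eq eqn_leq le'.
have /rV0Pn[j bj] := b0.
have : delta_mx j 0 \in lker f by rewrite ker memvf.
rewrite memv_ker lfunE /= -colE => /eqP/matrixP/(_ 0 0); rewrite !mxE => /eqP.
by rewrite (negPf bj).
Qed.

(** * Affine spaces of full column rank *)

Lemma first_row_unitmx (F : fieldType) k (l : 'rV[F]_(1 + k)) : l != 0 ->
  exists2 g : 'M_(1 + k), g \in unitmx & l *m g = row_mx 1%:M 0.
Proof.
move=> l0; have [|h uh hl] := @unitmx_first_col F k l^T.
  by rewrite -trmx0 (inj_eq trmx_inj).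
exists (invmx h^T); first by rewrite unitmx_inv unitmx_tr.
have -> : l = row_mx 1%:M 0 *m h^T.
  apply: trmx_inj; rewrite trmx_mul trmxK tr_row_mx trmx1 trmx0 -[h]hsubmxK hl.
  by rewrite mul_row_col mulmx1 mulmx0 addr0.
by rewrite mulmxK // unitmx_tr.
Qed.

(** In a basis where [l] is the first coordinate, the first column of [X]
    contributes at most [r] and the rest of the first row at most [r - 1]; when
    the latter is zero, the remaining block [K] is such that [1 + K] is
    nonsingular. *)
Lemma dim_inj_on_hyperplane (F : fieldType) r (X : {vspace 'M[F]_r}) (l : 'rV_r) :
  has_elements F r -> l != 0 ->
  (forall M (x : 'cV_r), M \in X -> l *m x = 0 -> x + M *m x = 0 -> x = 0) ->
  (\dim X <= 'C(r, 2) + r)%N.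
Proof.
case: r X l => [|k] X l hF; first by rewrite thinmx0 eqxx.
rewrite -[k.+1]/(1 + k)%N in X l *.
move=> l0 injX; have [g ug lg] := first_row_unitmx l0.
pose f := linfun (rsubmx \o (mulmxr g \o mulmx (invmx g)) :
  'M[F]_(1 + k) -> 'M[F]_(1 + k, k)).
have fE M : f M = rsubmx (invmx g *m M *m g) by rewrite lfunE.
pose K : {vspace 'M[F]_(1 + k)} := (linfun (mulmxr l : 'cV_(1 + k) -> _) @: fullv)%VS.
have dK : (\dim K <= k.+1)%N.
  have := limg_ker_dim (linfun (mulmxr l : 'cV_(1 + k) -> 'M_(1 + k))) fullv.
  by rewrite dim_fullmx muln1 => e; rewrite -[X in (_ <= X)%N]e leq_addl.
apply: leq_trans (dim_le_ker_img (f := f) (K := K) (I := (f @: X)%VS) _ _) _.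
- move=> M MX; rewrite fE; set N := invmx g *m M *m g => N0.
  apply/memv_imgP; exists (g *m lsubmx N); rewrite ?memvf // lfunE /=.
  have -> : l = row_mx 1%:M 0 *m invmx g by rewrite -lg mulmxK.
  rewrite mulmxA -(mulmxA g) mul_mx_row mulmx1 mulmx0 -N0 hsubmxK /N.
  by rewrite !mulmxA mulmxV // mul1mx mulmxK.
- by move=> M MX; apply: memv_img.
rewrite addnC leq_add //.
pose h := linfun (usubmx : 'M[F]_(1 + k, k) -> _).
pose dd := linfun (dsubmx : 'M[F]_(1 + k, k) -> _).
pose K2 := (f @: X :&: lker h)%VS.
apply: leq_trans (dim_le_ker_img (f := h) (K := K2) (I := fullv) _ _) _.
- by move=> N NI hN; rewrite memv_cap NI memv_ker hN eqxx.
- by move=> *; rewrite memvf.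
rewrite dim_fullmx mul1n binS bin1 leq_add2r.
apply: (@leq_trans (\dim (dd @: K2))).
  apply: (dim_le_inj (f := dd)); last by move=> N; apply: memv_img.
  move=> N /memv_capP[_]; rewrite memv_ker !lfunE /= => /eqP u0 d0.
  by rewrite -[N]vsubmxK u0 d0 col_mx0.
apply: dim_unit_shift; first exact: has_elementsW hF.
move=> _ v /memv_imgP[N /memv_capP[/memv_imgP[M MX ->]]] + ->.
rewrite memv_ker !lfunE /= => /eqP u0 vK.
pose x : 'cV[F]_(1 + k) := col_mx 0 v.
suff : g *m x = 0.
  move/(congr1 (mulmx (invmx g))); rewrite mulmx0 mulKmx // => /eqP.
  by rewrite col_mx_eq0 => /andP[_ /eqP].
apply: (injX M) => //.
  by rewrite mulmxA lg mul_row_col mulmx0 mul0mx addr0.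
set P := invmx g *m M *m g in u0 vK.
have -> : M *m (g *m x) = g *m (P *m x).
  by rewrite /P !mulmxA mulmxV // mul1mx.
rewrite -mulmxDr -[P]hsubmxK mul_row_col mulmx0 add0r -[rsubmx P]vsubmxK u0.
by rewrite mul_col_mx mul0mx add_col_mx addr0 vK col_mx0 mulmx0.
Qed.

Lemma neq0_11 (F : fieldType) : 1%:M != 0 :> 'M[F]_1.
Proof. by rewrite mx11_eq0 !mxE eqxx oner_eq0. Qed.

(** Here [A l], taken modulo [X], sits on top of one extra row [l].  Injectivity
    says that the vector [(x, 0)] misses the subspace of all the vectors
    [(A l x + M x, l x)]; a form separating them is the pair [(z, - w)]. *)
Lemma row_shift_forms (F : fieldType) r (X : {vspace 'M[F]_r})
    (A : 'Hom('rV[F]_r, 'M[F]_r)) (x : 'cV_r) :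
  (forall l M, M \in X -> x + (A l + M) *m x = 0 -> l *m x = 0 -> x = 0) ->
  x != 0 ->
  exists (z : 'rV_r) (w : F), [/\ z *m x = 1%:M,
    forall M, M \in X -> z *m (M *m x) = 0 &
    forall l, z *m (A l *m x) = w *: (l *m x)].
Proof.
move=> injx x0.
pose f := linfun (mulmx (col_mx 1%:M 0 : 'M_(r + 1, r)) \o mulmxr x : 'M[F]_r -> 'cV[F]_(r + 1)).
pose g1 : 'Hom('rV[F]_r, 'cV[F]_(r + 1)) := (f \o A)%VF.
pose g2 := linfun (mulmx (col_mx 0 1%:M : 'M_(r + 1, 1)) \o mulmxr x : 'rV[F]_r -> 'cV[F]_(r + 1)).
have fE M : f M = col_mx (M *m x) 0.
  by rewrite lfunE /= mul_col_mx mul1mx mul0mx.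
have gE l : (g1 + g2) l = col_mx (A l *m x) (l *m x).
  rewrite add_lfunE comp_lfunE fE lfunE /= mul_col_mx mul0mx mul1mx add_col_mx.
  by rewrite addr0 add0r.
pose U := (f @: X + (g1 + g2)%R @: fullv)%VS.
have : col_mx x 0 \notin U.
  apply: contraNN x0 => /memv_addP[_ /memv_imgP[M MX ->] [_ /memv_imgP[l _ ->]]].
  rewrite fE gE add_col_mx add0r => /eq_col_mx[xE lx].
  apply/eqP; apply: (injx (- l) (- M)); rewrite ?memvN // ?mulNmx -?lx ?oppr0 //.
  by rewrite linearN /= -opprD mulNmx mulmxDl addrC [_ *m x + _]addrC -xE addNr.
case/separation=> y [yx yU]; exists (lsubmx y), (- (rsubmx y) 0 0).
move: yx yU; rewrite -[y]hsubmxK row_mxKl row_mxKr mul_row_col mulmx0 addr0 => yx yU.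
split=> // [M MX|l].
  rewrite -[LHS]addr0 -[in X in _ + X](mulmx0 _ (rsubmx y)) -mul_row_col -fE; apply: yU.
  by rewrite -[f M]addr0 memv_add ?mem0v ?memv_img.
have : lsubmx y *m (A l *m x) + rsubmx y *m (l *m x) = 0.
  rewrite -mul_row_col -gE; apply: yU.
  by rewrite -[X in X \in _]add0r memv_add ?mem0v ?memv_img ?memvf.
move/eqP; rewrite addr_eq0 => /eqP ->.
by rewrite {1}[rsubmx y]mx11_scalar mul_scalar_mx scaleNr.
Qed.

Lemma dim_add_line (F : fieldType) (vT : vectType F) (X : {vspace vT}) (N : vT) :
  N \notin X -> \dim (X + <[N]>) = (\dim X).+1.
Proof.
move=> NX; rewrite dimv_disjoint_sum.
  by rewrite dim_vline (_ : N != 0) ?addn1 //; apply: contraNneq NX => ->; rewrite mem0v.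
apply/eqP; rewrite -subv0; apply/subvP=> u /memv_capP[uX /vlineP[k uE]].
rewrite memv0 uE; have [->|k0] := eqVneq k 0; first by rewrite scale0r.
by case/negP: NX; rewrite -[N]scale1r -(mulVf k0) -scalerA memvZ // -uE.
Qed.

(** The forms [z] still certify that the matrices of [1 + (X + <[N]>)] are
    nonsingular, so that [N] cannot enlarge a maximal [X]. *)
Lemma max_unit_shift_mem (F : fieldType) r (X : {vspace 'M[F]_r}) (N : 'M_r) :
  has_elements F r -> max_unit_shift X ->
  (forall (x : 'cV_r), x != 0 -> exists z : 'rV_r,
     [/\ z *m x = 1%:M, forall M, M \in X -> z *m (M *m x) = 0 & z *m (N *m x) = 0]) ->
  N \in X.
Proof.
move=> hF [uX dX] zP; apply: contraT => NX.
have : (\dim (X + <[N]>) <= 'C(r, 2))%N.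
  apply: dim_unit_shift => // Q x /memv_addP[M MX [Nk /vlineP[k ->] ->]] e.
  apply/eqP; apply: contraT => /zP[z [zx zX zN]].
  have := congr1 (mulmx z) e; rewrite mulmx0 mulmxDr zx mulmxDl mulmxDr zX //.
  by rewrite -scalemxAl -scalemxAr zN scaler0 !addr0 => /eqP; rewrite (negPf (neq0_11 _)).
by rewrite dim_add_line // => /leq_trans/(_ dX); rewrite ltnn.
Qed.

(** If [u l] is in [X] for no nonzero [u], then [X] and the matrices [u l] span a
    space of the largest dimension that [dim_inj_on_hyperplane] allows on the
    kernel of [l]; the forms [z] show that [N] can be added to it. *)
Lemma row_shift_on_kernel (F : fieldType) r (X : {vspace 'M[F]_r}) (N : 'M_r) (l : 'rV_r) :
  has_elements F r -> max_unit_shift X -> l != 0 ->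
  (forall u : 'cV_r, u *m l \in X -> u = 0) ->
  (forall x : 'cV_r, x != 0 -> l *m x = 0 -> exists z : 'rV_r,
     [/\ z *m x = 1%:M, forall M, M \in X -> z *m (M *m x) = 0 & z *m (N *m x) = 0]) ->
  exists v : 'cV_r, N - v *m l \in X.
Proof.
move=> hF [uX dX] l0 good zP.
pose h := linfun (mulmxr l : 'cV_r -> 'M_r).
pose L := (h @: fullv)%VS.
have dL : \dim L = r.
  rewrite limg_dim_eq ?dim_fullmx ?muln1 //; apply/eqP; rewrite -subv0.
  apply/subvP=> u; rewrite capfv memv_ker lfunE /= memv0 => /eqP ul.
  by rewrite (good u) // ul mem0v.
have dXL : (\dim (X + L) = \dim X + r)%N.
  rewrite dimv_disjoint_sum ?dL //; apply/eqP; rewrite -subv0.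
  apply/subvP=> M /memv_capP[+ /memv_imgP[u _ ME]].
  by rewrite ME lfunE /= memv0 => /good ->; rewrite mul0mx.
have : N \in (X + L)%VS.
  apply: contraT => NX.
  have : (\dim (X + L + <[N]>) <= 'C(r, 2) + r)%N.
    apply: (dim_inj_on_hyperplane hF l0) => Q x.
    case/memv_addP=> ML /memv_addP[M MX [Lu /memv_imgP[u _ ->] ->]] [Nk /vlineP[k ->] ->].
    move=> lx e; apply/eqP; apply: contraT => /zP/(_ lx)[z [zx zX zN]].
    have := congr1 (mulmx z) e; rewrite mulmx0 mulmxDr zx !mulmxDl !mulmxDr zX //.
    rewrite lfunE /= -mulmxA lx !mulmx0 -scalemxAl -scalemxAr zN scaler0 !addr0.
    by move/eqP; rewrite (negPf (neq0_11 _)).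
  by rewrite dim_add_line // dXL ltnNge leq_add2r dX.
case/memv_addP=> M MX [_ /memv_imgP[v _ ->] ->]; exists v.
by rewrite lfunE /= addrK.
Qed.

(** For generic [l], [row_shift_on_kernel] yields [v] with [A l - v l] in [X].
    Evaluating at [x] with [l x <> 0] gives [z_x v = w_x], whatever [l] is, and
    at most [r] of these equations determine [v]: hence [v] is the same for all
    [l] that vanish at none of these [x], and every [m] is a combination of two
    such forms. *)
Lemma row_shift_linear (F : fieldType) r (X : {vspace 'M[F]_r})
    (A : 'Hom('rV[F]_r, 'M[F]_r)) :
  has_elements F r.+2 -> max_unit_shift X ->
  (forall l M (x : 'cV_r), M \in X -> x + (A l + M) *m x = 0 -> l *m x = 0 -> x = 0) ->
  exists v : 'cV_r, forall l, A l - v *m l \in X.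
Proof.
move=> hF2 maxX injA; have hF : has_elements F r by apply: has_elementsW hF2; rewrite ltnW.
case: (posnP r) => [r0|r0].
  exists 0 => l; rewrite (_ : _ - _ = 0) ?mem0v //.
  by apply/matrixP=> i; have := ltn_ord i; rewrite {2}r0.
have [e e0 eP] := rank1_right_proper hF maxX.1 r0.
have forms (x : 'cV_r) : exists zw : 'rV_r * F, x != 0 -> [/\ zw.1 *m x = 1%:M,
    forall M, M \in X -> zw.1 *m (M *m x) = 0 &
    forall l, zw.1 *m (A l *m x) = zw.2 *: (l *m x)].
  have [->|x0] := eqVneq x 0; first by exists (0, 0).
  have [z [w zwP]] := row_shift_forms (fun l M => @injA l M x) x0.
  by exists (z, w).
have [zw zwP] := choice forms; pose z x := (zw x).1; pose w x := (zw x).2.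
have good (l : 'rV_r) : l *m e != 0 -> forall u : 'cV_r, u *m l \in X -> u = 0.
  by move=> le u ul; apply/eqP; apply: contraNT le => u0; apply/eqP; apply: eP u0 ul.
have vP (l : 'rV_r) : l *m e != 0 -> exists v : 'cV_r, A l - v *m l \in X.
  move=> le; apply: row_shift_on_kernel (good _ le) _ => //.
    by apply: contraNneq le => ->; rewrite mul0mx.
  move=> x x0 lx; have [zx zX zA] := zwP x x0; exists (z x); split=> //.
  by rewrite zA lx scaler0.
have zv (l : 'rV_r) (v : 'cV_r) (x : 'cV_r) :
    A l - v *m l \in X -> l *m x != 0 -> z x *m v = (w x)%:M.
  move=> Av lx; have x0 : x != 0 by apply: contraNneq lx => ->; rewrite mulmx0.
  have [zx zX zA] := zwP x x0; have := zX _ Av; rewrite mulmxBl mulmxBr zA -mulmxA.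
  move/eqP; rewrite subr_eq0 => /eqP; rewrite !(mulmxA (z x)) [l *m x]mx11_scalar.
  rewrite mul_mx_scalar -mul_scalar_mx -scalar_mxM mulrC => zvE.
  apply: (@scalerI _ _ ((l *m x) 0 0)); first by rewrite -mx11_eq0.
  by rewrite -zvE scale_scalar_mx.
have /rV0Pn[j ej] : e^T != 0 by rewrite -trmx0 (inj_eq trmx_inj).
pose l0 : 'rV[F]_r := delta_mx 0 j.
have l0e : l0 *m e != 0 by rewrite -rowE mx11_eq0 mxE; rewrite mxE in ej.
have [v Av] := vP l0 l0e; exists v.
(* Keeping [e] among the [x] makes the condition [l e <> 0] one of the at most
   [r] conditions [l x <> 0]. *)
have [||| xs [sz exs Pxs inj]] := @select_forms F r _ z (fun x => l0 *m x != 0) e.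
- move=> u u0; apply: contrapT => no; case/negP: u0; apply/eqP.
  apply: (good _ l0e); apply: max_unit_shift_mem => // x x0.
  have [zx zX _] := zwP x x0; exists (z x); split=> //.
  rewrite -mulmxA mulmxA; have [->|lx] := eqVneq (l0 *m x) 0; first by rewrite mulmx0.
  rewrite (_ : z x *m u = 0) ?mul0mx //; apply/eqP; apply: contrapT => /negP zu.
  by apply: no; exists x.
- by [].
- have [zx _ _] := zwP e e0; apply: contra_eq_neq zx => z0.
  by rewrite /z in z0; rewrite z0 mul0mx eq_sym neq0_11.
have generic (l : 'rV_r) : (forall x, x \in xs -> l *m x != 0) -> A l - v *m l \in X.
  move=> lxs; have [v' Av'] := vP l (lxs e exs).
  suff -> : v = v' by [].
  apply/eqP; rewrite -subr_eq0; apply/eqP; apply: inj => x xxs.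
  by rewrite mulmxBr (zv _ _ _ Av (Pxs _ xxs)) (zv _ _ _ Av' (lxs x xxs)) subrr.
move=> m.
(* The pair [(0, 1)] excludes [t = 0]. *)
pose ps := (0, 1) :: [seq ((l0 *m x) 0 0, (m *m x) 0 0) | x <- xs].
have [||t tP] := @avoid_roots F ps.
- by apply: has_elementsW hF2; rewrite /= size_map ltnS ltnS.
- move=> p; rewrite inE => /predU1P[->|/mapP[x xxs ->]].
    by rewrite xpair_eqE negb_and oner_eq0 orbT.
  by rewrite xpair_eqE negb_and -mx11_eq0 Pxs.
have t0 : t != 0.
  by have := tP (0, 1); rewrite mem_head /= add0r mulr1; apply.
have : A (l0 + t *: m) - v *m (l0 + t *: m) \in X.
  apply: generic => x xxs; rewrite mulmxDl -scalemxAl mx11_eq0 mxE [X in _ + X]mxE.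
  apply: (tP ((l0 *m x) 0 0, (m *m x) 0 0)); rewrite inE; apply/orP; right.
  by apply/mapP; exists x.
rewrite linearD linearZ mulmxDr -scalemxAr opprD addrACA -scalerBr => AX.
have tAX : t *: (A m - v *m m) \in X.
  by rewrite -[X in X \in _](addKr (A l0 - v *m l0)) memvD ?memvN.
by rewrite -[X in X \in _]scale1r -(mulVf t0) -scalerA memvZ.
Qed.

Lemma mulmx_sum_col_row (F : fieldType) m n p (A : 'M[F]_(m, n)) (B : 'M_(n, p)) :
  A *m B = \sum_i col i A *m row i B.
Proof.
apply/matrixP=> i j; rewrite summxE mxE; apply: eq_bigr => k _.
by rewrite mxE big_ord1 !mxE.
Qed.

(** Full column rank: [R K B] stands for the membership of [K] on top of [B] in a
    linear space, and the last hypothesis says that [1 + K] on top of [B] is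
    injective.  Restricting [R] to the [B] with a single nonzero row reduces this
    to [row_shift_linear], which provides the columns of [Y]. *)
Lemma column_shift_linear (F : fieldType) t a (X : {vspace 'M[F]_t})
    (R : 'M[F]_t -> 'M[F]_(a, t) -> Prop) :
  has_elements F t.+2 -> max_unit_shift X ->
  (forall k K B K' B', R K B -> R K' B' -> R (k *: K + K') (k *: B + B')) ->
  (forall K, K \in X -> R K 0) -> (forall B, exists K, R K B) ->
  (forall K B (x : 'cV_t), R K B -> x + K *m x = 0 -> B *m x = 0 -> x = 0) ->
  exists Y : 'M_(t, a), forall K B, R K B <-> K - Y *m B \in X.
Proof.
move=> hF maxX Rlin RX Rsurj Rinj.
have R0 : R 0 0 by apply: RX; rewrite mem0v.
have RD K B K' B' : R K B -> R K' B' -> R (K + K') (B + B').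
  by move=> h h'; have := Rlin 1 _ _ _ _ h h'; rewrite !scale1r.
have RZ k K B : R K B -> R (k *: K) (k *: B).
  by move=> h; have := Rlin k _ _ _ _ h R0; rewrite !addr0.
have Rsum (I : finType) (k : I -> F) (K : I -> 'M_t) B :
    (forall i, R (K i) (B i)) -> R (\sum_i k i *: K i) (\sum_i k i *: B i).
  move=> h; elim/big_ind2: _ => // [*|i _]; [exact: RD | exact: RZ].
have XR K : R K 0 -> K \in X.
  move=> RK; apply: contraT => KX.
  have : (\dim (X + <[K]>) <= 'C(t, 2))%N.
    apply: dim_unit_shift; first by apply: has_elementsW hF; rewrite ltnW.
    move=> Q x /memv_addP[M MX [Kk /vlineP[k ->] ->]] e.
    apply: (Rinj _ 0 x) e _; last by rewrite mul0mx.
    have := Rlin k _ _ _ _ RK (RX _ MX).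
    by rewrite scaler0 addr0 addrC.
  by rewrite dim_add_line // => /leq_trans/(_ maxX.2); rewrite ltnn.
have [T RT] := choice (fun ij : 'I_a * 'I_t => Rsurj (delta_mx ij.1 ij.2)).
pose A i := linfun (vec_mx \o mulmxr (\matrix_(j < t) mxvec (T (i, j)))
   : 'rV[F]_t -> 'M[F]_t).
have AE i l : A i l = \sum_j l 0 j *: T (i, j).
  rewrite lfunE /= mulmx_sum_row linear_sum /=; apply: eq_bigr => j _.
  by rewrite linearZ /= rowK mxvecK.
have RA i (l : 'rV_t) : R (A i l) (delta_mx i 0 *m l).
  rewrite AE (_ : _ *m l = \sum_j l 0 j *: delta_mx i j).
    by apply: Rsum => j; apply: RT (i, j).
  rewrite [l in LHS]row_sum_delta mulmx_sumr; apply: eq_bigr => j _.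
  by rewrite -scalemxAr mul_delta_mx.
have vP i : exists v : 'cV_t, forall l, A i l - v *m l \in X.
  apply: row_shift_linear => // l M x MX e lx.
  apply: (Rinj _ (delta_mx i 0 *m l + 0) x) e _; last first.
    by rewrite addr0 -mulmxA lx mulmx0.
  by apply: RD; [apply: RA | apply: RX].
have [v {}vP] := choice vP; pose Y := (\matrix_i (v i)^T)^T.
have colY i : col i Y = v i by rewrite -tr_row rowK trmxK.
exists Y => K B; pose K0 := \sum_i A i (row i B).
have RK0 : R K0 B.
  have -> : B = \sum_i 1 *: (delta_mx i 0 *m row i B).
    rewrite -{1}[B]mul1mx mulmx_sum_col_row; apply: eq_bigr => i _.
    by rewrite scale1r col1.
  have -> : K0 = \sum_i 1 *: A i (row i B) by apply: eq_bigr => i _; rewrite scale1r.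
  by apply: Rsum => i; apply: RA.
have K0X : K0 - Y *m B \in X.
  rewrite mulmx_sum_col_row -sumrB; apply: memv_suml => i _.
  by rewrite colY.
split=> [RK|KX].
  have : K - K0 \in X.
    by apply: XR; have := RD _ _ _ _ RK (RZ (-1) _ _ RK0); rewrite !scaleN1r subrr.
  by move=> KK0; have := memvD KK0 K0X; rewrite addrA subrK.
have : K - K0 \in X by have := memvB KX K0X; rewrite opprB addrA subrK.
by move/RX=> /RD/(_ RK0); rewrite subrK add0r.
Qed.

(** * Second order conditions for bounded rank *)

Lemma size_det_affine (F : fieldType) n (P : 'M[{poly F}]_n) :
  (forall i j, (size (P i j) <= 2)%N) -> (size (\det P) <= n.+1)%N.
Proof.
move=> P2; rewrite /determinant; apply: (leq_trans (size_sum _ _ _)).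
apply/bigmax_leqP=> s _; rewrite -signr_odd mulr_sign.
rewrite (fun_if (fun p : {poly F} => size p)) size_polyN if_same.
apply: (leq_trans (size_poly_prod_leq _ _)).
rewrite leq_subLR card_ord addnS ltnS.
apply: (@leq_trans (\sum_(i < n) 2)); first by apply: leq_sum => i _.
by rewrite sum_nat_const card_ord muln2 addnn.
Qed.

Lemma poly_mx_coef (F : fieldType) m n p (A : 'M[F]_(m, n)) (G : 'M[{poly F}]_(n, p)) k :
  map_mx (coefp k) (map_mx polyC A *m G) = A *m map_mx (coefp k) G.
Proof.
apply/matrixP=> i j; rewrite !mxE /= coef_sum; apply: eq_bigr => l _.
by rewrite !mxE coefCM.
Qed.

(** The determinant is a polynomial in [t] of degree at most [r + 1] with [r + 2]
    roots.  Over [F[t]] its vanishing reads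
    [D det (1 + t A) = t B adj (1 + t A) C], and the coefficients [G_k] of
    [adj (1 + t A) C] satisfy [G_0 = C] and [G_(k+1) = d_(k+1) C - A G_k], where
    [d_k] are those of [det (1 + t A)]. *)
Lemma bordered_det_coefs (F : fieldType) r (A : 'M[F]_r) (B : 'rV_r) (C : 'cV_r)
    (D : 'M_1) :
  has_elements F r.+2 ->
  (forall t, \det (block_mx (1%:M + t *: A) (t *: C) (t *: B) (t *: D)) = 0) ->
  [/\ D = 0, B *m C = 0, B *m (A *m C) = 0 & B *m (A *m (A *m C)) = 0].
Proof.
move=> [ts [uts sts]] det0.
pose X : 'M[{poly F}]_r := 1%:M + 'X *: map_mx polyC A.
pose P := block_mx X ('X *: map_mx polyC C) ('X *: map_mx polyC B) ('X *: map_mx polyC D).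
have detP : \det P = 0.
  apply: (@roots_geq_poly_eq0 _ _ ts) => //.
    apply/allP=> t _; rewrite /root.
    have -> : (\det P).[t] = \det (map_mx (horner_eval t) P).
      by rewrite det_map_mx.
    rewrite map_block_mx map_mxD map_mx1 !map_mxZ /= /horner_eval hornerX.
    rewrite -!map_mx_comp.
    have mapC m n (M : 'M[F]_(m, n)) : map_mx (horner_eval t \o polyC) M = M.
      by apply/matrixP=> i j; rewrite mxE /= /horner_eval hornerC.
    by rewrite !mapC det0.
  apply: leq_trans sts; apply: leq_trans (size_det_affine _) _; last by rewrite addn1.
  have s2 (b c : F) : (size (b%:P + 'X * c%:P)%R <= 2)%N.
    by rewrite addrC mulrC size_MXaddC; case: ifP => // _; rewrite ltnS size_polyC leq_b1.
  have s2' (c : F) : (size ('X * c%:P : {poly F})%R <= 2)%N by rewrite -[_ * _]add0r s2.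
  move=> i j; rewrite !mxE; case: splitP => i' _; rewrite !mxE; case: splitP => j' _;
    rewrite !mxE ?s2' // -[_ *+ _]/(_ *+ _) -polyC1 -polyCMn s2 //.
have detX0 : (\det X)`_0 = 1.
  have -> : (\det X)`_0 = \det (map_mx (horner_eval 0) X).
    by rewrite det_map_mx /= /horner_eval horner_coef0.
  rewrite map_mxD map_mx1 map_mxZ /= /horner_eval hornerX scale0r addr0 det1 //.
have detX : \det X != 0 by apply: contra_eq_neq detX0 => ->; rewrite coef0 eq_sym oner_eq0.
pose G := \adj X *m map_mx polyC C.
pose u := 'X *: map_mx polyC C; pose v := 'X *: map_mx polyC B.
pose d := 'X *: (map_mx polyC D : 'M_1).
have XG : X *m G = \det X *: map_mx polyC C.
  by rewrite /G mulmxA mul_mx_adj mul_scalar_mx.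
(* Multiply on the right by a matrix that clears the upper right block; [\det X]
   is not invertible but it is nonzero. *)
have schur : d *m (\det X)%:M - v *m (\adj X *m u) = 0.
  have := congr1 determinant (_ : P *m block_mx (\adj X) (- (\adj X *m u)) 0 (\det X)%:M =
    block_mx (\det X)%:M 0 (v *m \adj X) (d *m (\det X)%:M - v *m (\adj X *m u))).
  rewrite det_mulmx detP mul0r det_lblock det_scalar => /(_ _)/esym/eqP.
  rewrite mulf_eq0 expf_eq0 (negPf detX) andbF /= det_mx11 => /(_ _)/eqP h.
  apply/matrixP=> i j; rewrite !ord1 h ?mxE // mulmx_block !mulmx0 !addr0 mul_mx_adj.
  by rewrite !mulmxN (mulmxA X) mul_mx_adj scalar_mxC addNr [- _ + _]addrC.
have main : \det X *: map_mx polyC D = 'X *: (map_mx polyC B *m G) :> 'M_1.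
  apply/matrixP=> i j; apply: (mulfI (negbT (polyX_eq0 F))).
  move/eqP: schur; rewrite subr_eq0 => /eqP/matrixP/(_ i j).
  rewrite mul_mx_scalar /d /v /u -scalemxAr -scalemxAl -scalemxAr -/G.
  by rewrite !mxE mulrCA.
have D0 : D = 0.
  apply/matrixP=> i j; have /matrixP/(_ i j) := main.
  rewrite !mxE => /(congr1 (coefp 0)) /=.
  by rewrite coef0M detX0 mul1r coefC eqxx coefXM.
have BG k : B *m map_mx (coefp k) G = 0.
  have BG0 : map_mx polyC B *m G = 0.
    apply/matrixP=> i j; apply: (mulfI (negbT (polyX_eq0 F))).
    have /matrixP/(_ i j) := main; rewrite D0 map_mx0 scaler0 [RHS]mxE => <-.
    by rewrite !mxE mulr0.
  by rewrite -poly_mx_coef BG0; apply/matrixP=> i j; rewrite !mxE /= coef0.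
pose Gk k := map_mx (coefp k) G.
have XGE : G + 'X *: (map_mx polyC A *m G) = \det X *: map_mx polyC C.
  by rewrite -XG /X mulmxDl mul1mx scalemxAl.
have G0 : Gk 0%N = C.
  apply/matrixP=> i j; have /matrixP/(_ i j) := XGE.
  rewrite !mxE => /(congr1 (coefp 0)) /=.
  by rewrite coefD coefXM addr0 coef0M detX0 mul1r coefC eqxx.
have GS k : Gk k.+1 = (\det X)`_k.+1 *: C - A *m Gk k.
  rewrite -poly_mx_coef; apply/matrixP=> i j.
  have XGij : G i j + 'X * (map_mx polyC A *m G) i j = \det X * (C i j)%:P.
    by have /matrixP/(_ i j) := XGE; rewrite mxE [X in _ + X]mxE => ->; rewrite !mxE.
  have := congr1 (coefp k.+1) XGij; rewrite /= coefD coefXM coefMC /= => e.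
  rewrite [LHS]mxE [RHS]mxE [X in X + _]mxE [X in _ + X]mxE [X in _ - X]mxE -e.
  by rewrite /= addrK.
have BC : B *m C = 0 by rewrite -G0 BG.
have BAG k : B *m (A *m Gk k) = 0.
  have := BG k.+1; rewrite -/(Gk _) GS mulmxBr -scalemxAr BC scaler0 sub0r.
  by move/eqP; rewrite oppr_eq0 => /eqP.
have BAC : B *m (A *m C) = 0 by rewrite -G0 BAG.
split=> //; have := BAG 1%N; rewrite GS G0 mulmxBr mulmxBr -!scalemxAr BAC scaler0.
by rewrite sub0r => /eqP; rewrite oppr_eq0 => /eqP.
Qed.

(** * Block triangular maximal spaces and Lagrangian subspaces *)

Section PairHom.
Variables (F : fieldType) (aT r1 r2 : vectType F) (f : 'Hom(aT, r1)) (g : 'Hom(aT, r2)).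

Definition pair_fun x := (f x, g x).
Fact pair_fun_linear : linear pair_fun.
Proof. by move=> k x y; rewrite /pair_fun !linearP. Qed.
HB.instance Definition _ := GRing.isLinear.Build F aT (r1 * r2)%type _ pair_fun pair_fun_linear.

Definition pairh : 'Hom(aT, (r1 * r2)%type) := linfun pair_fun.

Lemma pairhE x : pairh x = (f x, g x).
Proof. by rewrite lfunE. Qed.
End PairHom.

Definition basis_mx (F : fieldType) n (E : {vspace 'cV[F]_n}) : 'M[F]_(n, \dim E) :=
  (\matrix_(i < \dim E) ((vbasis E)`_i)^T)^T.

Lemma mul_basis_mx (F : fieldType) n (E : {vspace 'cV[F]_n}) (c : 'cV_(\dim E)) :
  basis_mx E *m c = \sum_i c i 0 *: (vbasis E)`_i.
Proof.
rewrite mulmx_sum_col_row; apply: eq_bigr => i _.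
rewrite -tr_row rowK trmxK [row i c]mx11_scalar mul_mx_scalar.
by congr (_ *: _); rewrite !mxE.
Qed.

Lemma mem_basis_mx (F : fieldType) n (E : {vspace 'cV[F]_n}) x :
  x \in E <-> exists c, x = basis_mx E *m c.
Proof.
split=> [xE|[c ->]].
  exists (\col_i coord (vbasis E) i x); rewrite mul_basis_mx {1}(coord_vbasis xE).
  by apply: eq_bigr => i _; rewrite mxE.
rewrite mul_basis_mx; apply: memv_suml => i _; apply: memvZ.
by rewrite vbasis_mem // mem_nth // size_tuple.
Qed.

Lemma basis_mx_inj (F : fieldType) n (E : {vspace 'cV[F]_n}) (c : 'cV_(\dim E)) :
  basis_mx E *m c = 0 -> c = 0.
Proof.
rewrite mul_basis_mx => c0; apply/matrixP=> i j; rewrite ord1 mxE.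
have /freeP/(_ (fun i => c i 0)) := basis_free (vbasisP E); apply.
by rewrite -[RHS]c0.
Qed.

Lemma rank_basis_mx (F : fieldType) n (E : {vspace 'cV[F]_n}) :
  \rank (basis_mx E) = \dim E.
Proof.
rewrite -mxrank_tr; apply/eqP; apply: inj_row_free => v vB; apply: trmx_inj.
by rewrite trmx0; apply: (@basis_mx_inj _ _ E); apply: trmx_inj; rewrite trmx_mul trmxK vB trmx0.
Qed.

Lemma mx_eq0_forms (F : fieldType) m n (M : 'M[F]_(m, n)) :
  (forall (y : 'rV_m) (x : 'cV_n), y *m M *m x = 0) -> M = 0.
Proof.
move=> yMx; apply/matrixP=> i j; have := yMx (delta_mx 0 i) (delta_mx j 0).
by rewrite -rowE -colE => /matrixP/(_ 0 0); rewrite !mxE.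
Qed.

Lemma dim_annihilator (F : fieldType) n (A : {vspace 'rV[F]_n}) (E : {vspace 'cV[F]_n}) :
  (forall b c, b \in A -> c \in E -> b *m c = 0) -> (\dim A + \dim E <= n)%N.
Proof.
move=> AE; rewrite -(dim_trv A) -(rank_basis_mx (trv A)) -(rank_basis_mx E) -mxrank_tr.
apply: mulmx0_rank_max; apply: mx_eq0_forms => y x.
rewrite mulmxA -mulmxA -[y]trmxK -trmx_mul; apply: AE.
  by rewrite -mem_trv; apply/mem_basis_mx; exists y^T.
by apply/mem_basis_mx; exists x.
Qed.

Lemma bin2D s t : ('C(s + t, 2) = 'C(s, 2) + 'C(t, 2) + s * t)%N.
Proof.
elim: s => [|s IH]; first by rewrite add0n mul0n addn0.
by rewrite addSn !binS !bin1 IH mulSn; lia.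
Qed.

Lemma unit_shift_block (F : fieldType) s t (W : {vspace 'M[F]_(s + t)}) M :
  unit_shift W -> M \in W -> dlsubmx M = 0 ->
  (1%:M + ulsubmx M \in unitmx) /\ (1%:M + drsubmx M \in unitmx).
Proof.
move=> /unit_shiftP uW MW dl; have := uW M MW.
rewrite (scalar_mx_block s t) -{1}[M]submxK add_block_mx dl addr0 unitmxE.
by rewrite det_ublock unitrM -!unitmxE => /andP[].
Qed.

(** The dimension of a maximal block triangular [W] is the sum of the bounds on
    the dimensions of its three parts, so all of them are reached. *)
Lemma max_unit_shift_block (F : fieldType) s t (W : {vspace 'M[F]_(s + t)}) :
  has_elements F (s + t) -> max_unit_shift W ->
  (forall M, M \in W -> dlsubmx M = 0) ->
  exists (W1 : {vspace 'M[F]_s}) (W2 : {vspace 'M[F]_t}),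
    [/\ max_unit_shift W1, max_unit_shift W2 &
      forall M, M \in W <-> [/\ dlsubmx M = 0, ulsubmx M \in W1 & drsubmx M \in W2]].
Proof.
move=> hF [uW dW] dl0.
pose ul := linfun (lsubmx \o usubmx : 'M[F]_(s + t) -> 'M_s).
pose dr := linfun (rsubmx \o dsubmx : 'M[F]_(s + t) -> 'M_t).
pose dl := linfun (lsubmx \o dsubmx : 'M[F]_(s + t) -> 'M_(t, s)).
pose ur := linfun (rsubmx \o usubmx : 'M[F]_(s + t) -> 'M_(s, t)).
have ulE M : ul M = ulsubmx M by rewrite lfunE.
have drE M : dr M = drsubmx M by rewrite lfunE.
have dlE M : dl M = dlsubmx M by rewrite lfunE.
have urE M : ur M = ursubmx M by rewrite lfunE.
pose W1 := (ul @: W)%VS; pose W2 := (dr @: W)%VS.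
have uW1 : unit_shift W1.
  apply/unit_shiftP=> _ /memv_imgP[M MW ->].
  by rewrite ulE; case: (unit_shift_block uW MW (dl0 M MW)).
have uW2 : unit_shift W2.
  apply/unit_shiftP=> _ /memv_imgP[M MW ->].
  by rewrite drE; case: (unit_shift_block uW MW (dl0 M MW)).
have d1 : (\dim W1 <= 'C(s, 2))%N.
  by apply: dim_unit_shift uW1; apply: has_elementsW hF; rewrite leq_addr.
have d2 : (\dim W2 <= 'C(t, 2))%N.
  by apply: dim_unit_shift uW2; apply: has_elementsW hF; rewrite leq_addl.
pose T := (lker dl :&: (ul @^-1: W1 :&: dr @^-1: W2))%VS.
have TP M : M \in T <-> [/\ dlsubmx M = 0, ulsubmx M \in W1 & drsubmx M \in W2].
  rewrite !memv_cap memv_ker -!memv_preim ulE drE dlE.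
  by split=> [/and3P[/eqP]|[-> -> ->]]; rewrite ?eqxx.
have sub : (W <= T)%VS.
  apply/subvP=> M MW; apply/TP; split; first exact: dl0.
    by rewrite -ulE memv_img.
  by rewrite -drE memv_img.
have dT : (\dim T <= \dim W1 + \dim W2 + s * t)%N.
  pose T2 := (T :&: lker ul)%VS; pose T3 := (T2 :&: lker dr)%VS.
  have h1 : (\dim T <= \dim T2 + \dim W1)%N.
    apply: (dim_le_ker_img (f := ul)) => M MT.
      by move=> M0; rewrite memv_cap MT memv_ker M0 eqxx.
    by have /TP[_ M1 _] := MT; rewrite ulE.
  have h2 : (\dim T2 <= \dim T3 + \dim W2)%N.
    apply: (dim_le_ker_img (f := dr)) => M MT.
      by move=> M0; rewrite memv_cap MT memv_ker M0 eqxx.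
    by have /memv_capP[/TP[_ _ M2] _] := MT; rewrite drE.
  have h3 : (\dim T3 <= s * t)%N.
    rewrite -(dim_fullmx F); apply: (dim_le_inj (f := ur)) => M MT; last exact: memvf.
    have /memv_capP[/memv_capP[/TP[Mdl _ _] Mul] Mdr] := MT.
    move: Mul Mdr; rewrite !memv_ker ulE drE urE => /eqP Mul /eqP Mdr Mur.
    by rewrite -[M]submxK Mdl Mul Mdr Mur block_mx0.
  lia.
have WT : W = T.
  apply/eqP; rewrite eqEdim sub (leq_trans dT) // (leq_trans _ dW) // bin2D; lia.
have := leq_trans dW (dimvS sub); rewrite bin2D => dWT.
have arith (A B x y z d : nat) : (d <= x + y + z -> A + B + z <= d -> x <= A ->
    y <= B -> (A <= x) /\ (B <= y))%N by lia.
have [d1' d2'] := arith _ _ _ _ _ _ dT dWT d1 d2.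
exists W1, W2; split=> //.
by move=> M; rewrite WT.
Qed.

Lemma adapted_basis (F : fieldType) s t (E : {vspace 'cV[F]_(s + t)}) :
  \dim E = s -> exists2 g : 'M[F]_(s + t), g \in unitmx &
    forall x : 'cV_(s + t), (g *m x \in E) = (dsubmx x == 0).
Proof.
move=> dE.
have [B [Binj BE]] : exists B : 'M[F]_(s + t, s),
    \rank B = s /\ forall x, x \in E <-> exists c, x = B *m c.
  move: (rank_basis_mx E) (@mem_basis_mx _ _ E); move: (basis_mx E).
  by rewrite dE => B rB mB; exists B.
pose e : 'M[F]_(s, s + t) := row_mx 1%:M 0.
have eT : e *m e^T = 1%:M by rewrite tr_row_mx mul_row_col trmx1 mulmx1 mul0mx addr0.
have /complete_unitmx[g ug] : \rank (e *m (e^T *m B^T)) = \rank e.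
  rewrite mulmxA eT mul1mx mxrank_tr Binj; apply/esym/eqP; apply/row_freeP.
  by exists e^T.
rewrite mulmxA eT mul1mx => gE.
have gc c : g^T *m col_mx c 0 = B *m c.
  rewrite -[B]trmxK gE trmx_mul tr_row_mx trmx1 trmx0 -mulmxA; congr (_ *m _).
  by rewrite mul_col_mx mul1mx mul0mx.
exists g^T; first by rewrite unitmx_tr.
move=> x; apply/idP/eqP => [/BE[c]|x0].
  rewrite -gc => /(congr1 (mulmx (invmx g^T))); rewrite !mulKmx ?unitmx_tr // => ->.
  by rewrite col_mxKd.
by apply/BE; exists (usubmx x); rewrite -gc -[x in LHS]vsubmxK x0.
Qed.

(** By polarisation, the [b] with [(b, 0)] in [L] annihilate the projection of [L]
    to the columns. *)
Lemma dim_isotropic (F : fieldType) r (L : {vspace ('rV[F]_r * 'cV[F]_r)%type}) :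
  (forall b c, (b, c) \in L -> b *m c = 0) -> (\dim L <= r)%N.
Proof.
move=> iso; pose f2 : 'Hom(('rV[F]_r * 'cV[F]_r)%type, 'cV[F]_r) := linfun snd.
pose f1 : 'Hom(('rV[F]_r * 'cV[F]_r)%type, 'rV[F]_r) := linfun fst.
have polar b c b' c' : (b, c) \in L -> (b', c') \in L -> b *m c' + b' *m c = 0.
  move=> bc bc'; have := iso _ _ (memvD bc bc'); rewrite mulmxDl !mulmxDr /=.
  by rewrite (iso _ _ bc) (iso _ _ bc') add0r addr0.
apply: leq_trans (dim_le_ker_img (f := f2) (K := (L :&: lker f2)%VS) (I := (f2 @: L)%VS) _ _) _.
- by move=> u uL u0; rewrite memv_cap uL memv_ker u0 eqxx.
- by move=> u; apply: memv_img.
have : (\dim (f1 @: (L :&: lker f2)) + \dim (f2 @: L) <= r)%N.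
  apply: dim_annihilator => _ _ /memv_imgP[[b c] + ->] /memv_imgP[[b' c'] bc' ->].
  rewrite memv_cap memv_ker !lfunE /= => /andP[bc /eqP c0].
  by have := polar _ _ _ _ bc bc'; rewrite c0 mulmx0 addr0.
apply: leq_trans; rewrite leq_add2r.
apply: (dim_le_inj (f := f1)) => [[b c]|]; last by move=> u; apply: memv_img.
by rewrite memv_cap memv_ker !lfunE /= => /andP[_ /eqP->] ->.
Qed.

(** In a basis adapted to the invariant subspace [E], [W] is block triangular with
    a maximal first diagonal block.  By [orth_col_eq0] for that block, [b] kills
    [E] whenever [(b, c)] is in [L] with [c] generic in [E], and any element of
    [L] is a difference of two such. *)
Lemma lagrangian_split_adapted (F : fieldType) s t (W : {vspace 'M[F]_(s + t)})
    (L : {vspace ('rV[F]_(s + t) * 'cV[F]_(s + t))%type}) (E : {vspace 'cV[F]_(s + t)}) :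
  has_elements F (s + t) -> max_unit_shift W -> \dim E = s ->
  (forall c, c \in E <-> exists b, (b, c) \in L) ->
  (forall b c, (b, c) \in L -> b *m c = 0) ->
  (forall b c M, (b, c) \in L -> M \in W -> b *m (M *m c) = 0) ->
  (forall M c, M \in W -> c \in E -> M *m c \in E) ->
  forall b c e, (b, c) \in L -> e \in E -> b *m e = 0.
Proof.
move=> hF maxW dE LE iso isoW inv; have [g ug gE] := adapted_basis dE.
pose W' := eqv (invmx g) g W.
have maxW' : max_unit_shift W'.
  split; first exact: unit_shift_eqv maxW.1.
  by rewrite dim_eqv ?unitmx_inv // maxW.2.
have dl0 M : M \in W' -> dlsubmx M = 0.
  rewrite mem_eqv ?unitmx_inv // invmxK => MW; apply: mx_eq0_forms => y x.
  have : g *m (M *m col_mx x 0) \in E.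
    have xE : g *m col_mx x 0 \in E by rewrite gE; apply/eqP; apply: col_mxKd.
    by have := inv _ _ MW xE; rewrite mulmxA mulmxKV // -mulmxA.
  rewrite gE -{1}[M]submxK mul_block_col.
  rewrite col_mxKd mulmx0 addr0.
  by move=> /eqP Mx; rewrite -mulmxA Mx mulmx0.
have [W1 [W2 [maxW1 _ WP]]] := max_unit_shift_block hF maxW' dl0.
pose b1 (b : 'rV[F]_(s + t)) : 'rV_s := lsubmx (b *m g).
pose c1 (c : 'cV[F]_(s + t)) : 'cV_s := usubmx (invmx g *m c).
have cE c : c \in E -> c = g *m col_mx (c1 c) 0.
  move=> cE; have : dsubmx (invmx g *m c) = 0 by apply/eqP; rewrite -gE mulKVmx.
  by move=> d0; rewrite -[col_mx _ _](_ : invmx g *m c = _) ?mulKVmx // -[LHS]vsubmxK d0.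
have bE b e : e \in E -> b *m e = b1 b *m c1 e.
  move=> eE; rewrite {1}(cE e eE) mulmxA -{1}[b *m g]hsubmxK mul_row_col mulmx0.
  by rewrite addr0.
suff b10 b c : (b, c) \in L -> b1 b = 0.
  by move=> b c e bcL eE; rewrite bE // (b10 b c) // mul0mx.
have hFs : has_elements F s by apply: has_elementsW hF; rewrite leq_addr.
case: (posnP s) => [s0|s0].
  by move=> _; apply/matrixP=> i j; have := ltn_ord j; rewrite {2}s0.
have [f f0 fP] := rank1_left_proper hFs maxW1.1 s0.
have step b' c' : (b', c') \in L -> f *m c1 c' != 0 -> b1 b' = 0.
  move=> bcL fc; have c'E : c' \in E by apply/LE; exists b'.
  apply: (orth_col_eq0 hFs maxW1 (c := c1 c')).
  - by apply: contraNneq fc => ->; rewrite mulmx0.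
  - by move=> l cl; apply/eqP; apply: contraNT fc => l0; apply/eqP; apply: fP cl.
  - by rewrite -bE // iso.
  move=> K KW; pose M := g *m block_mx K 0 0 0 *m invmx g.
  have MW : M \in W.
    have : block_mx K 0 0 0 \in W'.
      by apply/WP; rewrite block_mxKdl block_mxKul block_mxKdr mem0v.
    by rewrite mem_eqv ?unitmx_inv // invmxK.
  have := isoW _ _ _ bcL MW; rewrite /M -!mulmxA {1}(cE _ c'E) mulKmx //.
  rewrite mul_block_col !mul0mx !addr0 mulmxA -{1}[b' *m g]hsubmxK.
  by rewrite mul_row_col mulmx0 addr0.
move=> bcL; have [fc|] := eqVneq (f *m c1 c) 0; last exact: step bcL.
have /rV0Pn[j fj] := f0; pose d : 'cV[F]_s := delta_mx j 0.
have fd : f *m d != 0 by rewrite mx11_eq0 -colE mxE.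
have /LE[b' bdL] : g *m col_mx d 0 \in E by rewrite gE col_mxKd.
have fd' : f *m c1 (g *m col_mx d 0) != 0 by rewrite /c1 mulKmx // col_mxKu.
have b'0 := step _ _ bdL fd'.
have := step _ _ (memvD bcL bdL); rewrite /c1 /b1 /= mulmxDr linearD /= mulmxDr fc add0r.
by move=> /(_ fd'); rewrite mulmxDl linearD /= -/(b1 b') b'0 addr0.
Qed.

(** Take for [E] the projection of [L] to the columns.  By [dim_isotropic], [L]
    cannot be enlarged, so that it contains [(b, 0)] as soon as [b] kills [E];
    polarising [b M c = 0] against these elements makes [E] invariant. *)
Lemma lagrangian_split (F : fieldType) r (W : {vspace 'M[F]_r})
    (L : {vspace ('rV[F]_r * 'cV[F]_r)%type}) :
  has_elements F r -> max_unit_shift W -> (r <= \dim L)%N ->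
  (forall b c, (b, c) \in L -> b *m c = 0) ->
  (forall b c M, (b, c) \in L -> M \in W -> b *m (M *m c) = 0) ->
  exists E : {vspace 'cV[F]_r},
    (forall M c, M \in W -> c \in E -> M *m c \in E) /\
    (forall b c, (b, c) \in L <-> c \in E /\ forall e, e \in E -> b *m e = 0).
Proof.
move=> hF maxW dL iso isoW.
pose f2 : 'Hom(('rV[F]_r * 'cV[F]_r)%type, 'cV[F]_r) := linfun snd.
pose E := (f2 @: L)%VS.
have LE c : c \in E <-> exists b, (b, c) \in L.
  split=> [/memv_imgP[[b d] bdL]|[b bcL]].
    by rewrite lfunE /= => ->; exists b.
  by apply/memv_imgP; exists (b, c); rewrite // lfunE.
have ann b : (forall e, e \in E -> b *m e = 0) -> (b, 0) \in L.
  move=> bE; apply: contraT => bL.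
  have : (\dim (L + <[(b, 0%R : 'cV[F]_r)]>) <= r)%N.
    apply: dim_isotropic => b' c' /memv_addP[[b1 c1] L1 [Q /vlineP[k ->]]].
    rewrite -[(b1, c1) + _]/(b1 + k *: b, c1 + k *: 0) => -[-> ->].
    rewrite scaler0 addr0 mulmxDl (iso _ _ L1) -scalemxAl bE ?scaler0 ?addr0 //.
    by apply/LE; exists b1.
  by rewrite dim_add_line // => /leq_trans/(_ dL); rewrite ltnn.
have inv M c : M \in W -> c \in E -> M *m c \in E.
  move=> MW /LE[b bcL]; apply: contraT => /separation[y [yMc yE]].
  have := isoW _ _ _ (memvD (ann _ yE) bcL) MW.
  rewrite /= add0r mulmxDl yMc (isoW _ _ _ bcL MW) addr0 => /eqP.
  by rewrite (negPf (neq0_11 _)).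
exists E; split=> //.
have orth b c e : (b, c) \in L -> e \in E -> b *m e = 0.
  have [s [t [rE dE]]] : exists s t, r = (s + t)%N /\ \dim E = s.
    exists (\dim E), (r - \dim E)%N; split=> //; rewrite subnKC //.
    by have := dimvS (subvf E); rewrite dim_fullmx muln1.
  move: (E) dE LE inv => E' dE' LE' inv'; clear ann E f2 dL.
  by subst r; apply: lagrangian_split_adapted dE' LE' iso isoW inv' _ _ _.
move=> b c; split=> [bcL|[/LE[b' bcL] bE]].
  by split=> [|e eE]; [apply/LE; exists b | apply: orth bcL eE].
rewrite -[(b, c)](_ : (b - b', 0) + (b', c) = _).
  rewrite memvD // ann // => e eE.
  by rewrite mulmxBl bE // (orth _ _ _ bcL eE) subrr.
by rewrite -[LHS]/(b - b' + b', 0 + c) subrK add0r.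
Qed.

(** * The off-diagonal blocks *)

Lemma rank_det0 (F : fieldType) r (P : 'M[F]_(r + 1)) : (\rank P <= r)%N -> \det P = 0.
Proof.
move=> rP; apply/eqP; apply: contraTT rP; rewrite -unitfE -unitmxE => /mxrank_unit ->.
by rewrite addn1 ltnn.
Qed.

(** The translation space of an affine space of constant rank [r], once a base
    point has been brought to the form with [1] in the upper left corner and zero
    blocks elsewhere. *)
Definition corner_shift (F : fieldType) r a b (V : {vspace 'M[F]_(r + a, r + b)}) :=
  forall M, M \in V -> \rank ((block_mx 1%:M 0 0 0 : 'M_(r + a, r + b)) + M)%R = r.

(** Bordering the upper left block by one row [y B] and one column [C x] reduces
    to [bordered_det_coefs]. *)
Lemma corner_shift_coefs (F : fieldType) r a b (V : {vspace 'M[F]_(r + a, r + b)})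
    (A : 'M_r) (C : 'M_(r, b)) (B : 'M_(a, r)) (D : 'M_(a, b)) :
  has_elements F r.+2 -> corner_shift V -> block_mx A C B D \in V ->
  [/\ D = 0, B *m C = 0, B *m (A *m C) = 0 & B *m (A *m (A *m C)) = 0].
Proof.
move=> hF cV MV.
have main (y : 'rV_a) (x : 'cV_b) : [/\ y *m D *m x = 0, y *m (B *m C) *m x = 0,
    y *m (B *m (A *m C)) *m x = 0 & y *m (B *m (A *m (A *m C))) *m x = 0].
  have := @bordered_det_coefs F r A (y *m B) (C *m x) (y *m D *m x) hF.
  rewrite !mulmxA; apply=> t; apply: rank_det0.
  pose P : 'M_(r + 1, r + a) := block_mx 1%:M 0 0 y.
  pose Q : 'M_(r + b, r + 1) := block_mx 1%:M 0 0 x.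
  rewrite [X in \rank X](_ : _ = P *m (block_mx 1%:M 0 0 0 + t *: block_mx A C B D) *m Q).
    apply: (leq_trans (mxrankM_maxl _ _)); apply: (leq_trans (mxrankM_maxr _ _)).
    by rewrite cV // memvZ.
  rewrite scale_block_mx add_block_mx !add0r !mulmx_block !mul1mx !mulmx1 !mul0mx !mulmx0.
  by rewrite !addr0 !add0r -!scalemxAr -!scalemxAl.
by split; apply: mx_eq0_forms => y x; have [] := main y x.
Qed.

Section Pairs.
Variables (F : fieldType) (r : nat).

Definition at_row_col a b (i : 'I_a) (j : 'I_b) :
    'Hom(('rV[F]_r * 'cV[F]_r)%type, ('M[F]_(a, r) * 'M[F]_(r, b))%type) :=
  pairh (linfun (mulmx (delta_mx i 0)) \o linfun fst)
        (linfun (mulmxr (delta_mx 0 j)) \o linfun snd).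

Lemma at_row_colE a b (i : 'I_a) (j : 'I_b) bc :
  at_row_col i j bc = (delta_mx i 0 *m bc.1, bc.2 *m delta_mx 0 j).
Proof. by rewrite /at_row_col pairhE !comp_lfunE !lfunE. Qed.

Definition pairs_at a b (U : {vspace ('M[F]_(a, r) * 'M[F]_(r, b))%type}) i j :=
  (at_row_col i j @^-1: U)%VS.

Lemma mem_pairs_at a b (U : {vspace ('M[F]_(a, r) * 'M[F]_(r, b))%type}) i j b' c' :
  ((b', c') \in pairs_at U i j) = ((delta_mx i 0 *m b', c' *m delta_mx 0 j) \in U).
Proof. by rewrite /pairs_at -memv_preim at_row_colE. Qed.

Definition isotropic a b (U : {vspace ('M[F]_(a, r) * 'M[F]_(r, b))%type}) :=
  forall B C, (B, C) \in U -> B *m C = 0.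

(** Deleting a row of [B] and a column of [C] leaves an isotropic space; the
    elements that become zero are supported on that row and that column. *)
Lemma dim_le_pairs_at a b (U : {vspace ('M[F]_(a.+1, r) * 'M[F]_(r, b.+1))%type}) i j k :
  (forall U' : {vspace ('M[F]_(a, r) * 'M[F]_(r, b))%type}, isotropic U' -> \dim U' <= k)%N ->
  isotropic U -> (\dim U <= \dim (pairs_at U i j) + k)%N.
Proof.
move=> bound iso.
pose f := pairh (linfun (row' i) \o linfun fst) (linfun (col' j) \o linfun snd) :
  'Hom(('M[F]_(a.+1, r) * 'M[F]_(r, b.+1))%type, ('M[F]_(a, r) * 'M[F]_(r, b))%type).
have fE B C : f (B, C) = (row' i B, col' j C).
  by rewrite /f pairhE !comp_lfunE !lfunE.
apply: (@leq_trans (\dim (at_row_col i j @: pairs_at U i j) + \dim (f @: U))); last first.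
  apply: leq_add; first by rewrite -[X in (_ <= X)%N](limg_ker_dim (at_row_col i j)) leq_addl.
  apply: bound => B' C' /memv_imgP[[B C] /iso BC].
  rewrite fE => -[-> ->]; apply/matrixP=> k' l; rewrite [RHS]mxE.
  have /matrixP/(_ (lift i k') (lift j l)) := BC; rewrite !mxE => {2}<-.
  by apply: eq_bigr => m _; rewrite !mxE.
apply: (dim_le_ker_img (f := f)) => [[B C] BCU|u]; last exact: memv_img.
rewrite fE => -[B0 C0].
have BE : B = delta_mx i 0 *m row i B.
  apply/matrixP=> k' l; rewrite mxE big_ord1 !mxE eqxx andbT.
  case: (unliftP i k') => [k'' ->|->]; last by rewrite eqxx mul1r.
  rewrite eq_sym (negPf (neq_lift _ _)) mul0r.
  by have /matrixP/(_ k'' l) := B0; rewrite !mxE.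
have CE : C = col j C *m delta_mx 0 j.
  apply/matrixP=> k' l; rewrite mxE big_ord1 !mxE eqxx /=.
  case: (unliftP j l) => [l' ->|->]; last by rewrite eqxx mulr1.
  rewrite eq_sym (negPf (neq_lift _ _)) mulr0.
  by have /matrixP/(_ k' l') := C0; rewrite !mxE.
apply/memv_imgP; exists (row i B, col j C); last by rewrite at_row_colE /= -BE -CE.
by rewrite mem_pairs_at -BE -CE.
Qed.

Lemma delta_mul11_eq0 a b (i : 'I_a) (j : 'I_b) (k : 'M[F]_1) :
  delta_mx i 0 *m k *m delta_mx 0 j = 0 -> k = 0.
Proof.
rewrite [k]mx11_scalar mul_mx_scalar -scalemxAl mul_delta_mx => /matrixP/(_ i j).
by rewrite !mxE !eqxx mulr1 => ->; apply/matrixP=> i' j'; rewrite !mxE mul0rn.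
Qed.

Lemma isotropic_pairs_at a b (U : {vspace ('M[F]_(a, r) * 'M[F]_(r, b))%type}) i j b' c' :
  isotropic U -> (b', c') \in pairs_at U i j -> b' *m c' = 0.
Proof.
rewrite mem_pairs_at => iso /iso; rewrite mulmxA -(mulmxA _ b').
exact: delta_mul11_eq0.
Qed.

Lemma dim_isotropic_pairs a b (U : {vspace ('M[F]_(a, r) * 'M[F]_(r, b))%type}) :
  (b <= a)%N -> isotropic U -> (\dim U <= r * a)%N.
Proof.
elim: b a U => [|b IH] a U le iso.
  pose f : 'Hom(('M[F]_(a, r) * 'M[F]_(r, 0))%type, 'M[F]_(a, r)) := linfun fst.
  rewrite mulnC -(dim_fullmx F); apply: (dim_le_inj (f := f)) => [[B C] _|*]; last exact: memvf.
  by rewrite lfunE /= => ->; rewrite [C]thinmx0.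
case: a U le iso => // a U le iso.
apply: leq_trans (dim_le_pairs_at ord0 ord0 (k := r * a) _ iso) _.
  by move=> U' isoU'; apply: IH.
rewrite mulnS leq_add2r; apply: dim_isotropic => b' c'; exact: isotropic_pairs_at.
Qed.

(** Maximality makes every [pairs_at U i j] Lagrangian.  Pairing with the
    elements [(delta_i y, 0)] and [(0, x delta_j)] of [U] shows that [U] is
    contained in the space cut out by one and the same [E], and these elements
    generate that space. *)
Lemma isotropic_pairs_split a b (W : {vspace 'M[F]_r})
    (U : {vspace ('M[F]_(a, r) * 'M[F]_(r, b))%type}) :
  has_elements F r -> max_unit_shift W -> (0 < b <= a)%N ->
  isotropic U -> (forall B C M, (B, C) \in U -> M \in W -> B *m (M *m C) = 0) ->
  (r * a <= \dim U)%N ->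
  exists E : {vspace 'cV[F]_r},
    (forall M c, M \in W -> c \in E -> M *m c \in E) /\
    (forall B C, (B, C) \in U <->
       (forall e, e \in E -> B *m e = 0) /\ (forall x, C *m x \in E)).
Proof.
case: b U => // b; case: a => // a U hF maxW /andP[_ le] iso isoW dU.
have iso_at i j b' c' := @isotropic_pairs_at _ _ U i j b' c' iso.
have isoW_at i j b' c' M : (b', c') \in pairs_at U i j -> M \in W -> b' *m (M *m c') = 0.
  rewrite mem_pairs_at => /isoW h /h e; apply: (@delta_mul11_eq0 _ _ i j).
  by rewrite -[RHS]e !mulmxA.
have dL i j : (r <= \dim (pairs_at U i j))%N.
  have := dim_le_pairs_at i j (k := r * a) (fun U' => @dim_isotropic_pairs a b U' le) iso.
  by move/(leq_trans dU); rewrite mulnS leq_add2r.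
have EP ij := lagrangian_split hF maxW (dL ij.1 ij.2) (iso_at ij.1 ij.2) (isoW_at ij.1 ij.2).
have [Eij {}EP] := choice EP.
have mem_row i j (y : 'rV_r) : (forall e, e \in Eij (i, j) -> y *m e = 0) ->
    (delta_mx i 0 *m y, 0 : 'M_(r, b.+1)) \in U.
  move=> yE; have := (EP (i, j)).2 y 0; rewrite mem_pairs_at mul0mx => -[_]; apply.
  by split=> //; apply: mem0v.
have mem_col i j (x : 'cV_r) : x \in Eij (i, j) ->
    (0 : 'M_(a.+1, r), x *m delta_mx 0 j) \in U.
  move=> xE; have := (EP (i, j)).2 0 x; rewrite mem_pairs_at mulmx0 => -[_]; apply.
  by split=> // e _; rewrite mul0mx.
have polar (B B' : 'M_(a.+1, r)) (C C' : 'M_(r, b.+1)) : (B, C) \in U -> (B', C') \in U -> B *m C' + B' *m C = 0.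
  move=> BC BC'; have := iso _ _ (memvD BC BC'); rewrite mulmxDl !mulmxDr /=.
  by rewrite (iso _ _ BC) (iso _ _ BC') add0r addr0.
(* The two polarised identities, with one of the four blocks equal to zero. *)
have polB (B B' : 'M_(a.+1, r)) (C Z : 'M_(r, b.+1)) : Z = 0 -> (B, C) \in U -> (B', Z) \in U -> B' *m C = 0.
  by move=> Z0 h /(polar _ _ _ _ h); rewrite Z0 mulmx0 add0r.
have polC (B Z : 'M_(a.+1, r)) (C C' : 'M_(r, b.+1)) : Z = 0 -> (B, C) \in U -> (Z, C') \in U -> B *m C' = 0.
  by move=> Z0 h /(polar _ _ _ _ h); rewrite Z0 mul0mx addr0.
have UC i j (B : 'M_(a.+1, r)) (C : 'M_(r, b.+1)) x : (B, C) \in U -> C *m x \in Eij (i, j).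
  move=> BCU; apply: contraT => /separation[y [yCx yE]].
  have e := polB _ _ _ _ (erefl 0) BCU (mem_row i j y yE).
  move/matrixP/(_ i 0): (congr1 (mulmx^~ x) e); rewrite mul0mx -!mulmxA yCx mulmx1.
  by rewrite !mxE !eqxx => /eqP; rewrite oner_eq0.
have UB i j (B : 'M_(a.+1, r)) (C : 'M_(r, b.+1)) (e : 'cV_r) : (B, C) \in U -> e \in Eij (i, j) -> B *m e = 0.
  move=> BCU eE; have := polC _ _ _ _ (erefl 0) BCU (mem_col i j e eE).
  move=> /(congr1 (mulmx^~ (delta_mx j (0 : 'I_1)))).
  rewrite mul0mx -!mulmxA mul_delta_mx.
  have -> : delta_mx 0 0 = 1%:M :> 'M[F]_1 by apply/matrixP=> k l; rewrite !mxE !ord1.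
  by rewrite mulmx1.
have Esub i j i' j' (e : 'cV_r) : e \in Eij (i, j) -> e \in Eij (i', j').
  move=> eE; have := UC i' j' _ _ (delta_mx j 0) (mem_col i j e eE).
  rewrite -mulmxA mul_delta_mx.
  have -> : delta_mx 0 0 = 1%:M :> 'M[F]_1 by apply/matrixP=> k l; rewrite !mxE !ord1.
  by rewrite mulmx1.
exists (Eij (ord0, ord0)); split; first exact: (EP (ord0, ord0)).1.
move=> B C; split=> [BCU|[BE CE]].
  by split=> [e|x]; [apply: UB BCU | apply: UC BCU].
have -> : (B, C) = \sum_i (delta_mx i 0 *m row i B, 0) + \sum_j (0, col j C *m delta_mx 0 j).
  rewrite [\sum_i _](_ : _ = (B, 0)); last first.
    rewrite -{2}[B]mul1mx mulmx_sum_col_row; elim/big_rec2: _ => // i B1 B2 _ ->.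
    by rewrite col1 -[LHS]/(_ + _, 0 + 0) addr0.
  rewrite [\sum_j _](_ : _ = (0, C)).
    by rewrite -[RHS]/(_ + _, _ + _) addr0 add0r.
  rewrite -{2}[C]mulmx1 mulmx_sum_col_row; elim/big_rec2: _ => // i B1 B2 _ ->.
  by rewrite row1 -[LHS]/(0 + 0, _ + _) addr0.
apply: memvD; apply: memv_suml => k _.
  apply: (mem_row k ord0) => e /Esub eE.
  by rewrite -row_mul BE //; apply/matrixP=> i' j'; rewrite !mxE.
by apply: (mem_col ord0 k); rewrite colE; apply: Esub (CE _).
Qed.
End Pairs.

(** * The translation space at a normalised base point *)

Definition corner (F : fieldType) r a b (V : {vspace 'M[F]_(r + a, r + b)}) :
    {vspace 'M[F]_r} :=
  (linfun (mulmxr (row_mx 1%:M 0 : 'M_(r, r + b)) \o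
           mulmx (col_mx 1%:M 0 : 'M_(r + a, r))) @^-1: V)%VS.

Lemma block_corner (F : fieldType) r a b (A : 'M[F]_r) :
  block_mx A 0 0 0 = (col_mx 1%:M 0 : 'M_(r + a, r)) *m A *m (row_mx 1%:M 0 : 'M_(r, r + b)).
Proof. by rewrite mul_col_mx mul1mx mul0mx mul_col_row !mulmx1 !mulmx0. Qed.

Lemma mem_corner (F : fieldType) r a b (V : {vspace 'M[F]_(r + a, r + b)}) A :
  (A \in corner V) = (block_mx A 0 0 0 \in V).
Proof. by rewrite /corner -memv_preim lfunE /= block_corner. Qed.

Lemma unit_shift_corner (F : fieldType) r a b (V : {vspace 'M[F]_(r + a, r + b)}) :
  corner_shift V -> unit_shift (corner V).
Proof.
move=> cV; apply/unit_shiftP=> A; rewrite mem_corner => /cV.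
rewrite add_block_mx !addr0 block_corner => rA.
rewrite -row_free_unit -row_leq_rank -[X in (X <= _)%N]rA.
by apply: leq_trans (mxrankM_maxl _ _) (mxrankM_maxr _ _).
Qed.

(** The kernel of the map to the pairs [(B, C)] is the upper left corner, of
    dimension at most ['C(r, 2)], and the image is isotropic, of dimension at
    most [r a].  Both bounds are therefore reached. *)
Lemma corner_shift_split (F : fieldType) r a b (V : {vspace 'M[F]_(r + a, r + b)}) :
  has_elements F r.+2 -> corner_shift V -> (0 < b <= a)%N ->
  ('C(r, 2) + r * a <= \dim V)%N ->
  max_unit_shift (corner V) /\
  exists E : {vspace 'cV[F]_r},
    (forall M c, M \in corner V -> c \in E -> M *m c \in E) /\
    (forall (B : 'M_(a, r)) (C : 'M_(r, b)), (exists A, block_mx A C B 0 \in V) <->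
       (forall e : 'cV_r, e \in E -> B *m e = 0) /\ (forall x : 'cV_b, C *m x \in E)).
Proof.
move=> hF cV ab dV.
have hFr : has_elements F r by apply: has_elementsW hF; rewrite ltnW.
have uW := unit_shift_corner cV.
pose f : 'Hom('M[F]_(r + a, r + b), ('M[F]_(a, r) * 'M[F]_(r, b))%type) :=
  pairh (linfun (lsubmx \o dsubmx)) (linfun (rsubmx \o usubmx)).
have fE A C B D : f (block_mx A C B D) = (B, C).
  by rewrite /f pairhE !lfunE /= block_mxEv col_mxKd col_mxKu row_mxKl row_mxKr.
have VP M : M \in V -> exists A C B, M = block_mx A C B 0.
  move=> MV; exists (ulsubmx M), (ursubmx M), (dlsubmx M).
  rewrite -{1}[M]submxK; congr block_mx.
  by move: MV; rewrite -{1}[M]submxK => /(corner_shift_coefs hF cV)[].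
pose U := (f @: V)%VS.
have UP B C : (B, C) \in U <-> exists A, block_mx A C B 0 \in V.
  split=> [/memv_imgP[M MV]|[A AV]].
    by have [A [C' [B' ME]]] := VP M MV; move: MV; rewrite ME fE => MV [-> ->]; exists A.
  by rewrite -(fE A C B 0) memv_img.
have isoU : isotropic U.
  by move=> B C /UP[A /(corner_shift_coefs hF cV)[]].
have isoW (B : 'M_(a, r)) (C : 'M_(r, b)) M : (B, C) \in U -> M \in corner V -> B *m (M *m C) = 0.
  move=> /UP[A AV]; rewrite mem_corner => MV.
  have [_ _ BAC _] := corner_shift_coefs hF cV AV.
  have := memvD AV MV; rewrite add_block_mx !addr0 => /(corner_shift_coefs hF cV)[_ _].
  by rewrite mulmxDl mulmxDr BAC add0r.
have dU : (\dim U <= r * a)%N by case/andP: ab => _ ab; apply: dim_isotropic_pairs.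
have dW := dim_unit_shift hFr uW.
have dVle : (\dim V <= \dim (corner V) + \dim U)%N.
  pose h := linfun (mulmxr (row_mx 1%:M 0 : 'M[F]_(r, r + b)) \o
           mulmx (col_mx 1%:M 0 : 'M[F]_(r + a, r))).
  apply: (@leq_trans (\dim (h @: corner V) + \dim U)); last first.
    by rewrite leq_add2r -[X in (_ <= X)%N](limg_ker_dim h) leq_addl.
  apply: (dim_le_ker_img (f := f)) => M MV; last exact: memv_img.
  have [A [C [B ME]]] := VP M MV; move: MV; rewrite ME fE => MV [B0 C0].
  move: MV; rewrite B0 C0 -mem_corner => AW; apply/memv_imgP; exists A => //.
  by rewrite lfunE /= block_corner.
have arith (x y c z v : nat) : (c + z <= v -> v <= x + y -> x <= c -> y <= z ->
    (c <= x) /\ (z <= y))%N by lia.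
have [dW' dU'] := arith _ _ _ _ _ dV dVle dW dU.
have maxW : max_unit_shift (corner V) by [].
split=> //; have [E [inv EP]] := isotropic_pairs_split hFr maxW ab isoU isoW dU'.
by exists E; split=> // B C; rewrite -UP EP.
Qed.

(** The shape of the translation space when the subspace [E] of
    [corner_shift_split] is spanned by the first [s] basis vectors. *)
Definition split_shift (F : fieldType) s t a b
    (V : {vspace 'M[F]_((s + t) + a, (s + t) + b)}) :=
  [/\ max_unit_shift (corner V), forall A, A \in corner V -> dlsubmx A = 0,
    forall M, M \in V -> exists A (B2 : 'M_(a, t)) (C1 : 'M_(s, b)),
      M = block_mx A (col_mx C1 0) (row_mx 0 B2) 0 &
    forall (B2 : 'M_(a, t)) (C1 : 'M_(s, b)), exists A,
      block_mx A (col_mx C1 0) (row_mx 0 B2) 0 \in V].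

Lemma unitmx_block_diag (F : fieldType) m n (A : 'M[F]_m) (B : 'M[F]_n) :
  A \in unitmx -> B \in unitmx -> block_mx A 0 0 B \in unitmx.
Proof. by rewrite !unitmxE det_lblock unitrM => -> ->. Qed.

Lemma rank_mul_unit (F : fieldType) m n (P : 'M[F]_m) (Q : 'M[F]_n) (M : 'M_(m, n)) :
  P \in unitmx -> Q \in unitmx -> \rank (P *m M *m Q) = \rank M.
Proof.
move=> uP uQ; rewrite mxrankMfree ?row_free_unit //.
by have [] := eqmxMfull M (_ : row_full P); rewrite ?row_full_unit.
Qed.

(** A change of basis of [F^r] that is adapted to [E] conjugates the corner and
    fixes the base point. *)
Lemma corner_shift_adapted (F : fieldType) s t a b
    (V : {vspace 'M[F]_((s + t) + a, (s + t) + b)}) (E : {vspace 'cV[F]_(s + t)}) :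
  corner_shift V -> max_unit_shift (corner V) -> \dim E = s ->
  (forall M, M \in V -> drsubmx M = 0) ->
  (forall M c, M \in corner V -> c \in E -> M *m c \in E) ->
  (forall (B : 'M_(a, s + t)) (C : 'M_(s + t, b)), (exists A, block_mx A C B 0 \in V) <->
     (forall e : 'cV_(s + t), e \in E -> B *m e = 0) /\ (forall x : 'cV_b, C *m x \in E)) ->
  exists P Q, [/\ P \in unitmx, Q \in unitmx,
    P *m block_mx 1%:M 0 0 0 *m Q = block_mx 1%:M 0 0 0,
    corner_shift (eqv P Q V) & split_shift (eqv P Q V)].
Proof.
move=> cV maxW dE dr0 inv EP; have [g ug gE] := adapted_basis dE.
pose G : 'M[F]_((s + t) + a) := block_mx g 0 0 1%:M.
pose H : 'M[F]_((s + t) + b) := block_mx (invmx g) 0 0 1%:M.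
have uG : G \in unitmx by apply: unitmx_block_diag; rewrite ?unitmx1.
have uH : H \in unitmx by apply: unitmx_block_diag; rewrite ?unitmx_inv ?unitmx1.
have GH A C B D : G *m block_mx A C B D *m H = block_mx (g *m A *m invmx g) (g *m C) (B *m invmx g) D.
  by rewrite !mulmx_block !mul0mx !mulmx0 !mul1mx !mulmx1 !addr0 !add0r.
exists (invmx G), (invmx H); rewrite !unitmx_inv uG uH.
set V' := eqv _ _ V.
have V'P A C B D : (block_mx A C B D \in V') =
    (block_mx (g *m A *m invmx g) (g *m C) (B *m invmx g) D \in V).
  by rewrite mem_eqv ?unitmx_inv // !invmxK GH.
have GJ : G *m block_mx 1%:M 0 0 0 *m H = block_mx 1%:M 0 0 0.
  by rewrite GH !mulmx0 mul0mx mulmx1 mulmxV.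
have cornerP A : (A \in corner V') = (g *m A *m invmx g \in corner V).
  by rewrite !mem_corner V'P mulmx0 mul0mx.
split=> //.
- by rewrite -GJ !mulmxA mulVmx // mul1mx mulmxK.
- move=> M MV'; rewrite -(rank_mul_unit _ uG uH) mulmxDr mulmxDl GJ; apply: cV.
  by move: MV'; rewrite mem_eqv ?unitmx_inv // !invmxK.
have shape B C : (exists A, block_mx A C B 0 \in V') <-> lsubmx B = 0 /\ dsubmx C = 0.
  have -> : (exists A, block_mx A C B 0 \in V') <->
      (exists A, block_mx A (g *m C) (B *m invmx g) 0 \in V).
    split=> -[A]; first by rewrite V'P => AV; exists (g *m A *m invmx g).
    move=> AV; exists (invmx g *m A *m g).
    by rewrite V'P !mulmxA mulmxV // mul1mx mulmxK.
  rewrite EP; split=> [[BE CE]|[B0 C0]]; split.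
  - apply: mx_eq0_forms => y x; rewrite -mulmxA.
    have xE : g *m col_mx x 0 \in E by rewrite gE; apply/eqP; apply: col_mxKd.
    have : B *m col_mx x 0 = 0 by rewrite -[RHS](BE _ xE) mulmxA mulmxKV.
    by rewrite -{1}[B]hsubmxK mul_row_col mulmx0 addr0 => ->; rewrite mulmx0.
  - apply: mx_eq0_forms => y x; rewrite -mulmxA mul_dsub_mx.
    by have := CE x; rewrite -mulmxA gE => /eqP ->; rewrite mulmx0.
  - move=> e eE; have : dsubmx (invmx g *m e) == 0 by rewrite -gE mulKVmx.
    move=> /eqP d0; rewrite -mulmxA -[invmx g *m e]vsubmxK d0 -{1}[B]hsubmxK B0.
    by rewrite mul_row_col mul0mx mulmx0 addr0.
  - by move=> x; rewrite -mulmxA gE -[C]vsubmxK C0 mul_col_mx col_mxKd mul0mx.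
split.
- split; last first.
    have -> : corner V' = eqv (invmx g) g (corner V).
      by apply/vspaceP=> A; rewrite cornerP mem_eqv ?unitmx_inv // invmxK.
    by rewrite dim_eqv ?unitmx_inv // maxW.2.
  apply: unit_shift_corner => M MV'.
  rewrite -(rank_mul_unit _ uG uH) mulmxDr mulmxDl GJ; apply: cV.
  by move: MV'; rewrite mem_eqv ?unitmx_inv // !invmxK.
- move=> A; rewrite cornerP => AW; apply: mx_eq0_forms => y x.
  have xE : g *m col_mx x 0 \in E by rewrite gE; apply/eqP; apply: col_mxKd.
  have : dsubmx (A *m col_mx x 0) = 0.
    by apply/eqP; rewrite -gE; have := inv _ _ AW xE; rewrite mulmxA mulmxKV // -mulmxA.
  rewrite -{1}[A]submxK mul_block_col col_mxKd mulmx0 addr0 -mulmxA => ->.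
  by rewrite mulmx0.
- move=> M; rewrite -{1}[M]submxK V'P => MV.
  have D0 : drsubmx M = 0 by have := dr0 _ MV; rewrite block_mxKdr.
  have [] := (shape (dlsubmx M) (ursubmx M)).1.
    by exists (ulsubmx M); rewrite V'P; move: MV; rewrite D0.
  move=> l0 d0; exists (ulsubmx M), (rsubmx (dlsubmx M)), (usubmx (ursubmx M)).
  by rewrite -{1}l0 -d0 hsubmxK vsubmxK -D0 submxK.
- move=> B2 C1; apply: (shape (row_mx 0 B2) (col_mx C1 0)).2.
  by rewrite row_mxKl col_mxKd.
Qed.

Lemma mx_mul_eq0 (F : fieldType) m n p (Z : 'M[F]_(m, n)) : (0 < p)%N ->
  (forall C : 'M_(n, p), Z *m C = 0) -> Z = 0.
Proof.
case: p => // p _ Z0; apply: mx_eq0_forms => y x.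
have := Z0 (x *m delta_mx 0 0); rewrite mulmxA => /(congr1 (mulmx^~ (delta_mx 0 (0 : 'I_1)))).
rewrite mul0mx -!mulmxA mul_delta_mx.
have -> : delta_mx 0 0 = 1%:M :> 'M[F]_1 by apply/matrixP=> k l; rewrite !mxE !ord1.
by rewrite mulmx1 => ->; rewrite mulmx0.
Qed.

(** If the first row [b] of [B] is generic, then [b Z = 0] and [b X Z = 0] leave no
    room for a nonzero column of [Z], by [orth_col_eq0]; and the [B] with generic
    first row span. *)
Lemma linear_relation_eq0 (F : fieldType) s t a (X : {vspace 'M[F]_t})
    (R : 'M[F]_(a, t) -> 'M[F]_(t, s) -> Prop) :
  has_elements F t -> max_unit_shift X -> (0 < a)%N ->
  (forall B Z B' Z', R B Z -> R B' Z' -> R (B + B') (Z + Z')) ->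
  (forall B, exists Z, R B Z) ->
  (forall B Z, R B Z -> B *m Z = 0) ->
  (forall B Z K, R B Z -> K \in X -> B *m (K *m Z) = 0) ->
  forall B Z, R B Z -> Z = 0.
Proof.
move=> hF maxX; case: a R => // a R _ RD Rsurj R0 RX.
case: (posnP t) => [t0 B Z _|t0].
  by apply/matrixP=> i; have := ltn_ord i; rewrite {2}t0.
have [e e0 eP] := rank1_right_proper hF maxX.1 t0.
have [uX dX] := maxX.
have maxXt : max_unit_shift (trv X) by split; [apply: unit_shift_trv | rewrite dim_trv].
have generic B Z : R B Z -> row 0 B *m e != 0 -> Z = 0.
  move=> RBZ be; apply: mx_eq0_forms => y x.
  suff : (Z *m x)^T = 0.
    by move=> /(congr1 trmx); rewrite trmxK trmx0 -mulmxA => ->; rewrite mulmx0.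
  apply: (orth_col_eq0 hF maxXt (c := (row 0 B)^T)).
  - by apply: contraNneq be => b0; rewrite -[row 0 B]trmxK b0 trmx0 mul0mx.
  - move=> l; rewrite mem_trv trmx_mul trmxK => lB; apply: trmx_inj; rewrite trmx0.
    by apply/eqP; apply: contraNT be => l0; apply/eqP; apply: eP l0 lB.
  - by rewrite -trmx_mul mulmxA -row_mul (R0 _ _ RBZ) row0 mul0mx trmx0.
  move=> M; rewrite mem_trv => MX; rewrite -[M]trmxK -!trmx_mul !mulmxA.
  by rewrite -!row_mul -(mulmxA B) (RX _ _ _ RBZ MX) mul0mx row0 trmx0.
move=> B Z RBZ; have [be|] := eqVneq (row 0 B *m e) 0; last exact: generic RBZ.
have /rV0Pn[j ej] : e^T != 0 by rewrite -trmx0 (inj_eq trmx_inj).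
pose B0 : 'M[F]_(a.+1, t) := delta_mx 0 j.
have B0e : row 0 B0 *m e != 0.
  have -> : row 0 B0 = delta_mx 0 j by apply/rowP=> k; rewrite !mxE.
  by rewrite -rowE mx11_eq0 mxE; rewrite mxE in ej.
have [Z0 RB0] := Rsurj B0.
have ZZ0 : Z + Z0 = 0.
  apply: generic (RD _ _ _ _ RBZ RB0) _.
  by rewrite linearD mulmxDl be add0r.
by have := ZZ0; rewrite (generic _ _ RB0 B0e) addr0.
Qed.

(** * The normal form of the translation space *)

(** The rank is at most [s] plus that of [R] on top of [B], and at most [t] plus
    that of [P] next to [C]. *)
Lemma rank_split_blocks (F : fieldType) s t a b (P : 'M[F]_s) (Q : 'M_(s, t))
    (R : 'M_t) (C : 'M_(s, b)) (B : 'M_(a, t)) :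
  \rank (block_mx (block_mx P Q 0 R) (col_mx C 0) (row_mx 0 B) 0) = (s + t)%N ->
  \rank (row_mx P C) = s /\ \rank (col_mx R B) = t.
Proof.
set X := block_mx _ _ _ _ => rX.
pose L1 : 'M[F]_((s + t) + a, s) := col_mx (col_mx 1%:M 0) 0.
pose L2 : 'M[F]_((s + t) + a, t + a) := block_mx (col_mx 0 1%:M) 0 0 1%:M.
pose R1 : 'M[F]_(s + b, (s + t) + b) := block_mx (row_mx 1%:M 0) 0 0 1%:M.
pose R2 : 'M[F]_(t, (s + t) + b) := row_mx (row_mx 0 1%:M) 0.
have XE : X = col_mx (col_mx (row_mx (row_mx P Q) C) (row_mx (row_mx 0 R) 0))
    (row_mx (row_mx 0 B) 0).
  by rewrite /X block_mxEv (block_mxEv P) -block_mxEh block_mxEv.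
have X1 : X = L1 *m row_mx (row_mx P Q) C + L2 *m col_mx R B *m R2.
  rewrite XE /L1 /L2 mul_block_col mul0mx ?addr0 ?add0r mul1mx !mul_col_mx !mul1mx !mul0mx.
  by rewrite /R2 !mul_mx_row !mulmx1 !mulmx0 !add_col_mx ?addr0 ?add0r.
have X2 : X = L1 *m row_mx P C *m R1 + col_mx (col_mx Q R) B *m R2.
  rewrite XE /L1 /R1 /R2 !mul_col_mx !mul1mx !mul0mx mul_row_block !mulmx0 mulmx1 ?addr0 ?add0r.
  rewrite !mul_mx_row !mulmx1 !mulmx0 !add_col_mx !add_row_mx ?addr0 ?add0r.
  by [].
have r1 : (\rank X <= s + \rank (col_mx R B))%N.
  rewrite X1; apply: leq_trans (mxrank_add _ _) _; apply: leq_add.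
    exact: mulmx_max_rank.
  exact: leq_trans (mxrankM_maxl _ _) (mxrankM_maxr _ _).
have r2 : (\rank X <= \rank (row_mx P C) + t)%N.
  rewrite X2; apply: leq_trans (mxrank_add _ _) _; apply: leq_add.
    exact: leq_trans (mxrankM_maxl _ _) (mxrankM_maxr _ _).
  exact: mulmx_max_rank.
have := rank_leq_row (row_mx P C); have := rank_leq_col (col_mx R B).
move: r1 r2; rewrite rX leq_add2l leq_add2r => h1 h2 h3 h4.
by split; apply/eqP; rewrite eqn_leq ?h1 ?h2 ?h3 ?h4.
Qed.

Lemma quadratic_coef_eq0 (F : fieldType) (V : lmodType F) (x y : V) :
  has_elements F 3 -> (forall k : F, (k * k) *: x + k *: y = 0) -> x = 0 /\ y = 0.
Proof.
move=> hF xy; (* A scalar [t] different from [0] and [1]. *)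
have [||t tP] := @avoid_roots F [:: (0, 1); (-1, 1)].
- by [].
- by move=> p; rewrite !inE => /orP[]/eqP ->; rewrite xpair_eqE oner_eq0 andbF.
have t0 : t != 0 by have := tP (0, 1); rewrite inE eqxx /= add0r mulr1; apply.
have t1 : t - 1 != 0.
  by have := tP (-1, 1); rewrite !inE eqxx orbT /= mulr1 addrC; apply.
have yx : y = - x.
  by have /eqP := xy 1; rewrite mul1r !scale1r addrC addr_eq0 => /eqP.
have : (t * (t - 1)) *: x = 0.
  by have := xy t; rewrite yx scalerN -scalerBl mulrBr mulr1.
have u : t * (t - 1) != 0 by rewrite mulf_neq0.
move/(congr1 ( *:%R (t * (t - 1))^-1)); rewrite scaler0 scalerA mulVf // scale1r => x0.
by rewrite yx x0 oppr0.
Qed.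

Section SplitShift.
Variables (F : fieldType) (s t a b : nat) (V : {vspace 'M[F]_((s + t) + a, (s + t) + b)}).
Hypotheses (hF : has_elements F (s + t).+2) (a0 : (0 < a)%N) (b0 : (0 < b)%N).
Hypotheses (cV : corner_shift V) (sV : split_shift V).

Let blk (A : 'M[F]_(s + t)) (C : 'M[F]_(s, b)) (B : 'M[F]_(a, t)) :
  'M_((s + t) + a, (s + t) + b) := block_mx A (col_mx C 0) (row_mx 0 B) 0.

Lemma blkD k A C B A' C' B' :
  k *: blk A C B + blk A' C' B' = blk (k *: A + A') (k *: C + C') (k *: B + B').
Proof.
by rewrite /blk scale_block_mx add_block_mx scale_col_mx scale_row_mx add_col_mx
  add_row_mx !scaler0 !addr0.
Qed.

Lemma corner_blk K : (K \in corner V) = (blk K 0 0 \in V).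
Proof. by rewrite mem_corner /blk col_mx0 row_mx0. Qed.

Let max_corner : max_unit_shift (corner V).
Proof. by have [] := sV. Qed.

Let hFr : has_elements F (s + t).
Proof. by apply: has_elementsW hF; rewrite ltnW. Qed.

Let corner_split : exists (W1 : {vspace 'M[F]_s}) (W2 : {vspace 'M[F]_t}),
  [/\ max_unit_shift W1, max_unit_shift W2 &
    forall M, M \in corner V <-> [/\ dlsubmx M = 0, ulsubmx M \in W1 & drsubmx M \in W2]].
Proof. by have [_ dl0 _ _] := sV; apply: max_unit_shift_block. Qed.

(** The coefficients [B A C] and [B A A C], compared at [A] and at [A + K] with
    [K] block diagonal. *)
Lemma split_shift_coefs A C B K1 K2 : blk A C B \in V -> block_mx K1 0 0 K2 \in corner V ->
  B *m dlsubmx A *m C = 0 /\ B *m (K2 *m dlsubmx A + dlsubmx A *m K1) *m C = 0.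
Proof.
move=> MV; rewrite corner_blk => KV.
have [_ _ BAC BAAC] := corner_shift_coefs hF cV MV.
have := memvD KV MV; rewrite -[blk _ 0 0]scale1r blkD !scale1r !add0r.
move=> /(corner_shift_coefs hF cV)[_ _ _].
have BX (M : 'M_(s + t)) : row_mx 0 B *m (M *m col_mx C 0) = B *m dlsubmx M *m C.
  rewrite -{1}[M]submxK mul_block_col !mulmx0 !addr0 mul_row_col mul0mx add0r.
  by rewrite mulmxA.
rewrite BX in BAC; rewrite (mulmxA (_ + A)) BX; rewrite (mulmxA A) BX in BAAC.
have dlM (M N : 'M_(s + t)) : dlsubmx (M *m N) =
    dlsubmx M *m ulsubmx N + drsubmx M *m dlsubmx N.
  by rewrite -{1}[M]submxK -{1}[N]submxK mulmx_block block_mxKdl.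
have dlD (M N : 'M_(s + t)) : dlsubmx (M + N) = dlsubmx M + dlsubmx N.
  by rewrite -{1}[M]submxK -{1}[N]submxK add_block_mx block_mxKdl.
move=> e; split=> //; move: e BAAC; rewrite mulmxDl !mulmxDr !dlD !dlM.
rewrite block_mxKdl block_mxKul block_mxKdr !mul0mx !mulmx0 !add0r !addr0.
move=> e1 e2; move: e1; rewrite addrA mulmxDr mulmxDl e2 addr0 => <-.
by rewrite mulmxDr.
Qed.

Let hF3 : has_elements F 3 \/ (s + t = 0)%N.
Proof.
case: (posnP (s + t)) => [|st]; [by right | left].
by apply: has_elementsW hF; rewrite !ltnS.
Qed.

(** Scaling one of two independent elements separates their contributions. *)
Lemma split_shift_polar A B A' C K1 K2 :
  blk A 0 B \in V -> blk A' C 0 \in V -> block_mx K1 0 0 K2 \in corner V ->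
  [/\ B *m dlsubmx A *m C = 0, B *m dlsubmx A' *m C = 0,
      B *m (K2 *m dlsubmx A + dlsubmx A *m K1) *m C = 0 &
      B *m (K2 *m dlsubmx A' + dlsubmx A' *m K1) *m C = 0].
Proof.
move=> MV M'V KV; case: hF3 => [h3|st0]; last first.
  have t0 : t = 0%N by apply/eqP; move/eqP: st0; rewrite addn_eq0 => /andP[].
  have Z (M : 'M_(t, b)) (D : 'M_(a, t)) : D *m M = 0.
    by apply/matrixP=> i j; rewrite !mxE big1 // => k; have := ltn_ord k; rewrite {2}t0.
  by rewrite -!mulmxA !Z.
have coefs k : k *: B *m dlsubmx (k *: A + A') *m C = 0 /\ k *: B *m
    (K2 *m dlsubmx (k *: A + A') + dlsubmx (k *: A + A') *m K1) *m C = 0.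
  apply: split_shift_coefs KV.
  by have := memvD (memvZ k MV) M'V; rewrite blkD scaler0 add0r addr0.
have dlE k : dlsubmx (k *: A + A') = k *: dlsubmx A + dlsubmx A'.
  by rewrite -{1}[A]submxK -{1}[A']submxK scale_block_mx add_block_mx block_mxKdl.
have [k|e1 e2] := quadratic_coef_eq0 (x := B *m dlsubmx A *m C) (y := B *m dlsubmx A' *m C) h3.
  have [+ _] := coefs k; rewrite dlE => <-.
  by rewrite mulmxDr mulmxDl -!scalemxAl -!scalemxAr -!scalemxAl scalerA.
have [k|e3 e4] := quadratic_coef_eq0 (x := B *m (K2 *m dlsubmx A + dlsubmx A *m K1) *m C)
   (y := B *m (K2 *m dlsubmx A' + dlsubmx A' *m K1) *m C) h3; last by split.
have [_ +] := coefs k; rewrite dlE => <-.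
have -> : K2 *m (k *: dlsubmx A + dlsubmx A') + (k *: dlsubmx A + dlsubmx A') *m K1 =
    k *: (K2 *m dlsubmx A + dlsubmx A *m K1) + (K2 *m dlsubmx A' + dlsubmx A' *m K1).
  by rewrite mulmxDr mulmxDl -scalemxAr -scalemxAl addrACA scalerDr.
move: (K2 *m dlsubmx A + _) (K2 *m dlsubmx A' + _) => U U'.
by rewrite mulmxDr mulmxDl -!scalemxAl -!scalemxAr -!scalemxAl scalerA.
Qed.

(** The contribution of [B] and that of [C] to the lower left block [Z] vanish
    separately, by [linear_relation_eq0] applied to [Z] and to its transpose. *)
Lemma split_shift_dl0 A C B : blk A C B \in V -> dlsubmx A = 0.
Proof.
have [W1 [W2 [maxW1 maxW2 WP]]] := corner_split; have [_ _ _ surj] := sV.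
have KV K1 K2 : K1 \in W1 -> K2 \in W2 -> block_mx K1 0 0 K2 \in corner V.
  by move=> K1W K2W; apply/WP; rewrite block_mxKdl block_mxKul block_mxKdr.
have dlB A0 B0 : blk A0 0 B0 \in V -> dlsubmx A0 = 0.
  move=> A0V; pose R (B : 'M_(a, t)) (Z : 'M_(t, s)) := exists2 A, dlsubmx A = Z & blk A 0 B \in V.
  apply: (@linear_relation_eq0 F s t a W2 R) (B0) (dlsubmx A0) _ => //.
  - by apply: has_elementsW hFr; rewrite leq_addl.
  - move=> B1 Z1 B2 Z2 [A1 <- V1] [A2 <- V2]; exists (A1 + A2).
      by rewrite -{1}[A1]submxK -{1}[A2]submxK add_block_mx block_mxKdl.
    by have := memvD V1 V2; rewrite -[blk A1 _ _]scale1r blkD !scale1r addr0.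
  - by move=> B1; have [A1 A1V] := surj B1 0; exists (dlsubmx A1), A1.
  - move=> B1 _ [A1 <- V1]; apply: (mx_mul_eq0 b0) => C1.
    have [A2 V2] := surj 0 C1.
    by have [] := split_shift_polar V1 V2 (KV 0 0 (mem0v _) (mem0v _)).
  - move=> B1 _ K [A1 <- V1] KW; apply: (mx_mul_eq0 b0) => C1.
    have [A2 V2] := surj 0 C1.
    by have [_ _] := split_shift_polar V1 V2 (KV 0 K (mem0v _) KW); rewrite mulmx0 addr0.
  by exists A0.
have dlC A0 C0 : blk A0 C0 0 \in V -> dlsubmx A0 = 0.
  move=> A0V; pose R (B : 'M_(b, s)) (Z : 'M_(s, t)) :=
    exists2 A, (dlsubmx A)^T = Z & blk A B^T 0 \in V.
  apply: trmx_inj; rewrite trmx0.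
  apply: (@linear_relation_eq0 F t s b (trv W1) R) (C0^T) _ _ => //.
  - by apply: has_elementsW hFr; rewrite leq_addr.
  - by split; [apply: unit_shift_trv maxW1.1 | rewrite dim_trv maxW1.2].
  - move=> B1 Z1 B2 Z2 [A1 <- V1] [A2 <- V2]; exists (A1 + A2).
      by rewrite -{1}[A1]submxK -{1}[A2]submxK add_block_mx block_mxKdl linearD.
    by have := memvD V1 V2; rewrite -[blk A1 _ _]scale1r blkD !scale1r addr0 linearD.
  - by move=> B1; have [A1 A1V] := surj 0 B1^T; exists (dlsubmx A1)^T, A1.
  - move=> B1 _ [A1 <- V1]; apply: trmx_inj; rewrite trmx_mul trmxK trmx0.
    apply: trmx_inj; rewrite trmx0; apply: (mx_mul_eq0 a0) => B2.
    apply: trmx_inj; rewrite trmx_mul trmxK trmx0 mulmxA.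
    have [A2 V2] := surj B2^T 0.
    by have [] := split_shift_polar V2 V1 (KV 0 0 (mem0v _) (mem0v _)).
  - move=> B1 _ K [A1 <- V1]; rewrite mem_trv => KW.
    apply: trmx_inj; rewrite !trmx_mul trmxK trmx0.
    apply: trmx_inj; rewrite trmx0; apply: (mx_mul_eq0 a0) => B2.
    apply: trmx_inj; rewrite trmx_mul trmxK trmx0 !mulmxA.
    have [A2 V2] := surj B2^T 0.
    have [_ _ _] := split_shift_polar V2 V1 (KV K^T 0 KW (mem0v _)).
    by rewrite mul0mx add0r mulmxA.
  by exists A0; rewrite ?trmxK.
move=> AV; have [A' A'V] := surj B 0.
have : blk (A - A') C 0 \in V.
  have := memvD (memvZ (-1) A'V) AV; rewrite -/(blk A' 0 B) blkD !scaleN1r addNr.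
  by rewrite oppr0 add0r addrC.
have dlD : dlsubmx (A - A') = dlsubmx A - dlsubmx A'.
  by rewrite -{1}[A]submxK -{1}[A']submxK opp_block_mx add_block_mx block_mxKdl.
by move/dlC; rewrite dlD (dlB _ _ A'V) subr0.
Qed.

(** With a zero lower left block, the first diagonal block next to [C] and the
    second one above [B] have full rank separately, so that
    [column_shift_linear] applies to each of them, up to transposition for the
    first. *)
Lemma split_shift_normal_form :
  exists (W1 : {vspace 'M[F]_s}) (W2 : {vspace 'M[F]_t}) (X : 'M[F]_(b, s)) (Y : 'M[F]_(t, a)),
  [/\ max_unit_shift W1, max_unit_shift W2 & forall A C B,
    blk A C B \in V <-> [/\ dlsubmx A = 0, ulsubmx A - C *m X \in W1 &
                           drsubmx A - Y *m B \in W2]].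
Proof.
have [W1 [W2 [maxW1 maxW2 WP]]] := corner_split; have [_ _ _ surj] := sV.
have blkV A C B : blk A C B \in V -> exists A12,
   A = block_mx (ulsubmx A) A12 0 (drsubmx A) /\
   \rank (row_mx (1%:M + ulsubmx A) C) = s /\ \rank (col_mx (1%:M + drsubmx A) B) = t.
  move=> AV; exists (ursubmx A); have dl := split_shift_dl0 AV.
  rewrite -{1}dl submxK; split=> //; apply: (@rank_split_blocks _ _ _ _ _ _ (ursubmx A)).
  have := cV AV; rewrite /blk -{1}[A]submxK dl (scalar_mx_block s t) !add_block_mx.
  by rewrite !add0r.
have blkD1 A C B A' C' B' : blk A C B \in V -> blk A' C' B' \in V ->
    forall k, blk (k *: A + A') (k *: C + C') (k *: B + B') \in V.
  by move=> V1 V2 k; rewrite -blkD memvD // memvZ.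
have cornerV (K1 : 'M_s) (K2 : 'M_t) : K1 \in W1 -> K2 \in W2 ->
    blk (block_mx K1 0 0 K2) 0 0 \in V.
  move=> K1W K2W; rewrite -corner_blk; apply/WP.
  by rewrite block_mxKdl block_mxKul block_mxKdr.
have [Y YP] : exists Y : 'M_(t, a), forall K B,
    (exists A C, drsubmx A = K /\ blk A C B \in V) <-> K - Y *m B \in W2.
  apply: column_shift_linear => //.
  - by apply: has_elementsW hF; rewrite !ltnS leq_addl.
  - move=> k K B K' B' [A [C [<- AV]]] [A' [C' [<- A'V]]].
    exists (k *: A + A'), (k *: C + C'); split; last exact: blkD1.
    by rewrite -{1}[A]submxK -{1}[A']submxK scale_block_mx add_block_mx block_mxKdr.
  - move=> K KW; exists (block_mx 0 0 0 K), 0.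
    by rewrite block_mxKdr; split=> //; apply: cornerV; rewrite ?mem0v.
  - by move=> B; have [A AV] := surj B 0; exists (drsubmx A), A, 0.
  move=> K B x [A [C [<- /blkV[_ [_ [_ rB]]]]]] Ax Bx.
  have /row_freeP[L LE] : row_free (col_mx (1%:M + drsubmx A) B)^T.
    by rewrite /row_free mxrank_tr rB.
  rewrite -[x]mul1mx -[1%:M]trmx1 -LE trmx_mul trmxK -mulmxA mul_col_mx mulmxDl mul1mx.
  by rewrite Ax Bx col_mx0 mulmx0.
have [X XP] : exists X : 'M_(s, b), forall K C,
    (exists A B, (ulsubmx A)^T = K /\ blk A C^T B \in V) <-> K - X *m C \in trv W1.
  apply: column_shift_linear => //.
  - by apply: has_elementsW hF; rewrite !ltnS leq_addr.
  - by split; [apply: unit_shift_trv maxW1.1 | rewrite dim_trv maxW1.2].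
  - move=> k K C K' C' [A [B [<- AV]]] [A' [B' [<- A'V]]].
    exists (k *: A + A'), (k *: B + B'); split; last by rewrite linearP; apply: blkD1.
    by rewrite -{1}[A]submxK -{1}[A']submxK scale_block_mx add_block_mx block_mxKul linearP.
  - move=> K; rewrite mem_trv => KW; exists (block_mx K^T 0 0 0), 0.
    by rewrite block_mxKul trmxK trmx0; split=> //; apply: cornerV; rewrite ?mem0v.
  - by move=> C; have [A AV] := surj 0 C^T; exists (ulsubmx A)^T, A, 0.
  move=> K C x [A [B [<- /blkV[_ [_ [rC _]]]]]] Ax Cx.
  have /row_freeP[L LE] : row_free (row_mx (1%:M + ulsubmx A) C^T).
    by rewrite /row_free rC.
  rewrite -[x]mul1mx -[1%:M]trmx1 -LE trmx_mul -mulmxA tr_row_mx trmxK mul_col_mx.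
  by rewrite linearD /= trmx1 mulmxDl mul1mx Ax Cx col_mx0 mulmx0.
exists W1, W2, X^T, Y; split=> // A C B; split=> [AV|[dl ul dr]].
  split; first exact: split_shift_dl0 AV.
    have := (XP (ulsubmx A)^T C^T).1; rewrite mem_trv linearB /= trmx_mul !trmxK; apply.
    by exists A, B.
  by apply/YP; exists A, C.
have [A0 A0V] := surj B C; have [A12 [A0E _]] := blkV _ _ _ A0V.
have : blk (A - A0) 0 0 \in V.
  rewrite -corner_blk; apply/WP.
  rewrite -{1 2 3}[A]submxK {1 2 3}A0E opp_block_mx add_block_mx.
  rewrite block_mxKdl block_mxKul block_mxKdr dl subr0; split=> //.
    have -> : ulsubmx A - ulsubmx A0 =
        (ulsubmx A - C *m X^T) - (ulsubmx A0 - C *m X^T) by rewrite opprB addrA subrK.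
    apply: memvB => //; have := (XP (ulsubmx A0)^T C^T).1.
    by rewrite mem_trv linearB /= trmx_mul !trmxK; apply; exists A0, B.
  have -> : drsubmx A - drsubmx A0 =
      (drsubmx A - Y *m B) - (drsubmx A0 - Y *m B) by rewrite opprB addrA subrK.
  by apply: memvB => //; apply/YP; exists A0, C.
by move/memvD/(_ A0V); rewrite -[blk (A - A0) _ _]scale1r blkD !scale1r !add0r subrK.
Qed.

(** The corner and the blocks [B2], [C1] leave no room for more; the conclusion
    forces [s = 0] when [b < a]. *)
Lemma dim_split_shift : ('C(s + t, 2) + (s + t) * a <= \dim V)%N -> (s * a <= s * b)%N.
Proof.
pose f : 'Hom('M[F]_((s + t) + a, (s + t) + b), ('M[F]_(a, t) * 'M[F]_(s, b))%type) :=
  pairh (linfun (rsubmx \o (lsubmx \o dsubmx))) (linfun (usubmx \o (rsubmx \o usubmx))).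
have fE A C B : f (blk A C B) = (B, C).
  by rewrite /f /blk pairhE !lfunE /= block_mxEv col_mxKd col_mxKu row_mxKl !row_mxKr col_mxKu.
have [_ _ VE _] := sV.
pose h := linfun (mulmxr (row_mx 1%:M 0 : 'M[F]_(s + t, (s + t) + b)) \o
           mulmx (col_mx 1%:M 0 : 'M[F]_((s + t) + a, s + t))).
have d1 : (\dim V <= \dim (h @: corner V) + \dim {: ('M[F]_(a, t) * 'M[F]_(s, b))%type})%N.
  apply: (dim_le_ker_img (f := f)) => M MV; last exact: memvf.
  have [A [B [C ME]]] := VE M MV; move: MV; rewrite ME -/(blk A C B) fE => MV [B0 C0].
  move: MV; rewrite B0 C0 -corner_blk => AW; apply/memv_imgP; exists A => //.
  by rewrite lfunE /= -block_corner /blk col_mx0 row_mx0.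
have d2 : (\dim (h @: corner V) <= \dim (corner V))%N.
  by rewrite -[X in (_ <= X)%N](limg_ker_dim h) leq_addl.
have d3 := dim_unit_shift hFr max_corner.1.
have d4 : (\dim {: ('M[F]_(a, t) * 'M[F]_(s, b))%type} <= a * t + s * b)%N.
  pose p1 : 'Hom(('M[F]_(a, t) * 'M[F]_(s, b))%type, 'M[F]_(a, t)) := linfun fst.
  pose p2 : 'Hom(('M[F]_(a, t) * 'M[F]_(s, b))%type, 'M[F]_(s, b)) := linfun snd.
  rewrite addnC -!(dim_fullmx F); apply: leq_trans (_ : _ <= \dim (lker p1) + _)%N _.
    apply: (dim_le_ker_img (f := p1)) => [u _ u0|*]; last exact: memvf.
    by rewrite memv_ker u0.
  rewrite leq_add2r; apply: (dim_le_inj (f := p2)) => [[B C]|*]; last exact: memvf.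
  by rewrite memv_ker !lfunE /= => /eqP-> ->.
have arith (c x y z v : nat) : (v <= x + y -> x <= z -> z <= c -> y <= a * t + s * b ->
  c + (s + t) * a <= v -> s * a <= s * b)%N by lia.
exact: arith d1 d2 d3 d4.
Qed.
End SplitShift.

(** * Existence of the wedge decomposition *)

Lemma mx_equivalent_sym (F : fieldType) n p (X Y : set 'M[F]_(n, p)) :
  mx_equivalent X Y -> mx_equivalent Y X.
Proof.
move=> [P [Q [uP uQ ->]]]; exists (invmx P), (invmx Q); rewrite !unitmx_inv; split=> //.
apply/seteqP; split=> [M XM|_ [_ [M XM <-] <-]].
  exists (P *m M *m Q); first by exists M.
  by rewrite !mulmxA mulVmx // mul1mx mulmxK.
by rewrite !mulmxA mulVmx // mul1mx mulmxK.
Qed.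

Lemma mx_equivalent_trans (F : fieldType) n p (X Y Z : set 'M[F]_(n, p)) :
  mx_equivalent X Y -> mx_equivalent Y Z -> mx_equivalent X Z.
Proof.
move=> [P [Q [uP uQ ->]]] [P' [Q' [uP' uQ' ->]]].
exists (P' *m P), (Q *m Q'); rewrite !unitmx_mul uP uQ uP' uQ'; split=> //.
apply/seteqP; split=> [_ [_ [M XM <-] <-]|_ [M XM <-]].
  by exists M; rewrite ?mulmxA.
by exists (P *m M *m Q); [exists M | rewrite !mulmxA].
Qed.

Definition translate (F : fieldType) m n (J : 'M[F]_(m, n)) (V : {vspace 'M[F]_(m, n)}) :
  set 'M[F]_(m, n) := [set J + M | M in [set` V]].

Lemma mem_translate (F : fieldType) m n (J Z : 'M[F]_(m, n)) V :
  translate J V Z <-> Z - J \in V.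
Proof.
split=> [[M MV <-]|ZV]; first by rewrite addrC addKr.
by exists (Z - J) => //; rewrite addrC subrK.
Qed.

Lemma mx_equivalent_translate (F : fieldType) m n P Q (J : 'M[F]_(m, n)) V :
  P \in unitmx -> Q \in unitmx ->
  mx_equivalent (translate J V) (translate (P *m J *m Q) (eqv P Q V)).
Proof.
move=> uP uQ; exists P, Q; split=> //; apply/seteqP; split=> Z.
  case/mem_translate/memv_imgP=> M MV; rewrite lfunE /= => ZE.
  exists (J + M); first by exists M.
  by rewrite mulmxDr mulmxDl -ZE addrC subrK.
case=> _ [M MV <-] <-; apply/mem_translate.
rewrite mulmxDr mulmxDl addrC addKr; apply/memv_imgP; exists M => //.
by rewrite lfunE.
Qed.

Lemma optimal_translate (F : fieldType) r (W : {vspace 'M[F]_r}) :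
  has_elements F r -> max_unit_shift W -> optimal (translate 1%:M W).
Proof.
move=> hF [uW dW]; split.
  by exists 1%:M, W; split=> //; apply/eqP; rewrite eqn_leq dW dim_unit_shift.
by move=> _ [M MW <-]; apply: (unit_shiftP W).1.
Qed.

Lemma wedgeE (F : fieldType) n p s t m q (en : (s + (t + m))%N = n)
    (ep : (t + (s + q))%N = p) (MM : set 'M[F]_t) (NN : set 'M[F]_s) :
  wedge n p MM NN = [set X | exists M N A C D, [/\ MM M, NN N &
    X = castmx (en, ep) (block_mx A (row_mx N C) (col_mx M D) 0)]].
Proof.
have em : m = (n - (s + t))%N by lia.
have eq : q = (p - (s + t))%N by lia.
subst m q; apply/seteqP; split=> X.
  case=> en' [ep' [M [N [A [C [D [MM1 NN1 ->]]]]]]]; exists M, N, A, C, D.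
  by rewrite (eq_irrelevance en en') (eq_irrelevance ep ep').
by case=> M [N [A [C [D H]]]]; exists en, ep, M, N, A, C, D.
Qed.

(** The forms [a_i] and the vectors [b_j] are the two bases in which the set takes
    the shape of a wedge. *)
Lemma wedge_of_blocks (F : fieldType) n p s t m q (en : (s + (t + m))%N = n)
    (ep : (t + (s + q))%N = p) (MM : set 'M[F]_t) (NN : set 'M[F]_s)
    (S : set 'M[F]_(n, p)) (a1 : 'M_(s, n)) (a2 : 'M_(t, n)) (a3 : 'M_(m, n))
    (b1 : 'M_(p, t)) (b2 : 'M_(p, s)) (b3 : 'M_(p, q)) :
  (exists R, col_mx a1 (col_mx a2 a3) *m R = 1%:M) ->
  (exists R, R *m row_mx b1 (row_mx b2 b3) = 1%:M) ->
  (forall Z, S Z <-> [/\ MM (a2 *m Z *m b1), NN (a1 *m Z *m b2),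
     a2 *m Z *m b2 = 0 /\ a2 *m Z *m b3 = 0 & a3 *m Z *m b2 = 0 /\ a3 *m Z *m b3 = 0]) ->
  mx_equivalent S (wedge n p MM NN).
Proof.
rewrite (wedgeE en ep); case: n / en S a1 a2 a3 => S a1 a2 a3.
case: p / ep S b1 b2 b3 => S b1 b2 b3 [R PR] [R' QR'] SP.
set P := col_mx a1 _ in PR; set Q := row_mx b1 _ in QR'.
have uP : P \in unitmx by have [] := mulmx1_unit PR.
have uQ : Q \in unitmx by have [] := mulmx1_unit QR'.
have PZQ Z : P *m Z *m Q = block_mx (a1 *m Z *m b1) (row_mx (a1 *m Z *m b2) (a1 *m Z *m b3))
    (col_mx (a2 *m Z *m b1) (a3 *m Z *m b1))
    (block_mx (a2 *m Z *m b2) (a2 *m Z *m b3) (a3 *m Z *m b2) (a3 *m Z *m b3)).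
  by rewrite /P /Q !mul_col_mx !mul_mx_row !block_mxEv -block_mxEh block_mxEv.
exists P, Q; split=> //; apply/seteqP; split=> X.
  case=> M [N [A [C [D [MM1 NN1 XE]]]]].
  exists (invmx P *m X *m invmx Q); last first.
    by rewrite !mulmxA mulmxV // mul1mx mulmxKV.
  have : P *m (invmx P *m X *m invmx Q) *m Q = X.
    by rewrite !mulmxA mulmxV // mul1mx mulmxKV.
  rewrite PZQ XE castmx_id => /eq_block_mx[_ /eq_row_mx[eN _] /eq_col_mx[eM _]].
  rewrite -[0 in RHS](block_mx0 F t m s q) => /eq_block_mx[e1 e2 e3 e4].
  by apply/SP; rewrite eM eN e1 e2 e3 e4.
case=> Z /SP[MM1 NN1 [e1 e2] [e3 e4]] <-.
exists (a2 *m Z *m b1), (a1 *m Z *m b2), (a1 *m Z *m b1), (a1 *m Z *m b3), (a3 *m Z *m b1).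
by split=> //; rewrite castmx_id PZQ e1 e2 e3 e4 block_mx0.
Qed.

Lemma col_row_scalar_mx (F : fieldType) s t m :
  col_mx (row_mx 1%:M (row_mx 0 0)) (col_mx (row_mx 0 (row_mx 1%:M 0))
    (row_mx 0 (row_mx 0 1%:M))) = 1%:M :> 'M[F]_(s + (t + m)).
Proof.
rewrite (scalar_mx_block s (t + m)) (scalar_mx_block t m) block_mxEv row_mx0.
by rewrite -(col_mx0 F t m s) (block_mxEv 1%:M 0 0 1%:M) -block_mxEh block_mxEv.
Qed.

(** The matrices [X] and [Y] of [split_shift_normal_form] are the column and row
    operations that bring the set to the shape of a wedge. *)
Lemma split_shift_wedge (F : fieldType) s t a b
    (V : {vspace 'M[F]_((s + t) + a, (s + t) + b)}) :
  has_elements F (s + t).+2 -> (0 < a)%N -> (0 < b)%N ->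
  corner_shift V -> split_shift V ->
  exists (M : set 'M[F]_t) (N : set 'M[F]_s), [/\ optimal M, optimal N &
    mx_equivalent (translate (block_mx 1%:M 0 0 0) V)
      (wedge ((s + t) + a) ((s + t) + b) M N)].
Proof.
move=> hF a0 b0 cV sV.
have [W1 [W2 [X [Y [maxW1 maxW2 VP]]]]] := split_shift_normal_form hF a0 b0 cV sV.
have hF1 : has_elements F s by apply: has_elementsW hF; rewrite -addnS -addnS leq_addr.
have hF2 : has_elements F t by apply: has_elementsW hF; rewrite -2!addSn leq_addl.
exists (translate 1%:M W2), (translate 1%:M W1).
split; [exact: optimal_translate | exact: optimal_translate |].
pose a1 : 'M[F]_(s, (s + t) + a) := row_mx (row_mx 1%:M 0) 0.
pose a2 : 'M[F]_(t, (s + t) + a) := row_mx (row_mx 0 1%:M) (- Y).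
pose a3 : 'M[F]_(a, (s + t) + a) := row_mx 0 1%:M.
pose b1 : 'M[F]_((s + t) + b, t) := col_mx (col_mx 0 1%:M) 0.
pose b2 : 'M[F]_((s + t) + b, s) := col_mx (col_mx 1%:M 0) (- X).
pose b3 : 'M[F]_((s + t) + b, b) := col_mx 0 1%:M.
apply: (wedge_of_blocks (addnA s t a) (_ : t + (s + b) = s + t + b)%N
  (a1 := a1) (a2 := a2) (a3 := a3) (b1 := b1) (b2 := b2) (b3 := b3)).
- by rewrite addnA (addnC t).
- exists (row_mx (col_mx (col_mx 1%:M 0) 0)
           (row_mx (col_mx (col_mx 0 1%:M) 0) (col_mx (col_mx 0 Y) 1%:M))).
  rewrite -col_row_scalar_mx !mul_col_mx !mul_mx_row /a1 /a2 /a3 !mul_row_col.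
  by rewrite !mul1mx !mul0mx !mulmx0 ?mulmx1 !addr0 !add0r addrN.
- exists (col_mx (row_mx (row_mx 0 1%:M) 0)
           (col_mx (row_mx (row_mx 1%:M 0) 0) (row_mx (row_mx X 0) 1%:M))).
  rewrite -col_row_scalar_mx !mul_col_mx !mul_mx_row /b1 /b2 /b3 !mul_row_col.
  by rewrite !mul1mx !mul0mx !mulmx0 ?mulmx1 !addr0 !add0r addrN.
move=> Z; rewrite mem_translate.
pose A := ulsubmx Z; pose C := ursubmx Z; pose B := dlsubmx Z; pose D := drsubmx Z.
have ZE : Z = block_mx A C B D by rewrite submxK.
have a1Z : a1 *m Z = row_mx (usubmx A) (usubmx C).
  rewrite ZE /a1 mul_row_block !mul0mx !addr0 -{1}[A]vsubmxK -{1}[C]vsubmxK.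
  by rewrite !mul_row_col !mul1mx !mul0mx !addr0.
have a2Z : a2 *m Z = row_mx (dsubmx A - Y *m B) (dsubmx C - Y *m D).
  rewrite ZE /a2 mul_row_block -{1}[A]vsubmxK -{1}[C]vsubmxK.
  by rewrite !mul_row_col !mul1mx !mul0mx !add0r !mulNmx.
have a3Z : a3 *m Z = row_mx B D.
  by rewrite ZE /a3 mul_row_block !mul0mx !mul1mx !add0r.
have mb1 k (M : 'M_(k, s + t)) (N : 'M_(k, b)) : row_mx M N *m b1 = rsubmx M.
  by rewrite mul_row_col mulmx0 addr0 -{1}[M]hsubmxK mul_row_col mulmx0 mulmx1 add0r.
have mb2 k (M : 'M_(k, s + t)) (N : 'M_(k, b)) : row_mx M N *m b2 = lsubmx M - N *m X.
  by rewrite mul_row_col -{1}[M]hsubmxK mul_row_col mulmx0 mulmx1 addr0 mulmxN.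
have mb3 k (M : 'M_(k, s + t)) (N : 'M_(k, b)) : row_mx M N *m b3 = N.
  by rewrite mul_row_col mulmx0 mulmx1 add0r.
rewrite a1Z a2Z a3Z !mb1 !mb2 !mb3.
have ZJ : Z - block_mx 1%:M 0 0 0 = block_mx (A - 1%:M) C B D.
  by rewrite ZE opp_block_mx add_block_mx !subr0.
have [_ _ VE _] := sV.
have A1 : A - 1%:M = block_mx (ulsubmx A - 1%:M) (ursubmx A) (dlsubmx A) (drsubmx A - 1%:M).
  by rewrite -{1}[A]submxK (scalar_mx_block s t) opp_block_mx add_block_mx !subr0.
have rE : rsubmx (dsubmx A - Y *m B) = drsubmx A - Y *m rsubmx B.
  by rewrite linearB /= -mulmx_rsub.
have lE : lsubmx (dsubmx A - Y *m B) = dlsubmx A - Y *m lsubmx B.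
  by rewrite linearB /= lsubmx_mul.
rewrite rE lE; split.
  rewrite ZJ => ZV; have [A' [B2 [C1]]] := VE _ ZV.
  case/eq_block_mx=> _ CE BE DE; move: ZV; rewrite CE BE DE => /VP.
  rewrite A1 block_mxKdl block_mxKul block_mxKdr => -[dl ul dr].
  rewrite row_mxKl row_mxKr col_mxKu col_mxKd dl !mulmx0 !mul0mx !subr0.
  rewrite mul0mx subr0.
  by split=> //; apply/mem_translate; rewrite addrAC.
case=> /mem_translate Mdr /mem_translate Nul [e1 e2] [e3 D0].
rewrite D0 mulmx0 subr0 in e2; rewrite D0 mul0mx subr0 in e3.
rewrite D0 e2 e3 !mulmx0 !subr0 mul0mx subr0 in e1.
rewrite ZJ D0 -[B]hsubmxK e3 -[C]vsubmxK e2; apply/VP.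
by rewrite A1 block_mxKdl block_mxKul block_mxKdr e1 !(addrAC _ (- 1%:M)).
Qed.

Theorem corner_shift_wedge (F : fieldType) r a b (V : {vspace 'M[F]_(r + a, r + b)}) :
  has_elements F r.+2 -> (0 < b <= a)%N -> corner_shift V ->
  ('C(r, 2) + r * a <= \dim V)%N ->
  exists (s t : nat) (M : set 'M[F]_t) (N : set 'M[F]_s),
    [/\ r = (s + t)%N /\ ((b < a)%N -> s = 0%N), optimal M, optimal N &
      mx_equivalent (translate (block_mx 1%:M 0 0 0) V) (wedge (r + a) (r + b) M N)].
Proof.
move=> hF /andP[b0 ba] cV dV; have a0 := leq_trans b0 ba.
have [|maxW [E [inv EP]]] := corner_shift_split hF cV _ dV; first by rewrite b0.
have [s [t [rE dE]]] : exists s t, r = (s + t)%N /\ \dim E = s.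
  exists (\dim E), (r - \dim E)%N; split=> //; rewrite subnKC //.
  by have := dimvS (subvf E); rewrite dim_fullmx muln1.
have dr0 M : M \in V -> drsubmx M = 0.
  by rewrite -{1}[M]submxK => /(corner_shift_coefs hF cV)[].
subst r; have [P [Q [uP uQ PJQ cV' sV']]] := corner_shift_adapted cV maxW dE dr0 inv EP.
have [M [N [optM optN eqW]]] := split_shift_wedge hF a0 b0 cV' sV'.
exists s, t, M, N; split=> //.
  split=> // lt; apply/eqP; rewrite -leqn0; have := dim_split_shift hF a0 b0 sV'.
  rewrite dim_eqv // => /(_ dV); case: (s) => // k.
  by rewrite leq_mul2l /= leqNgt lt.
by apply: mx_equivalent_trans eqW; rewrite -{2}PJQ; apply: mx_equivalent_translate.
Qed.

Lemma affine_translate (F : fieldType) n p (S : set 'M[F]_(n, p)) d :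
  affine_subspace_dim S d ->
  exists J V, [/\ \dim V = d, S J & S = translate J V].
Proof.
case=> J [V [dV SE]]; exists J, V; split=> //.
by rewrite SE; exists 0; rewrite /= ?mem0v ?addr0.
Qed.

Theorem constant_rank_wedge (F : fieldType) n p r d (S : set 'M[F]_(n, p)) :
  has_elements F r.+2 -> (p <= n)%N -> (r < p)%N ->
  affine_subspace_dim S d -> constant_rank S r ->
  ('C(r, 2) + r * (n - r) <= d)%N ->
  exists (s t : nat) (M : set 'M[F]_t) (N : set 'M[F]_s),
    [/\ r = (s + t)%N /\ ((p < n)%N -> s = 0%N), optimal M, optimal N &
      mx_equivalent S (wedge n p M N)].
Proof.
move=> hF pn rp /affine_translate[J [V [dV SJ SE]]] cS dd.
have [a nE] : exists a, n = (r + a)%N by exists (n - r)%N; lia.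
have [b pE] : exists b, p = (r + b)%N by exists (p - r)%N; lia.
subst n p; have rJ : \rank J = r by apply: cS.
pose P := invmx (col_ebase J); pose Q := invmx (row_ebase J).
have uP : P \in unitmx by rewrite unitmx_inv col_ebase_unit.
have uQ : Q \in unitmx by rewrite unitmx_inv row_ebase_unit.
have PJQ : P *m J *m Q = block_mx 1%:M 0 0 0.
  rewrite /P /Q -{2}(mulmx_ebase J) !mulmxA mulVmx ?col_ebase_unit // mul1mx.
  by rewrite mulmxK ?row_ebase_unit // rJ pid_mx_block.
have [|||s [t [M [N [[rE s0] optM optN eqW]]]]] :=
    @corner_shift_wedge F r a b (eqv P Q V) hF.
- by lia.
- move=> M /memv_imgP[M' M'V ->]; rewrite lfunE /= -PJQ -mulmxDl -mulmxDr.
  by rewrite rank_mul_unit // cS // SE; exists M'.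
- by rewrite dim_eqv // dV; rewrite addKn in dd.
exists s, t, M, N; split=> //; first by split=> // lt; apply: s0; lia.
apply: mx_equivalent_trans eqW; rewrite SE -PJQ.
exact: mx_equivalent_translate.
Qed.

(** * Uniqueness of the wedge decomposition *)

(** What a wedge retains of its shape without reference to bases: [K] is spanned
    by the last [p - t] basis vectors, [G] by the first [s] ones, and the last
    clause expresses that the blocks [?] are arbitrary. *)
Definition wedge_frame (F : fieldType) n p (Y : set 'M[F]_(n, p))
    (K : {vspace 'cV[F]_p}) (G : {vspace 'cV[F]_n}) :=
  [/\ exists f, Y f,
    forall f, Y f -> (forall x, x \in K -> f *m x \in G) /\
                     (forall y, y \in G -> exists2 x, x \in K & f *m x = y) &
    exists2 g, g \notin G & forall f x y, Y f -> x \notin K -> y \in (G + <[g]>)%VS ->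
      exists h, [/\ Y (f + h), forall x', x' \in K -> h *m x' = 0 & h *m x = y]].

(** If [x] is in [K'] but not in [K], the images of [x] fill [G] and [g], too much
    for [G'].  So [K'] is contained in [K]; were it smaller, some matrix of [Y]
    could be modified to kill a vector of [K] outside [K'], while the kernels
    on [K] and [K'] have the same dimension. *)
Lemma wedge_frame_le (F : fieldType) n p (Y : set 'M[F]_(n, p)) K G K' G' :
  wedge_frame Y K G -> wedge_frame Y K' G' ->
  (\dim K + \dim G' = \dim K' + \dim G)%N -> (\dim G' <= \dim G)%N -> K = K'.
Proof.
move=> [[f Yf] fK [g gG hK]] [_ fK' [g' gG' hK']] dKG dG.
have subK : (K' <= K)%VS.
  apply/subvP=> x xK'; apply: contraT => xK.
  have : (G + <[g]> <= G')%VS.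
    apply/subvP=> y yG; have [h [Yfh _ hx]] := hK f x y Yf xK yG.
    have := (fK' _ Yfh).1 x xK'; rewrite mulmxDl hx => fy.
    by have := memvB fy ((fK' _ Yf).1 x xK'); rewrite addrC addKr.
  by move=> /dimvS; rewrite dim_add_line // ltnNge dG.
apply/eqP; rewrite eqEsubv subK andbT; apply/subvP=> x xK; apply: contraT => xK'.
have g'G : g' \in G.
  have [|h [Yfh _ hx]] := hK' f x g' Yf xK'; first by rewrite memvE addvSr.
  have := (fK _ Yfh).1 x xK; rewrite mulmxDl hx => fg.
  by have := memvB fg ((fK _ Yf).1 x xK); rewrite addrC addKr.
have [x1 x1K fx1] := (fK _ Yf).2 g' g'G.
have x1K' : x1 \notin K'.
  by apply: contra gG' => x1K'; rewrite -fx1; apply: (fK' _ Yf).1.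
have [|h [Yf1 _ hx1]] := hK' f x1 (- g') Yf x1K'; first by rewrite memvN memvE addvSr.
set f1 := f + h in Yf1; pose phi : 'Hom('cV[F]_p, 'cV[F]_n) := linfun (mulmx f1).
have imK : (phi @: K)%VS = G.
  apply/vspaceP=> y; apply/memv_imgP/idP => [[z zK ->]|yG].
    by rewrite lfunE /=; apply: (fK _ Yf1).1.
  by have [z zK <-] := (fK _ Yf1).2 y yG; exists z; rewrite // lfunE.
have imK' : (phi @: K')%VS = G'.
  apply/vspaceP=> y; apply/memv_imgP/idP => [[z zK ->]|yG].
    by rewrite lfunE /=; apply: (fK' _ Yf1).1.
  by have [z zK <-] := (fK' _ Yf1).2 y yG; exists z; rewrite // lfunE.
have d1 := limg_ker_dim phi K; have d2 := limg_ker_dim phi K'.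
rewrite imK in d1; rewrite imK' in d2.
have : (K' :&: lker phi)%VS == (K :&: lker phi)%VS.
  rewrite eqEdim capvS //=.
  by rewrite -(leq_add2r (\dim G + \dim G')) addnA d1 dKG addnCA d2 addnC.
move=> /eqP kerE; case/negP: x1K'.
have : x1 \in (K' :&: lker phi)%VS.
  by rewrite kerE memv_cap x1K memv_ker lfunE /= mulmxDl hx1 fx1 subrr eqxx.
by case/memv_capP.
Qed.

Lemma wedge_frame_unique (F : fieldType) n p (Y : set 'M[F]_(n, p)) K G K' G' :
  wedge_frame Y K G -> wedge_frame Y K' G' ->
  (\dim K + \dim G' = \dim K' + \dim G)%N -> K = K' /\ G = G'.
Proof.
move=> YK YK' dKG.
have KK' : K = K'.
  case/orP: (leq_total (\dim G') (\dim G)) => le; first exact: wedge_frame_le YK YK' _ _.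
  by apply/esym; apply: wedge_frame_le YK' YK _ _.
split=> //; have [[f Yf] fK _] := YK; have [_ fK' _] := YK'.
apply/vspaceP=> y; apply/idP/idP => yG.
  by have [x xK <-] := (fK _ Yf).2 y yG; apply: (fK' _ Yf).1; rewrite -KK'.
by have [x xK <-] := (fK' _ Yf).2 y yG; apply: (fK _ Yf).1; rewrite KK'.
Qed.

Lemma wedge_frame_equiv (F : fieldType) n p (Y : set 'M[F]_(n, p)) K G P Q :
  P \in unitmx -> Q \in unitmx -> wedge_frame Y K G ->
  wedge_frame [set P *m M *m Q | M in Y] (linfun (mulmx (invmx Q)) @: K)%VS
    (linfun (mulmx P) @: G)%VS.
Proof.
move=> uP uQ [[f0 Yf0] fK [g gG hK]].
set K1 := (_ @: K)%VS; set G1 := (_ @: G)%VS.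
have K1P x : (x \in K1) = (Q *m x \in K).
  apply/memv_imgP/idP => [[z zK ->]|QxK]; first by rewrite lfunE /= mulKVmx.
  by exists (Q *m x); rewrite // lfunE /= mulKmx.
have G1P y : (P *m y \in G1) = (y \in G).
  apply/memv_imgP/idP => [[z zG]|yG]; last by exists y; rewrite // lfunE.
  by rewrite lfunE /= => /(congr1 (mulmx (invmx P))); rewrite !mulKmx // => ->.
split; first by exists (P *m f0 *m Q), f0.
- move=> _ [f Yf <-]; split=> [x|y yG1].
    by rewrite K1P => xK; rewrite -!mulmxA G1P; apply: (fK _ Yf).1.
  have [|x xK fx] := (fK _ Yf).2 (invmx P *m y); first by rewrite -G1P mulKVmx.
  by exists (invmx Q *m x); rewrite ?K1P ?mulKVmx // -!mulmxA mulKVmx // fx mulKVmx.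
exists (P *m g); rewrite ?G1P // => _ x y [f Yf <-]; rewrite K1P => QxK yG.
have [|h [Yfh hK0 hx]] := hK f (Q *m x) (invmx P *m y) Yf QxK.
  case/memv_addP: yG => y1 y1G [y2 /vlineP[k ->] ->].
  rewrite mulmxDr -scalemxAr mulKmx // memv_add ?memvZ ?memv_line //.
  by rewrite -G1P mulKVmx.
exists (P *m h *m Q); split.
- by exists (f + h); rewrite // mulmxDr mulmxDl.
- by move=> x'; rewrite K1P => /hK0 h0; rewrite -!mulmxA h0 mulmx0.
by rewrite -!mulmxA hx mulKVmx.
Qed.

Definition first_kernel (F : fieldType) t q : {vspace 'cV[F]_(t + q)} :=
  lker (linfun (usubmx : 'cV[F]_(t + q) -> 'cV_t)).
Definition first_image (F : fieldType) s m : {vspace 'cV[F]_(s + m)} :=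
  lker (linfun (dsubmx : 'cV[F]_(s + m) -> 'cV_m)).

Lemma mem_first_kernel (F : fieldType) t q (x : 'cV[F]_(t + q)) :
  (x \in first_kernel F t q) = (usubmx x == 0).
Proof. by rewrite memv_ker lfunE. Qed.

Lemma mem_first_image (F : fieldType) s m (x : 'cV[F]_(s + m)) :
  (x \in first_image F s m) = (dsubmx x == 0).
Proof. by rewrite memv_ker lfunE. Qed.

Lemma dim_first_kernel (F : fieldType) t q : \dim (first_kernel F t q) = q.
Proof.
have := limg_ker_dim (linfun (usubmx : 'cV[F]_(t + q) -> 'cV_t)) fullv.
rewrite capfv [(_ @: _)%VS](_ : _ = fullv) ?dim_fullmx ?muln1.
  by move=> /eqP; rewrite addnC eqn_add2l => /eqP.
apply/vspaceP=> y; rewrite memvf; apply/memv_imgP; exists (col_mx y 0); rewrite ?memvf //.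
by rewrite lfunE /= col_mxKu.
Qed.

Lemma dim_first_image (F : fieldType) s m : \dim (first_image F s m) = s.
Proof.
have := limg_ker_dim (linfun (dsubmx : 'cV[F]_(s + m) -> 'cV_m)) fullv.
rewrite capfv [(_ @: _)%VS](_ : _ = fullv) ?dim_fullmx ?muln1.
  by move=> /eqP; rewrite eqn_add2r => /eqP.
apply/vspaceP=> y; rewrite memvf; apply/memv_imgP; exists (col_mx 0 y); rewrite ?memvf //.
by rewrite lfunE /= col_mxKd.
Qed.

Lemma dim_mulmx_unit (F : fieldType) n (P : 'M[F]_n) (U : {vspace 'cV[F]_n}) :
  P \in unitmx -> \dim (linfun (mulmx P) @: U) = \dim U.
Proof.
move=> uP; apply: limg_dim_eq; apply/eqP; rewrite -subv0; apply/subvP=> x /memv_capP[_].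
by rewrite memv_ker lfunE /= memv0 => /eqP Px; rewrite -[x](mulKmx uP) Px mulmx0.
Qed.

Lemma optimal_nonempty (F : fieldType) s (W : set 'M[F]_s) : optimal W -> exists A, W A.
Proof.
by case=> [[A [V [_ ->]]] _]; exists A, 0; rewrite ?addr0 //= mem0v.
Qed.

Lemma wedge_frame_blocks (F : fieldType) s t m q (MM : set 'M[F]_t) (NN : set 'M[F]_s) :
  (0 < m)%N -> optimal MM -> optimal NN ->
  wedge_frame (wedge (s + (t + m)) (t + (s + q)) MM NN)
    (first_kernel F t (s + q)) (first_image F s (t + m)).
Proof.
move=> m0 optM optN; rewrite (wedgeE (erefl (s + (t + m))) (erefl (t + (s + q)))).
split.
- have [M MM1] := optimal_nonempty optM; have [N NN1] := optimal_nonempty optN.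
  by exists (block_mx 0 (row_mx N 0) (col_mx M 0) 0), M, N, 0, 0, 0; rewrite castmx_id.
- move=> _ [M [N [A [C [D [MM1 NN1 ->]]]]]]; rewrite castmx_id; split=> [x|y].
    rewrite mem_first_kernel mem_first_image => /eqP x0.
    rewrite -[x]vsubmxK x0 mul_block_col !mulmx0 mul0mx !add0r.
    by apply/eqP; apply: col_mxKd.
  rewrite mem_first_image => /eqP y0.
  exists (col_mx 0 (col_mx (invmx N *m usubmx y) 0)).
    by rewrite mem_first_kernel; apply/eqP; apply: col_mxKu.
  rewrite mul_block_col !mulmx0 mul0mx !add0r mul_row_col mulmx0 addr0 mulKVmx.
    by rewrite -{2}[y]vsubmxK y0.
  exact: (optN.2 _ NN1).
exists (col_mx 0 (col_mx 0 (const_mx 1))).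
  rewrite mem_first_image col_mxKd col_mx_eq0 negb_and; apply/orP; right.
  apply/eqP=> /matrixP/(_ (Ordinal m0) 0)/eqP; rewrite !mxE oner_eq0 //.
move=> _ x y [M [N [A [C [D [MM1 NN1 ->]]]]]]; rewrite castmx_id mem_first_kernel => x0 yG.
have [y1 [y3 ->]] : exists y1 y3, y = col_mx y1 (col_mx 0 y3).
  case/memv_addP: yG => z + [z' /vlineP[k ->] ->]; rewrite mem_first_image => /eqP z0.
  exists (usubmx z), (k *: const_mx 1).
  by rewrite -{1}[z]vsubmxK z0 !scale_col_mx !scaler0 add_col_mx addr0 add0r.
have [|l [lx _]] := @separation F t 0%VS (usubmx x); first by rewrite memv0.
exists (block_mx (y1 *m l) 0 (col_mx 0 (y3 *m l)) 0); split.
- exists M, N, (A + y1 *m l), C, (D + y3 *m l); split=> //.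
  by rewrite castmx_id add_block_mx add_col_mx !addr0.
- move=> x'; rewrite mem_first_kernel => /eqP x'0.
  by rewrite -[x']vsubmxK x'0 mul_block_col !mulmx0 !mul0mx !addr0 col_mx0.
rewrite -{1}[x]vsubmxK mul_block_col !mul0mx !addr0 mul_col_mx mul0mx.
by rewrite -!mulmxA lx !mulmx1.
Qed.

Theorem wedge_sizes_unique (F : fieldType) n p s t s' t' (M : set 'M[F]_t) (N : set 'M[F]_s)
    (M' : set 'M[F]_t') (N' : set 'M[F]_s') :
  (s + t = s' + t')%N -> (s + t < n)%N -> (s + t <= p)%N ->
  optimal M -> optimal N -> optimal M' -> optimal N' ->
  mx_equivalent (wedge n p M N) (wedge n p M' N') -> s = s' /\ t = t'.
Proof.
move=> rE rn rp optM optN optM' optN' [P [Q [uP uQ YE]]].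
have frame s1 t1 (M1 : set 'M[F]_t1) (N1 : set 'M[F]_s1) : (s1 + t1 = s + t)%N ->
    optimal M1 -> optimal N1 -> exists K G, [/\ wedge_frame (wedge n p M1 N1) K G,
      (\dim K + t1 = p)%N & \dim G = s1].
  move=> e1 oM oN.
  have en : (s1 + (t1 + (n - (s1 + t1))) = n)%N by lia.
  have ep : (t1 + (s1 + (p - (s1 + t1))) = p)%N by lia.
  have m0 : (0 < n - (s1 + t1))%N by lia.
  have fr := @wedge_frame_blocks F s1 t1 _ (p - (s1 + t1)) M1 N1 m0 oM oN.
  move: fr; move: (n - (s1 + t1))%N en (p - (s1 + t1))%N ep => m en q ep fr.
  clear - fr en ep; subst n p; exists (first_kernel F t1 (s1 + q)), (first_image F s1 (t1 + m)).
  by split; [exact: fr | rewrite dim_first_kernel addnC | exact: dim_first_image].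
have [K [G [YK dK dG]]] := frame s t M N erefl optM optN.
have [K' [G' [YK' dK' dG']]] := frame s' t' M' N' (esym rE) optM' optN'.
have YK1 := wedge_frame_equiv uP uQ YK; rewrite -YE in YK1.
have [|KE GE] := wedge_frame_unique YK1 YK'; first by rewrite !dim_mulmx_unit ?unitmx_inv //; lia.
have : \dim G = \dim G' by rewrite -GE dim_mulmx_unit.
rewrite dG dG'; lia.
Qed.

(** A nonzero block [P2] would make [P1 M1 + P2 D] singular for some [D]. *)
Lemma column_classes_unique (F : fieldType) t m (M M' : set 'M[F]_t)
    (P : 'M[F]_(t + m)) (Q : 'M[F]_t) :
  (exists A, M A) -> M `<=` [set A | A \in unitmx] -> M' `<=` [set A | A \in unitmx] ->
  (forall A D, M A -> exists A' D', M' A' /\ P *m col_mx A D *m Q = col_mx A' D') ->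
  (forall A', M' A' -> exists A D, M A /\ P *m col_mx A D *m Q = col_mx A' 0) ->
  mx_equivalent M M'.
Proof.
move=> [A0 MA0] uM uM' MM' M'M.
pose P1 := ulsubmx P; pose P2 := ursubmx P.
have PE A D A' D' : P *m col_mx A D *m Q = col_mx A' D' -> (P1 *m A + P2 *m D) *m Q = A'.
  rewrite -{1}[P]submxK mul_block_col mul_col_mx => /eq_col_mx[-> _] //.
have step A D : M A -> (P1 *m A + P2 *m D) *m Q \in unitmx.
  by move=> /(MM' A D)[A' [D' [M'A' /PE ->]]]; apply: uM'.
have := step A0 0 MA0; rewrite mulmx0 addr0 !unitmx_mul => /andP[/andP[uP1 _] uQ].
have P20 : P2 = 0.
  apply: mx_eq0_forms => y d; rewrite -mulmxA; have [->|v0] := eqVneq (P2 *m d) 0.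
    by rewrite mulmx0.
  have uA0 := uM _ MA0; pose x := invmx (P1 *m A0) *m (P2 *m d).
  have u1 : P1 *m A0 \in unitmx by rewrite unitmx_mul uP1.
  have [|l [lx _]] := @separation F t 0%VS x.
    rewrite memv0; apply: contraNneq v0 => x0.
    by rewrite -[P2 *m d](mulKVmx u1) -/x x0 mulmx0.
  have := step A0 (- (d *m l)) MA0; rewrite unitmx_mul => /andP[/unitmx_injP inj _].
  have x0 : x = 0.
    by apply: inj; rewrite mulmxDl /x mulKVmx // -/x mulmxN mulNmx -!mulmxA lx mulmx1 addrN.
  by move: lx; rewrite x0 mulmx0 => /eqP; rewrite eq_sym (negPf (neq0_11 _)).
exists P1, Q; split=> //; apply/seteqP; split=> [A' /M'M[A [D [MA /PE]]]|_ [A MA <-]].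
  by rewrite P20 mul0mx addr0 => <-; exists A.
by have [A' [D' [M'A' /PE]]] := MM' A 0 MA; rewrite mulmx0 addr0 => ->.
Qed.

Lemma mx_equivalent_tr (F : fieldType) s (N N' : set 'M[F]_s) :
  mx_equivalent [set A | N A^T] [set A | N' A^T] -> mx_equivalent N N'.
Proof.
case=> P [Q [uP uQ NE]]; exists Q^T, P^T; rewrite !unitmx_tr; split=> //.
apply/seteqP; split=> [A N'A|_ [A NA <-]].
  have : [set A | N' A^T] A^T by rewrite /= trmxK.
  rewrite NE => -[B NB BE]; exists B^T => //.
  by rewrite -trmx_mul -trmx_mul mulmxA BE trmxK.
have : [set A | N' A^T] (P *m A^T *m Q) by rewrite NE; exists A^T; rewrite /= ?trmxK.
by rewrite /= !trmx_mul trmxK mulmxA.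
Qed.

(** By [wedge_frame_unique] the two equivalence matrices are block triangular;
    they then act separately on the first column block [M, ?] and on the first
    row block [N, ?]. *)
Theorem wedge_classes_unique (F : fieldType) n p s t (M M' : set 'M[F]_t)
    (N N' : set 'M[F]_s) :
  (s + t < n)%N -> (s + t <= p)%N ->
  optimal M -> optimal N -> optimal M' -> optimal N' ->
  mx_equivalent (wedge n p M N) (wedge n p M' N') ->
  mx_equivalent M M' /\ mx_equivalent N N'.
Proof.
move=> rn rp oM oN oM' oN'.
have en : (s + (t + (n - (s + t))) = n)%N by lia.
have ep : (t + (s + (p - (s + t))) = p)%N by lia.
have m0 : (0 < n - (s + t))%N by lia.
move: (n - (s + t))%N en (p - (s + t))%N ep m0 => m en q ep m0; clear rn rp.
subst n p => -[P [Q [uP uQ YE]]].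
have fr := wedge_frame_blocks q m0 oM oN; have fr' := wedge_frame_blocks q m0 oM' oN'.
have fr1 := wedge_frame_equiv uP uQ fr; rewrite -YE in fr1.
have [|KE GE] := wedge_frame_unique fr1 fr'; first by rewrite !dim_mulmx_unit ?unitmx_inv.
have Q12 : ursubmx Q = 0.
  apply: mx_eq0_forms => y x; rewrite -mulmxA.
  have : Q *m col_mx 0 x \in first_kernel F t (s + q).
    have : col_mx 0 x \in first_kernel F t (s + q).
      by rewrite mem_first_kernel; apply/eqP; apply: col_mxKu.
    by rewrite -{1}KE => /memv_imgP[z zK]; rewrite lfunE /= => ->; rewrite mulKVmx.
  rewrite mem_first_kernel -{1}[Q]submxK mul_block_col col_mxKu mulmx0 add0r => /eqP ->.
  by rewrite mulmx0.
have P21 : dlsubmx P = 0.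
  apply: mx_eq0_forms => y x; rewrite -mulmxA.
  have : P *m col_mx x 0 \in first_image F s (t + m).
    rewrite -GE; apply/memv_imgP; exists (col_mx x 0); last by rewrite lfunE.
    by rewrite mem_first_image; apply/eqP; apply: col_mxKd.
  rewrite mem_first_image -{1}[P]submxK mul_block_col col_mxKd mulmx0 addr0 => /eqP ->.
  by rewrite mulmx0.
have PXQ (A : 'M_(s, t)) (R : 'M_(s, s + q)) (L : 'M_(t + m, t)) :
    dlsubmx (P *m block_mx A R L 0 *m Q) = drsubmx P *m L *m ulsubmx Q /\
    ursubmx (P *m block_mx A R L 0 *m Q) = ulsubmx P *m R *m drsubmx Q.
  rewrite -{1 3}[P]submxK -{1 3}[Q]submxK Q12 P21 !mulmx_block block_mxKdl block_mxKur.
  by rewrite !mul0mx !mulmx0 ?add0r ?addr0 ?mul0mx ?add0r ?addr0.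
have [M0 MM0] := optimal_nonempty oM; have [N0 NN0] := optimal_nonempty oN.
have [M0' MM0'] := optimal_nonempty oM'; have [N0' NN0'] := optimal_nonempty oN'.
have fwd A D N1 C : M A -> N N1 -> exists A' D' N1' C', [/\ M' A', N' N1',
    drsubmx P *m col_mx A D *m ulsubmx Q = col_mx A' D' &
    ulsubmx P *m row_mx N1 C *m drsubmx Q = row_mx N1' C'].
  move=> MA NN1; have : wedge (s + (t + m)) (t + (s + q)) M' N'
      (P *m block_mx 0 (row_mx N1 C) (col_mx A D) 0 *m Q).
    rewrite YE; exists (block_mx 0 (row_mx N1 C) (col_mx A D) 0) => //.
    rewrite (wedgeE (erefl (s + (t + m))) (erefl (t + (s + q)))).
    by exists A, N1, 0, C, D; rewrite castmx_id.
  rewrite (wedgeE (erefl (s + (t + m))) (erefl (t + (s + q)))).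
  case=> A' [N1' [B [C' [D' [MA' NN1']]]]]; rewrite castmx_id => XE.
  have [dl ur] := PXQ 0 (row_mx N1 C) (col_mx A D).
  by exists A', D', N1', C'; rewrite -dl -ur XE block_mxKdl block_mxKur.
have bwd A' D' N1' C' : M' A' -> N' N1' -> exists A D N1 C, [/\ M A, N N1,
    drsubmx P *m col_mx A D *m ulsubmx Q = col_mx A' D' &
    ulsubmx P *m row_mx N1 C *m drsubmx Q = row_mx N1' C'].
  move=> MA NN1; have : wedge (s + (t + m)) (t + (s + q)) M' N'
      (block_mx 0 (row_mx N1' C') (col_mx A' D') 0).
    rewrite (wedgeE (erefl (s + (t + m))) (erefl (t + (s + q)))).
    by exists A', N1', 0, C', D'; rewrite castmx_id.
  rewrite YE => -[X]; rewrite (wedgeE (erefl (s + (t + m))) (erefl (t + (s + q)))).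
  case=> A [N1 [B [C [D [MA' NN1' ->]]]]]; rewrite castmx_id => XE.
  have [dl ur] := PXQ B (row_mx N1 C) (col_mx A D).
  by exists A, D, N1, C; rewrite -dl -ur XE block_mxKdl block_mxKur.
split.
  apply: (column_classes_unique (P := drsubmx P) (Q := ulsubmx Q)).
  - by exists M0.
  - by have [] := oM.
  - by have [] := oM'.
  - by move=> A D MA; have [A' [D' [_ [_ [MA' _ e _]]]]] := fwd A D N0 0 MA NN0; exists A', D'.
  by move=> A' MA'; have [A [D [_ [_ [MA _ e _]]]]] := bwd A' 0 N0' 0 MA' NN0'; exists A, D.
apply: mx_equivalent_tr.
have trE A (D : 'M_(q, s)) N1 (C : 'M_(s, q)) :
    ulsubmx P *m row_mx A^T D^T *m drsubmx Q = row_mx N1 C ->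
    (drsubmx Q)^T *m col_mx A D *m (ulsubmx P)^T = col_mx N1^T C^T.
  move=> e; rewrite -tr_row_mx -e !trmx_mul tr_row_mx !trmxK mulmxA //.
apply: (column_classes_unique (P := (drsubmx Q)^T) (Q := (ulsubmx P)^T)).
- by exists N0^T; rewrite /= trmxK.
- by move=> A /= /(oN.2 _); rewrite /= unitmx_tr.
- by move=> A /= /(oN'.2 _); rewrite /= unitmx_tr.
- move=> A D NA; have [_ [_ [N1 [C [_ NN1 _ e]]]]] := fwd M0 0 A^T D^T MM0 NA.
  by exists N1^T, C^T; rewrite /= trmxK; split=> //; apply: trE.
move=> A' NA'; have [_ [_ [N1 [C [_ NN1 _ e]]]]] := bwd M0' 0 A'^T 0 MM0' NA'.
exists N1^T, C^T; rewrite /= trmxK; split=> //.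
by rewrite -[A']trmxK -[0 in RHS]trmx0; apply: trE; rewrite !trmxK.
Qed.

(** * The greatest dimension, and the case [s = 0] *)

Lemma dim_ge_ker_img (F : fieldType) (aT rT : vectType F) (f : 'Hom(aT, rT))
    (U K : {vspace aT}) (I : {vspace rT}) :
  (forall u, u \in K -> u \in U /\ f u = 0) ->
  (forall v, v \in I -> exists2 u, u \in U & f u = v) ->
  (\dim K + \dim I <= \dim U)%N.
Proof.
move=> KU IU; rewrite -(limg_ker_dim f U); apply: leq_add; apply: dimvS; apply/subvP=> u.
  by move=> /KU[uU fu]; rewrite memv_cap uU memv_ker fu eqxx.
by move=> /IU[v vU <-]; apply: memv_img.
Qed.

Lemma dim_injective_img (F : fieldType) (aT rT : vectType F) (f : 'Hom(aT, rT)) :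
  (forall u, f u = 0 -> u = 0) -> \dim (f @: fullv) = \dim {:aT}.
Proof.
move=> injf; apply: limg_dim_eq; apply/eqP; rewrite -subv0; apply/subvP=> u.
by case/memv_capP=> _; rewrite memv_ker memv0 => /eqP/injf ->.
Qed.

(** The strictly upper triangular matrices, built one row at a time. *)
Lemma max_unit_shift_exists (F : fieldType) r :
  exists W : {vspace 'M[F]_r}, max_unit_shift W.
Proof.
elim: r => [|k [W [uW dW]]].
  by exists 0%VS; split=> // M x _ _; apply/matrixP=> i; have := ltn_ord i.
rewrite -[k.+1]/(1 + k)%N.
pose ul := linfun (lsubmx \o usubmx : 'M[F]_(1 + k) -> 'M_1).
pose dl := linfun (lsubmx \o dsubmx : 'M[F]_(1 + k) -> 'M_(k, 1)).
pose dr := linfun (rsubmx \o dsubmx : 'M[F]_(1 + k) -> 'M_k).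
pose U : {vspace 'M[F]_(1 + k)} := (lker ul :&: (lker dl :&: dr @^-1: W))%VS.
have UP (M : 'M_(1 + k)) : M \in U <-> exists l K, K \in W /\ M = block_mx 0 l 0 K.
  rewrite !memv_cap !memv_ker -memv_preim !lfunE /=.
  rewrite -/(ulsubmx M) -/(dlsubmx M) -/(drsubmx M); split.
    move=> /and3P[/eqP ul0 /eqP dl0 KW]; exists (ursubmx M), (drsubmx M); split=> //.
    by rewrite -{1}[M]submxK ul0 dl0.
  by case=> l [K [KW ->]]; rewrite block_mxKul block_mxKdl block_mxKdr !eqxx.
exists U; split.
  apply/unit_shiftP=> M /UP[l [K [KW ->]]].
  rewrite (scalar_mx_block 1 k) add_block_mx !add0r addr0 unitmxE det_ublock det1 mul1r.
  by rewrite -unitmxE; apply: (unit_shiftP W).1.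
pose h := linfun (mulmxr (row_mx 0 1%:M : 'M_(k, 1 + k)) \o
  mulmx (col_mx 1%:M 0 : 'M_(1 + k, 1)) : 'rV[F]_k -> 'M[F]_(1 + k)).
have hE l : h l = block_mx 0 l 0 0.
  by rewrite lfunE /= mul_col_mx mul1mx mul0mx mul_col_row !mulmx1 !mulmx0.
have dh : \dim (h @: fullv) = k.
  rewrite dim_injective_img ?dim_fullmx ?mul1n // => l; rewrite hE.
  by rewrite -(block_mx0 F 1 k 1 k) => /eq_block_mx[].
have := @dim_ge_ker_img F _ _ dr U (h @: fullv)%VS W.
rewrite dh binS bin1 => le; apply: leq_trans (le _ _).
- by rewrite addnC leq_add2l.
- move=> M /memv_imgP[l _ ->]; rewrite hE lfunE /=; split.
    by apply/UP; exists l, 0; rewrite mem0v.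
  by rewrite -/(drsubmx _) block_mxKdr.
move=> K KW; exists (block_mx 0 0 0 K); last by rewrite lfunE /= -/(drsubmx _) block_mxKdr.
by apply/UP; exists 0, K.
Qed.

(** A maximal [W] and an arbitrary block below it: this is what bounds the
    greatest dimension from below. *)
Lemma constant_rank_example (F : fieldType) n p r : (r <= n)%N -> (r <= p)%N ->
  exists (X : set 'M[F]_(n, p)) k, [/\ affine_subspace_dim X k, constant_rank X r &
    ('C(r, 2) + r * (n - r) <= k)%N].
Proof.
move=> rn rp; have [a nE] : exists a, n = (r + a)%N by exists (n - r)%N; lia.
have [b pE] : exists b, p = (r + b)%N by exists (p - r)%N; lia.
subst n p; rewrite addKn; have [W [uW dW]] := max_unit_shift_exists F r.
pose ul := linfun (lsubmx \o usubmx : 'M[F]_(r + a, r + b) -> 'M_r).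
pose rr := linfun (rsubmx : 'M[F]_(r + a, r + b) -> 'M_(r + a, b)).
pose U : {vspace 'M[F]_(r + a, r + b)} := (lker rr :&: ul @^-1: W)%VS.
have UP M : M \in U <-> exists A B, A \in W /\ M = block_mx A 0 B 0.
  rewrite !memv_cap memv_ker -memv_preim !lfunE /= -/(ulsubmx M); split.
    move=> /andP[/eqP r0 KW]; exists (ulsubmx M), (dlsubmx M); split=> //.
    rewrite -{1}[M]submxK; congr block_mx.
      by rewrite -[LHS]/(rsubmx (usubmx M)) -[usubmx M]hsubmxK row_mxKr;
        apply/matrixP=> i j; have /matrixP/(_ (lshift a i) j) := r0; rewrite !mxE.
    by apply/matrixP=> i j; have /matrixP/(_ (rshift r i) j) := r0; rewrite !mxE.
  case=> A [B [AW ->]]; rewrite block_mxKul AW andbT block_mxEh row_mxKr col_mx0 eqxx //.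
pose J : 'M[F]_(r + a, r + b) := block_mx 1%:M 0 0 0.
exists (translate J U), (\dim U); split.
- by exists J, U.
- move=> _ [M /UP[A [B [AW ->]]] <-]; rewrite /J add_block_mx !add0r.
  have uA : 1%:M + A \in unitmx by apply: (unit_shiftP W).1.
  apply/eqP; rewrite eqn_leq; apply/andP; split.
    have -> : block_mx (1%:M + A) 0 B 0 =
        col_mx (1%:M + A) B *m row_mx 1%:M 0 :> 'M_(r + a, r + b).
      by rewrite mul_col_row !mulmx1 !mulmx0.
    exact: mulmx_max_rank.
  rewrite -[X in (X <= _)%N](mxrank_unit uA).
  have e : 1%:M + A = row_mx 1%:M 0 *m block_mx (1%:M + A) 0 B 0 *m
      (col_mx 1%:M 0 : 'M_(r + b, r)).
    by rewrite mul_row_block mul_row_col !mul1mx !mul0mx !mulmx0 mulmx1 !addr0.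
  by rewrite {1}e; apply: leq_trans (mxrankM_maxl _ _) (mxrankM_maxr _ _).
pose h := linfun (mulmxr (row_mx 1%:M 0 : 'M_(r, r + b)) \o
  mulmx (col_mx 0 1%:M : 'M_(r + a, a)) : 'M[F]_(a, r) -> 'M[F]_(r + a, r + b)).
have hE B : h B = block_mx 0 0 B 0.
  by rewrite lfunE /= mul_col_mx mul1mx mul0mx mul_col_row !mulmx1 !mulmx0.
have dh : \dim (h @: fullv) = (a * r)%N.
  rewrite dim_injective_img ?dim_fullmx // => B; rewrite hE.
  by rewrite -(block_mx0 F r a r b) => /eq_block_mx[].
have := @dim_ge_ker_img F _ _ ul U (h @: fullv)%VS W.
rewrite dh => le; apply: leq_trans (le _ _).
- by rewrite addnC mulnC leq_add2l.
- move=> M /memv_imgP[B _ ->]; rewrite hE lfunE /= -/(ulsubmx _) block_mxKul; split=> //.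
  by apply/UP; exists 0, B; rewrite mem0v.
move=> A AW; exists (block_mx A 0 0 0); last by rewrite lfunE /= -/(ulsubmx _) block_mxKul.
by apply/UP; exists A, 0.
Qed.

Lemma has_elements_of_card (F : fieldType) k :
  (`I_k #<= [set: F])%card -> has_elements F k.
Proof.
move=> /card_leP[f].
pose g (i : 'I_k) : F := val (f (SigSub (mem_set (ltn_ord i : `I_k i)))).
exists [seq g i | i <- enum 'I_k]; rewrite size_map size_enum_ord; split=> //.
rewrite map_inj_uniq ?enum_uniq // => i j /val_inj/(@inj _ _ _ f).
by rewrite !inE => /(_ I I) /(congr1 val) /= ij; apply: val_inj.
Qed.

Lemma col_mx_thin (F : fieldType) m n (A : 'M[F]_(0, n)) (B : 'M[F]_(m, n)) :
  col_mx A B = B :> 'M[F]_(0 + m, n).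
Proof.
apply/matrixP=> i j; rewrite -[LHS]/(col_mx A B (i : 'I_(0 + m)) j).
have -> : i = rshift 0 (i : 'I_m) :> 'I_(0 + m) by apply: val_inj.
by rewrite col_mxEd; congr (B _ j); apply: val_inj.
Qed.

Lemma extended_spaceE (F : fieldType) n p t (W : set 'M[F]_t) (N : set 'M[F]_0) :
  (exists A, N A) -> extended_space n p W = wedge n p W N.
Proof.
move=> [N0 NN0].
have blockE m q (A : 'M[F]_t) (B : 'M[F]_(m, t)) (A0 : 'M[F]_(0, t)) (R : 'M[F]_(0, 0 + q)) :
    block_mx A0 R (col_mx A B) 0 = block_mx A 0 B 0 :> 'M[F]_(0 + (t + m), t + (0 + q)).
  by rewrite block_mxEv col_mx_thin (block_mxEh A) col_mx0.
apply/seteqP; split=> X.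
  case=> en [ep [A [B [WA ->]]]]; exists en, ep, A, N0, 0, 0, B; split=> //.
  by rewrite blockE.
case=> en [ep [M [N1 [A [C [D [WM _ ->]]]]]]]; exists en, ep, M, D; split=> //.
by rewrite blockE.
Qed.

(** * The classification *)

Theorem theorem1p3 (F : fieldType) (n p r d : nat) (S : set 'M[F]_(n, p))
    (hnp : (p <= n)%N) (hpr : (r < p)%N) (hr : (0 < r)%N)
    (hF : (`I_r.+2 #<= [set: F])%card)
    (hd : greatest_constant_rank_dim F n p r d)
    (hS : affine_subspace_dim S d) (hrk : constant_rank S r) :
  ((p < n)%N ->
     (exists W : set 'M[F]_r,
        optimal W /\ mx_equivalent S (extended_space n p W)) /\
     (forall (S' : set 'M[F]_(n, p)) (W W' : set 'M[F]_r),
        mx_equivalent S S' -> optimal W -> optimal W' ->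
        mx_equivalent S (extended_space n p W) ->
        mx_equivalent S' (extended_space n p W') ->
        mx_equivalent W W'))
  /\
  (n = p ->
     (exists (s t : nat) (M : set 'M[F]_t) (N : set 'M[F]_s),
        [/\ r = (s + t)%N, optimal M, optimal N &
            mx_equivalent S (wedge n p M N)]) /\
     (forall (S' : set 'M[F]_(n, p)) (s t s' t' : nat)
             (M : set 'M[F]_t) (N : set 'M[F]_s)
             (M' : set 'M[F]_t') (N' : set 'M[F]_s'),
        mx_equivalent S S' -> r = (s + t)%N -> r = (s' + t')%N ->
        optimal M -> optimal N -> optimal M' -> optimal N' ->
        mx_equivalent S (wedge n p M N) ->
        mx_equivalent S' (wedge n p M' N') ->
        s = s' /\ t = t') /\
     (forall (S' : set 'M[F]_(n, p)) (s t : nat)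
             (M M' : set 'M[F]_t) (N N' : set 'M[F]_s),
        mx_equivalent S S' -> r = (s + t)%N ->
        optimal M -> optimal N -> optimal M' -> optimal N' ->
        mx_equivalent S (wedge n p M N) ->
        mx_equivalent S' (wedge n p M' N') ->
        mx_equivalent M M' /\ mx_equivalent N N')).
Proof.
have hF2 : has_elements F r.+2 := has_elements_of_card hF.
have rn : (r < n)%N := leq_trans hpr hnp.
have [X [k [dX cX le]]] := constant_rank_example F (ltnW rn) (ltnW hpr).
have dd := leq_trans le (hd.2 X k dX cX).
have [s [t [M [N [[rE s0] oM oN SMN]]]]] := constant_rank_wedge hF2 hnp hpr hS hrk dd.
have unique s1 t1 s2 t2 (M1 : set 'M[F]_t1) (N1 : set 'M[F]_s1) (M2 : set 'M[F]_t2)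
    (N2 : set 'M[F]_s2) S' : mx_equivalent S S' ->
    mx_equivalent S (wedge n p M1 N1) -> mx_equivalent S' (wedge n p M2 N2) ->
    mx_equivalent (wedge n p M1 N1) (wedge n p M2 N2).
  move=> SS' S1 S2; apply: mx_equivalent_trans (mx_equivalent_sym S1) _.
  exact: mx_equivalent_trans SS' S2.
split=> [lt|_].
  split.
    move: (s0 lt) => s00; subst s; rewrite add0n in rE; subst t.
    exists M; split=> //; rewrite (extended_spaceE n p M (N := N)) //.
    exact: optimal_nonempty oN.
  move=> S' W W' SS' oW oW'.
  have opt0 : optimal [set 0 : 'M[F]_0].
    split; last by move=> A _; rewrite /= unitmxE det_mx00 unitr1.
    exists 0, 0%VS; rewrite dimv0; split=> //; apply/seteqP; split=> A _ /=.
      by exists 0; [apply: mem0v | rewrite [A]thinmx0 addr0].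
    by rewrite [A]thinmx0.
  rewrite !(extended_spaceE n p _ (optimal_nonempty opt0)) => SW SW'.
  have [] := @wedge_classes_unique F n p 0 r _ _ _ _ rn (ltnW hpr) oW opt0 oW' opt0 _ => //.
  exact: unique SS' SW SW'.
split; first by exists s, t, M, N.
split=> [S' s1 t1 s2 t2 M1 N1 M2 N2 SS' r1 r2 oM1 oN1 oM2 oN2 S1 S2|
         S' s1 t1 M1 M2 N1 N2 SS' r1 oM1 oN1 oM2 oN2 S1 S2].
  apply: (wedge_sizes_unique _ _ _ oM1 oN1 oM2 oN2 (unique _ _ _ _ _ _ _ _ _ SS' S1 S2)).
  - by rewrite -r1.
  - by rewrite -r1.
  - by rewrite -r1 ltnW.
apply: (wedge_classes_unique _ _ oM1 oN1 oM2 oN2 (unique _ _ _ _ _ _ _ _ _ SS' S1 S2)).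
- by rewrite -r1.
- by rewrite -r1 ltnW.
Qed.
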